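(* Let $V$ be a finite dimensional graded vector space over a field $\mathbb K$ of characteristic $0$. (i) Let $(\mathcal C(V)|_S,\{\ ,\ \}|,\Omega)$ be a Pinczon Lie algebra. Then there is a unique symplectic form $B$ on $V[1]$ (the one associated to the Pinczon bracket $\{\ ,\ \}$) and a unique $B$-quadratic coderivation $Q$ of $(S^+(V[1]),\Delta)$ such that $\Omega=\Omega_Q$. (ii) Conversely, if $V$ is equipped with a degree $0$, non degenerate, symmetric bilinear form $b$, with associated symplectic form $B$ on $V[1]$ and associated Pinczon bracket $\{\ ,\ \}$, then any $B$-quadratic structure $Q$ of $L_\infty$ algebra on $V$ defines a unique Pinczon Lie algebra $(\mathcal C(V)|_S,\{\ ,\ \}|,\Omega_Q)$.
   Context: Grading and signs. $|x|$ is the degree of a homogeneous $x\in V$; $V[1]$ is the same space with degree $\deg(x)=|x|-1$. Multilinear forms on $V[1]$ are graded with scalars in degree $0$. Koszul's sign rule is used everywhere: each term in which graded letters appear in an order differing from that of the first term by a permutation $\sigma$ carries the implicit sign of $\sigma$ computed by taking into account only the letters of odd degree (for $\deg$). Cyclic forms. An $n$-linear form on $V[1]$ is cyclic if $\Omega(x_n,x_1,\ldots,x_{n-1})=\Omega(x_1,\ldots,x_n)$ (Koszul sign); $\mathcal C^n$ is the space of these, $\mathcal C^0=\mathbb K$, and $\mathcal C(V)$ is the space of all cyclic multilinear forms. $\Omega^{Cycl}$ denotes the sum of the images of an $n$-linear $\Omega$ under the cyclic group generated by $(1,2,\ldots,n)$. Pinczon bracket. A Pinczon bracket on $\mathcal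 C(V)$ is a bilinear map $\{\ ,\ \}$ such that: (1) $\{\mathcal C^{k+1},\mathcal C^{k'+1}\}\subset\mathcal C^{k+k'}$; (2) it is a graded Lie bracket; (3) $\{\alpha,(\beta_1\otimes\cdots\otimes\beta_k)^{Cycl}\}=\sum_j\{\alpha,\beta_j\}(\beta_1\otimes\cdots\hat{\beta_j}\cdots\otimes\beta_k)^{Cycl}$ for linear forms $\alpha,\beta_j$; (4) $\{\Omega,\mathcal C(V)\}=0$ iff $\Omega\in\mathcal C^0$. Such brackets correspond bijectively to degree $0$, symmetric, non degenerate bilinear forms $b$ on $V$ through $\{\Omega,\Omega'\}=\sum_i(\iota_{e_i}\Omega\otimes\iota_{e'_i}\Omega')^{Cycl}$, where $(e_i)$ is a basis of $V$, $b(e_i,e'_j)=\delta_{ij}$, and $\iota_x$ is insertion of $x$ in one slot. The symplectic form on $V[1]$ associated to $b$ (hence to $\{\ ,\ \}$) is $B(x,y)=(-1)^{\deg(x)}b(x,y)$. Symmetric forms. For an $n$-linear cyclic form $\Omega$, $\Omega^{Sym}$ is the totally symmetric form $\Omega^{Sym}(x_1,\ldots,x_n)=\sum_{\sigma\in\mathfrak S_n}\Omega(x_{\sigma^{-1}(1)},\ldots,x_{\sigma^{-1}(n)})$. $\mathcal C(V)|_S$ is the space of totally symmetric multilinear forms on $V[1]$, a quotient of $\mathcal C(V)$ through $\Omega\mapsto\Omega^{Sym}$, and $\{\ ,\ \}|$ is the induced bracket on the quotient: $\{\Omega^{Sym},(\Omega')^{Sym}\}|=(\{\Omega,\Omega'\})^{Sym}$.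 Coderivations. $S^k(V[1])$ is spanned by the symmetric products $x_1\cdot\ldots\cdot x_k=\sum_{\sigma\in\mathfrak S_k}x_{\sigma^{-1}(1)}\otimes\cdots\otimes x_{\sigma^{-1}(k)}$; $S^+(V[1])=\sum_{k>0}S^k(V[1])$ has coproduct $\Delta(x_1\cdot\ldots\cdot x_k)=\sum_{I\sqcup J=[1,k],\,0<\#I<k}x_{\cdot I}\bigotimes x_{\cdot J}$ ($x_{\cdot I}=x_{i_1}\cdot\ldots\cdot x_{i_r}$ for $I=\{i_1<\cdots<i_r\}$). A coderivation $Q$ of $\Delta$ is characterized by its Taylor coefficients $Q_k$, totally symmetric $k$-linear maps from $V[1]^k$ into $V[1]$, seen as linear maps $S^k(V[1])\to V[1]$. With commutators determined by $[Q,Q'](x_1\cdot\ldots\cdot x_{k+k'-1})=\sum_{I\sqcup J=[1,k+k'-1],\,\#J=k'}Q(Q'(x_{\cdot J})\cdot x_{\cdot I})-\sum_{I\sqcup J=[1,k+k'-1],\,\#I=k}Q'(Q(x_{\cdot I})\cdot x_{\cdot J})$, an $L_\infty$ algebra structure on $V$ is a degree $1$ coderivation $Q$ of $(S^+(V[1]),\Delta)$ with $[Q,Q]=0$. The form of a coderivation. For $k$-linear $Q$, $\Omega_Q(x_1,\ldots,x_{k+1})=B(Q(x_1,\ldots,x_k),x_{k+1})$, and for a coderivation $\Omega_Q=\sum_k\Omega_{Q_k}$; $Q$ is $B$-quadratic if every $\Omega_{Q_k}$ is cyclic. Pinczon Lie algebra. A Pinczon Lie algebra $(\mathcal C(V)|_S,\{\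 ,\ \}|,\Omega)$ is a vector space $V$ such that $\mathcal C(V)$ is equipped with a Pinczon bracket $\{\ ,\ \}$, and a symmetric multilinear form $\Omega$, with degree $3$, such that $\{\Omega,\Omega\}|=0$.
   Formalization: Ω is required to have no 1-linear term (a degree 3 linear form is never Ω_Q, so (i) fails for it); the centre axiom (4) and the formula linking b to the bracket are imposed only after Sym; {Ω,Ω}| is read as ({Ω,Ω})^Sym, with Q_k(x_1·…·x_k)=k!Q_k(x_1,…,x_k). *)

(* Defs.v *)
From HB Require Import structures.
From mathcomp Require Import all_boot all_order all_fingroup all_algebra.
From mathcomp Require Import finmap.
From mathcomp.multinomials Require Import monalg.

Set Implicit Arguments.
Unset Strict Implicit.
Unset Printing Implicit Defensive.

Import GRing.Theory.
Local Open Scope ring_scope.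

Record grading (K : fieldType) (V : vectType K) := Grading {
  gsupp : seq int;
  gpiece :> int -> {vspace V};
  gsupp_uniq : uniq gsupp;
  gpiece_sum : fullv = (\sum_(d <- gsupp) gpiece d)%VS;
  gpiece_direct : directv (\sum_(d <- gsupp) gpiece d);
  gpiece_out : forall d, d \notin gsupp -> gpiece d = 0%VS }.

(* T(V[1]) and T(V[1]) (x) T(V[1]), in the bases deduced from vbasis fullv. *)
Notation vdim V := (\dim (@fullv _ V)).
Notation tensor K V := {malg K[seq 'I_(vdim V)]}.
Notation tensor2 K V := {malg K[(seq 'I_(vdim V) * seq 'I_(vdim V))%type]}.

Section GradedSpace.

Variables (K : fieldType) (V : vectType K) (G : grading V).

(* A letter x in G d has degree deg x = d - 1 as an element of V[1]; signs
   only see the parity of deg x. *)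
Definition odd_letter (d : int) : bool := odd `|d - 1|%N.

Definition degsign (d : int) : K := (-1) ^+ odd `|d|%N.

(* ds lists the degrees in V of the letters of the word s. *)
Definition hword (ds : seq int) (s : seq V) : bool :=
  all2 (fun d x => x \in G d) ds s.

Definition wdeg (ds : seq int) : int := \sum_(d <- ds) (d - 1).

(* The component of x of odd (p = true) or even (p = false) degree in V[1]. *)
Definition parity_part (p : bool) (x : V) : V :=
  \sum_(d <- gsupp G | odd_letter d == p) sumv_pi_for (gpiece_sum G) d x.

(* A (formal, possibly infinite) sum over n of n-linear maps is a function on
   words, the n-linear term being its restriction to the words of size n.
   Infinite sums are needed: a coderivation may have infinitely many non zero
   Taylor coefficients. *)
Definition mform := seq V -> K^o.

Definition multilinear (W : lmodType K) (F : seq V -> W) : Prop :=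
  forall (s1 s2 : seq V) (a : K) (x y : V),
    F (s1 ++ (a *: x + y) :: s2) = a *: F (s1 ++ x :: s2) + F (s1 ++ y :: s2).

(* Sign of the move of letters with parities p by which the i-th letter goes
   to the position sg i. *)
Definition ksign (n : nat) (sg : 'S_n) (p : seq bool) : K :=
  \prod_(i < n) \prod_(j < n | (i < j)%N && (sg j < sg i)%N)
     (if nth false p i && nth false p j then -1 else 1).

(* (x_1,...,x_n) |-> +- F (x_{sg^-1(1)},...,x_{sg^-1(n)}), the sign being
   extended by multilinearity to non homogeneous letters. *)
Definition koszul_act (W : lmodType K) (n : nat) (sg : 'S_n) (F : seq V -> W)
    (x : n.-tuple V) : W :=
  \sum_(p : n.-tuple bool)
    ksign sg p *: F [tuple parity_part (tnth p ((sg^-1)%g i))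
                                       (tnth x ((sg^-1)%g i)) | i < n].

Definition koszul_symmetric (W : lmodType K) (F : seq V -> W) : Prop :=
  forall (n : nat) (sg : 'S_n) (x : n.-tuple V), koszul_act sg F x = F x.

Definition rot_perm (n : nat) : 'S_n := perm (@ordS_inj n).

Definition koszul_cyclic (F : mform) : Prop :=
  forall (n : nat) (x : n.-tuple V), koszul_act (rot_perm n) F x = F x.

Definition cyclic_mform (F : mform) : Prop := multilinear F /\ koszul_cyclic F.

Definition symmetric_mform (F : mform) : Prop :=
  multilinear F /\ koszul_symmetric F.

Definition cycl_form (F : mform) : mform := fun s =>
  \sum_(sg in <[rot_perm (size s)]>%g) koszul_act sg F (in_tuple s).

Definition sym_form (F : mform) : mform := fun s =>
  \sum_(sg : 'S_(size s)) koszul_act sg F (in_tuple s).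

Definition arity (n : nat) (F : mform) : Prop :=
  forall s, F s != 0 -> size s = n.

Definition component (n : nat) (F : mform) : mform := fun s =>
  if size s == n then F s else 0.

(* As scalars have degree 0, a form of degree d only pairs non trivially with
   words of degree - d. *)
Definition has_degree (d : int) (F : mform) : Prop :=
  forall ds s, hword ds s -> F s != 0 -> wdeg ds + d = 0.

Definition insertion (x : V) (F : mform) : mform := fun s => F (x :: s).

(* Tensor product of forms of degrees d and d'. The Koszul sign
   (-1)^(d' deg(x_1,...,x_k)) is (-1)^(d' d) whenever F (x_1,...,x_k) <> 0. *)
Definition ftensor (d d' : int) (F F' : mform) : mform := fun s =>
  degsign (d * d') * \sum_(k < (size s).+1) F (take k s) * F' (drop k s).

Definition lform (a : {scalar V}) : mform := fun s =>
  if s is [:: x] then a x else 0.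

(* b_1 (x) ... (x) b_k for linear forms b_i of degree d i, with the same sign
   convention. *)
Definition ltensor (k : nat) (d : 'I_k -> int) (b : 'I_k -> {scalar V}) :
    mform :=
  fun s => if size s == k then
    (\prod_(i < k) \prod_(j < k | (i < j)%N) degsign (d i * d j))
      * \prod_(i < k) b i (nth 0 s i)
  else 0.

(* The bracket of formal sums is determined by the brackets of their terms
   (pb_terms). A graded Lie bracket is understood as a bracket of degree - 2,
   that is, of degree 0 once the degrees of forms are shifted by 2; this is
   what makes b of degree 0 below. *)
(* pb_center: for the bracket associated to b, forms such as (B (x) B)^Cycl,
   where B is the symplectic form, commute with C(V) without being scalars in
   general; they are killed by Sym. So the centre is only required to be made
   of scalars modulo the kernel of Sym. *)
Record pinczon_bracket (br : mform -> mform -> mform) : Prop := PinczonBracket {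
  pb_closed : forall F F', cyclic_mform F -> cyclic_mform F' ->
    cyclic_mform (br F F');
  pb_linearl : forall (a : K) F1 F2 F', cyclic_mform F1 -> cyclic_mform F2 ->
    cyclic_mform F' ->
    br (fun s => a * F1 s + F2 s) F' =1 (fun s => a * br F1 F' s + br F2 F' s);
  pb_linearr : forall (a : K) F F1 F2, cyclic_mform F -> cyclic_mform F1 ->
    cyclic_mform F2 ->
    br F (fun s => a * F1 s + F2 s) =1 (fun s => a * br F F1 s + br F F2 s);
  pb_arity : forall k k' F F', cyclic_mform F -> cyclic_mform F' ->
    arity k.+1 F -> arity k'.+1 F' -> arity (k + k') (br F F');
  pb_terms : forall F F', cyclic_mform F -> cyclic_mform F' -> forall s,
    br F F' s = \sum_(k < (size s).+1)
       br (component k.+1 F) (component (size s - k).+1 F') s;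
  pb_degree : forall d d' F F', cyclic_mform F -> cyclic_mform F' ->
    has_degree d F -> has_degree d' F' -> has_degree (d + d' - 2) (br F F');
  pb_antisym : forall d d' F F', cyclic_mform F -> cyclic_mform F' ->
    has_degree d F -> has_degree d' F' ->
    br F' F =1 (fun s => - (degsign (d * d') * br F F' s));
  pb_jacobi : forall d d' d'' F F' F'', cyclic_mform F -> cyclic_mform F' ->
    cyclic_mform F'' -> has_degree d F -> has_degree d' F' ->
    has_degree d'' F'' ->
    br F (br F' F'') =1
      (fun s => br (br F F') F'' s + degsign (d * d') * br F' (br F F'') s);
  pb_linear_form : forall (a : {scalar V}) (k : nat) (d : 'I_k.+1 -> int)
      (b : 'I_k.+1 -> {scalar V}),
    (forall i, has_degree (d i) (lform (b i))) ->
    br (lform a) (cycl_form (ltensor d b)) =1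
      (fun s => \sum_(j < k.+1)
         (\prod_(i < k.+1 | (i < j)%N) degsign (d i * d j))
           * br (lform a) (lform (b j)) [::]
           * cycl_form (ltensor (fun i => d (lift j i))
                                (fun i => b (lift j i))) s);
  pb_scalar : forall F F', cyclic_mform F -> cyclic_mform F' ->
    arity 0 F -> br F F' =1 (fun=> 0);
  pb_center : forall F, cyclic_mform F ->
    (forall F', cyclic_mform F' -> br F F' =1 (fun=> 0)) ->
    arity 0 (sym_form F) }.

Definition bilinear_map (b : V -> V -> K^o) : Prop :=
  (forall x, scalar (b x)) /\ (forall y, scalar (b^~ y)).

Definition left_nondegenerate (b : V -> V -> K^o) : Prop :=
  forall x, (forall y, b x y = 0) -> x = 0.

(* Symmetry of b is with respect to the degrees of V; it makes B
   antisymmetric with respect to those of V[1]. *)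
Definition quadratic_form (b : V -> V -> K^o) : Prop :=
  [/\ bilinear_map b,
      forall i j x y, x \in G i -> y \in G j -> b x y != 0 -> i + j = 0,
      forall i j x y, x \in G i -> y \in G j -> b y x = degsign (i * j) * b x y
    & left_nondegenerate b].

Definition symplectic_form (B : V -> V -> K^o) : Prop :=
  [/\ bilinear_map B,
      forall i j x y, x \in G i -> y \in G j ->
        B y x = - (degsign ((i - 1) * (j - 1)) * B x y)
    & left_nondegenerate B].

Definition symplectic_of (b : V -> V -> K^o) : V -> V -> K^o := fun x y =>
  b (parity_part false x) y - b (parity_part true x) y.

(* The sum over i of (insertion e_i F) (x) (insertion e'_i F') for forms of
   degrees d, d', where e_i has degree dg i in V and e'_i has degree - dg i.
   The first sign comes from moving e_i across F'. *)
Definition contraction (m : nat) (dg : 'I_m -> int) (e e' : 'I_m -> V)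
    (d d' : int) (F F' : mform) : mform := fun s =>
  \sum_(i < m) degsign ((dg i - 1) * d')
    * ftensor (d + (dg i - 1)) (d' + (- dg i - 1)) (insertion (e i) F)
        (insertion (e' i) F') s.

(* The formula for the bracket is imposed in C(V)|_S only: if P is the
   projection F |-> F^Sym / n! of C(V) onto symmetric forms, conjugation by
   P + c (1 - P), c <> 0, preserves the axioms of a Pinczon bracket but not the
   formula itself. On linear forms Sym is the identity, so b is still
   determined by the bracket. *)
Definition associated (br : mform -> mform -> mform) (b : V -> V -> K^o) :
    Prop :=
  forall (m : nat) (dg : 'I_m -> int) (e e' : m.-tuple V),
    basis_of fullv e -> (forall i, tnth e i \in G (dg i)) ->
    (forall i j, b (tnth e i) (tnth e' j) = (i == j)%:R) ->
    forall d d' F F', cyclic_mform F -> cyclic_mform F' ->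
      has_degree d F -> has_degree d' F' ->
      sym_form (br F F') =1
        sym_form (cycl_form (contraction dg (tnth e) (tnth e') d d' F F')).

Definition associated_symplectic (br : mform -> mform -> mform)
    (B : V -> V -> K^o) : Prop :=
  symplectic_form B /\
  exists b, [/\ quadratic_form b, associated br b & B = symplectic_of b].

Definition induced_bracket (br brS : mform -> mform -> mform) : Prop :=
  forall F F', cyclic_mform F -> cyclic_mform F' ->
    brS (sym_form F) (sym_form F') =1 sym_form (br F F').

(* The symmetric, hence cyclic, form W stands for its class W^Sym in the
   quotient C(V)|_S of C(V). It has no term of arity 1, as coderivations of
   S^+ have no term of arity 0 (a term of arity 0 cannot have degree 3). *)
Definition pinczon_lie_algebra (br brS : mform -> mform -> mform) (W : mform) :
    Prop :=
  [/\ pinczon_bracket br, induced_bracket br brS, symmetric_mform W,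
      has_degree 3 W /\ (forall s, (size s < 2)%N -> W s = 0)
    & brS (sym_form W) (sym_form W) =1 (fun=> 0)].

Definition pure_tensor (s : seq V) : tensor K V :=
  \sum_(w : (size s).-tuple 'I_(vdim V))
    (\prod_(i < size s) coord (vbasis fullv) (tnth w i) (nth 0 s i))
      *: (<< tval w >> : tensor K V).

Definition tensor_pair (t u : tensor K V) : tensor2 K V :=
  \sum_(w <- msupp t) \sum_(w' <- msupp u)
    (t@_w * u@_w') *: (<< (w, w') >> : tensor2 K V).

(* x_1 . ... . x_n for letters of degrees ds in V. *)
Definition sprod (ds : seq int) (s : seq V) : tensor K V :=
  \sum_(sg : 'S_(size s))
    ksign sg (map odd_letter ds)
      *: pure_tensor [tuple nth 0 s ((sg^-1)%g i) | i < size s].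

(* The component of degree d of S^+(V[1]). *)
Definition in_Splus (d : int) (t : tensor K V) : Prop :=
  exists l : seq (K * (seq int * seq V)),
    (forall i, (i < size l)%N ->
       let: (_, (ds, s)) := nth (0, ([::], [::])) l i in
       [/\ s != [::], hword ds s & wdeg ds = d])
    /\ t = \sum_(c <- l) c.1 *: sprod c.2.1 c.2.2.

(* Koszul sign of x_1,...,x_n -> x_I, x_J, where the mask m selects I. *)
Definition shsign (n : nat) (m : n.-tuple bool) (ds : seq int) : K :=
  \prod_(i < n) \prod_(j < n | [&& (i < j)%N, ~~ tnth m i & tnth m j])
    (if odd_letter (nth 0 ds i) && odd_letter (nth 0 ds j) then -1 else 1).

Definition sel (n : nat) (T : Type) (m : n.-tuple bool) (s : seq T) : seq T :=
  mask m s.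
Definition cosel (n : nat) (T : Type) (m : n.-tuple bool) (s : seq T) : seq T :=
  mask (map negb m) s.

Definition proper_mask (n : nat) (m : n.-tuple bool) : bool :=
  has id m && has negb m.

Definition is_coproduct (D : {linear tensor K V -> tensor2 K V}) : Prop :=
  forall ds s, hword ds s ->
    D (sprod ds s) = \sum_(m : (size s).-tuple bool | proper_mask m)
      shsign m ds *: tensor_pair (sprod (sel m ds) (sel m s))
                                 (sprod (cosel m ds) (cosel m s)).

(* A linear map Q from S^+(V[1]) to itself is given by the symmetric
   multilinear maps Q (x_1 . ... . x_n), n > 0. *)
Definition coderivation_deg (d : int) (Q : seq V -> tensor K V) : Prop :=
  [/\ multilinear Q, koszul_symmetric Q, Q [::] = 0,
      (forall ds s, hword ds s -> s != [::] -> in_Splus (wdeg ds + d) (Q s))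
    & exists2 D, is_coproduct D & forall ds s, hword ds s ->
        D (Q s) = \sum_(m : (size s).-tuple bool | proper_mask m)
          shsign m ds *:
            (tensor_pair (Q (sel m s)) (sprod (cosel m ds) (cosel m s))
             + degsign (d * wdeg (sel m ds)) *:
               tensor_pair (sprod (sel m ds) (sel m s)) (Q (cosel m s)))].

Definition coderivation (Q : seq V -> tensor K V) : Prop :=
  exists d, coderivation_deg d Q.

(* The component in S^1(V[1]) = V[1] of Q (x_1 . ... . x_n). *)
Definition corestriction (Q : seq V -> tensor K V) : seq V -> V := fun s =>
  \sum_(i < vdim V) (Q s)@_[:: i] *: (vbasis fullv)`_i.

(* The n-linear map Q_n inducing the corestriction on S^n(V[1]): as
   x_1 . ... . x_n is a sum of n! tensors in V[1]^{(x) n},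
   Q_n (x_1 . ... . x_n) = n! Q_n (x_1,...,x_n). *)
Definition taylor (Q : seq V -> tensor K V) : seq V -> V := fun s =>
  ((size s)`!%:R)^-1 *: corestriction Q s.

(* Corestriction of [Q,Q'] on x_1 . ... . x_n, for Q, Q' of degrees d, d' with
   corestrictions q, q'. *)
Definition commutator (d d' : int) (q q' : seq V -> V) (ds : seq int)
    (s : seq V) : V :=
  (\sum_(m : (size s).-tuple bool | has id m)
     shsign m ds *: q (q' (sel m s) :: cosel m s))
  - degsign (d * d') *:
    (\sum_(m : (size s).-tuple bool | has id m)
       shsign m ds *: q' (q (sel m s) :: cosel m s)).

Definition Linfty (Q : seq V -> tensor K V) : Prop :=
  coderivation_deg 1 Q /\
  (forall ds s, hword ds s -> s != [::] ->
     commutator 1 1 (corestriction Q) (corestriction Q) ds s = 0).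

Definition form_of (B : V -> V -> K^o) (Q : seq V -> tensor K V) : mform :=
  fun s =>
  if s is x :: s' then B (taylor Q (belast x s')) (last x s') else 0.

Definition B_quadratic (B : V -> V -> K^o) (Q : seq V -> tensor K V) : Prop :=
  koszul_cyclic (form_of B Q).

End GradedSpace.

(* Main.v *)
(* A Pinczon bracket restricted to linear forms is a nondegenerate matrix (a
   linear form in its kernel is central, by the Leibniz rule on tensors of linear
   forms), and its inverse is b. Bracketing with the linear form b (-, x) is, up
   to sign and symmetrization, the insertion of x, so that by the Jacobi identity
   and induction on the arity the bracket is given by the contraction formula
   modulo the kernel of Sym; hence b and B are determined. A symmetric W is then
   W (x_1,...,x_n,y) = B (Q_n (x_1,...,x_n), y) for unique symmetric maps Q_n,
   which are the Taylor coefficients of a unique coderivation. Conversely the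
   contraction formula turns {W, W} for W = Omega_Q into B ([Q, Q] (...), y), up
   to a nonzero factor. *)

Require Import Defs.
From HB Require Import structures.
From mathcomp Require Import all_boot all_order all_fingroup all_algebra.
From mathcomp Require Import cyclic finmap zify.
From mathcomp.multinomials Require Import monalg.

From Stdlib Require Import FunctionalExtensionality.

Set Implicit Arguments.
Unset Strict Implicit.
Unset Printing Implicit Defensive.

Import GRing.Theory.
Local Open Scope ring_scope.

(** * Signed sums over words *)

(** What shapes the proof is the Koszul signs, which the definitions attach to permutations, masks
    and parity decompositions. They are handled by recursion on words of homogeneous letters:
    permutations become successive insertions ([ksym]), masks become splittings ([shsum]), and every
    sign becomes a boolean function of parities, checked by cases. The Leibniz axiom only speaks of
    cyclic sums of tensors of linear forms. An n-linear cyclic form is a combination of these after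
    division by n, one of the places where characteristic 0 enters. The signs of the axioms also
    involve the degrees of the forms. A form of degree d vanishes on words of the other parity, so
    these signs can be read on the words; the resulting formula ([shbr]) makes sense for forms
    without degree and is extended to them by bilinearity. The normalization F^Sym / n of [hat_form]
    is the one for which insertion in the first slot commutes with symmetrization, so that no arity
    dependent factor appears in the induction. *)

Section SignedWords.

Variables (K : fieldType) (X : Type) (par : X -> bool).

Definition word_parity (u : seq X) : bool := foldr (fun x b => par x (+) b) false u.

Lemma parw_cat u v : word_parity (u ++ v) = word_parity u (+) word_parity v.
Proof. by elim: u => //= x u ->; rewrite addbA. Qed.

Lemma parw_rcons u x : word_parity (rcons u x) = word_parity u (+) par x.
Proof. by rewrite -cats1 parw_cat /= addbF. Qed.

Section Sums.

Variable W : lmodType K.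
Implicit Types (f : seq X -> W) (h : seq X -> seq X -> W) (s u v I J : seq X).

Notation sgn b := ((-1) ^+ nat_of_bool b : K).

(* The sum of h I J over the splittings of s into complementary subwords I and
   J, with the Koszul sign of s -> I ++ J. *)
Fixpoint shsum h s : W :=
  if s is x :: s' then
    shsum (fun I J => h (x :: I) J) s'
    + shsum (fun I J => sgn (par x && word_parity I) *: h I (x :: J)) s'
  else h [::] [::].

Fixpoint ins x f u : W :=
  if u is y :: u' then
    f (x :: y :: u') + sgn (par x && par y) *: ins x (fun v => f (y :: v)) u'
  else f [:: x].

(** Permutations are enumerated by inserting the letters one after the other; [ksym_perm] identifies
    the result with the signed sum over the symmetric group. *)
Fixpoint ksym f s : W := if s is x :: s' then ksym (ins x f) s' else f [::].

Fixpoint cuts h u : W :=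
  if u is x :: u' then h [::] u + cuts (fun I J => h (x :: I) J) u'
  else h [::] [::].

(** The congruence remembers the total parity and length of a splitting; sign computations use this
    to express the parity of s by those of I and J. *)
Lemma eq_shsum h h' s :
  (forall I J, word_parity I (+) word_parity J = word_parity s -> (size I + size J)%N = size s ->
     h I J = h' I J) ->
  shsum h s = shsum h' s.
Proof.
elim: s h h' => [|x s IHs] h h' eqh /=; first exact: eqh.
congr (_ + _); apply: IHs => I J pIJ sIJ.
  by apply: eqh; rewrite /= -?addbA ?pIJ // addSn sIJ.
congr (_ *: _); apply: eqh; rewrite /= -?pIJ ?addnS ?sIJ //.
by case: (word_parity I); case: (par x); case: (word_parity J).
Qed.

Lemma shsumD h h' s :
  shsum (fun I J => h I J + h' I J) s = shsum h s + shsum h' s.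
Proof.
elim: s h h' => //= x s IHs h h'; rewrite [RHS]addrACA; congr (_ + _).
  exact: IHs.
by rewrite -[RHS]IHs; apply: eq_shsum => I J _ _; rewrite scalerDr.
Qed.

Lemma shsumZ a h s : shsum (fun I J => a *: h I J) s = a *: shsum h s.
Proof.
elim: s h => //= x s IHs h; rewrite scalerDr; congr (_ + _); first exact: IHs.
by rewrite -[RHS]IHs; apply: eq_shsum => I J _ _; rewrite !scalerA mulrC.
Qed.

Lemma shsum0 s : shsum (fun _ _ => 0) s = 0.
Proof.
elim: s => //= x s IHs; rewrite IHs add0r -[RHS]IHs.
by apply: eq_shsum => I J _ _; rewrite scaler0.
Qed.

Lemma shsum_sum (T : Type) (r : seq T) (P : pred T) (h : T -> seq X -> seq X -> W) s :
  shsum (fun I J => \sum_(i <- r | P i) h i I J) s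
  = \sum_(i <- r | P i) shsum (h i) s.
Proof.
elim: r => [|i r IHr].
  by rewrite big_nil -[RHS](shsum0 s); apply: eq_shsum => *; rewrite big_nil.
rewrite big_cons -IHr; case: ifP => Pi; last first.
  by apply: eq_shsum => *; rewrite big_cons Pi.
by rewrite -shsumD; apply: eq_shsum => *; rewrite big_cons Pi.
Qed.

Lemma eq_ins x f f' u : (forall v, word_parity v = par x (+) word_parity u ->
    size v = (size u).+1 -> f v = f' v) -> ins x f u = ins x f' u.
Proof.
elim: u f f' => [|y u IHu] f f' eqf /=; first exact: eqf.
congr (_ + _ *: _); first exact: eqf.
apply: IHu => v pv sv; apply: eqf => /=; last by rewrite sv.
by rewrite pv addbCA.
Qed.

Lemma insD x f f' u : ins x (fun v => f v + f' v) u = ins x f u + ins x f' u.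
Proof.
by elim: u f f' => //= y u IHu f f'; rewrite IHu scalerDr addrACA.
Qed.

Lemma insZ x a f u : ins x (fun v => a *: f v) u = a *: ins x f u.
Proof.
by elim: u f => //= y u IHu f; rewrite IHu scalerDr !scalerA mulrC.
Qed.

Lemma eq_ksym f f' s :
  (forall u, word_parity u = word_parity s -> size u = size s -> f u = f' u) ->
  ksym f s = ksym f' s.
Proof.
elim: s f f' => [|x s IHs] f f' eqf /=; first exact: eqf.
apply: IHs => u pu su; apply: eq_ins => v pv sv.
by apply: eqf; rewrite /= -?pu -?su.
Qed.

Lemma ksymD f f' s : ksym (fun u => f u + f' u) s = ksym f s + ksym f' s.
Proof.
elim: s f f' => //= x s IHs f f'; rewrite -IHs.
by apply: eq_ksym => u _ _; rewrite insD.
Qed.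

Lemma ksymZ a f s : ksym (fun u => a *: f u) s = a *: ksym f s.
Proof.
elim: s f => //= x s IHs f; rewrite -IHs.
by apply: eq_ksym => u _ _; rewrite insZ.
Qed.

Lemma ksym0 s : ksym (fun _ => 0) s = 0.
Proof.
by rewrite -[RHS](scale0r (ksym (fun=> 0) s)) -ksymZ; apply: eq_ksym => *; rewrite scaler0.
Qed.

Lemma ksym_sum (T : Type) (r : seq T) (P : pred T) (f : T -> seq X -> W) s :
  ksym (fun u => \sum_(i <- r | P i) f i u) s
  = \sum_(i <- r | P i) ksym (f i) s.
Proof.
elim: r => [|i r IHr].
  by rewrite big_nil -[RHS](ksym0 s); apply: eq_ksym => *; rewrite big_nil.
rewrite big_cons -IHr; case: ifP => Pi; last first.
  by apply: eq_ksym => *; rewrite big_cons Pi.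
by rewrite -ksymD; apply: eq_ksym => *; rewrite big_cons Pi.
Qed.

Lemma eq_cuts h h' u : (forall I J, I ++ J = u -> h I J = h' I J) ->
  cuts h u = cuts h' u.
Proof.
elim: u h h' => [|y u IHu] h h' eqh /=; first exact: eqh.
by rewrite eqh //; congr (_ + _); apply: IHu => I J eqIJ; apply: eqh; rewrite /= eqIJ.
Qed.

Lemma cutsE h u :
  cuts h u = \sum_(k < (size u).+1) h (take k u) (drop k u).
Proof.
elim: u h => [|x u IHu] h /=; first by rewrite big_ord1.
by rewrite big_ord_recl /= IHu; congr (_ + _).
Qed.

Lemma cutsD h h' u :
  cuts (fun I J => h I J + h' I J) u = cuts h u + cuts h' u.
Proof. by elim: u h h' => //= x u IHu h h'; rewrite IHu addrACA. Qed.

Lemma cutsZ a h u : cuts (fun I J => a *: h I J) u = a *: cuts h u.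
Proof. by elim: u h => //= x u IHu h; rewrite IHu scalerDr. Qed.

(** A cut of the word leaves the inserted x in the left or in the right piece; in the second case x
    has passed the whole of I, hence the sign. *)
Lemma ins_cuts x h u :
  ins x (cuts h) u
  = cuts (fun I J => ins x (h^~ J) I) u
    + cuts (fun I J => sgn (par x && word_parity I) *: ins x (h I) J) u.
Proof.
elim: u h => [|y u IHu] h /=; first by rewrite andbF scale1r addrC.
rewrite insD IHu andbF scale1r cutsD cutsZ.
have -> : cuts (fun I J => sgn (par x && (par y (+) word_parity I))
              *: ins x [eta h (y :: I)] J) u
    = sgn (par x && par y)
      *: cuts (fun I J => sgn (par x && word_parity I) *: ins x (h (y :: I)) J) u.
  rewrite -cutsZ; apply: eq_cuts => I J _.
  by rewrite scalerA -signr_addb; case: (par x).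
by rewrite !scalerDr !addrA [LHS](ACl (2*3*5*1*4*6)).
Qed.

End Sums.

End SignedWords.

(** * Coalgebra identities for splittings; symmetric and cyclic functions of words *)

Section SignedWordsTheory.

Variables (K : fieldType) (X : Type) (par : X -> bool).
Notation parw := (word_parity par).
Notation sgn b := ((-1) ^+ nat_of_bool b : K).

Lemma sgnK (W : lmodType K) (b : bool) (w : W) : sgn b *: (sgn b *: w) = w.
Proof. by rewrite scalerA -signr_addb addbb scale1r. Qed.

Lemma raddf_ksym (W W' : lmodType K) (L : {linear W -> W'}) f s :
  L (ksym par f s) = ksym par (fun u => L (f u)) s.
Proof.
have raddf_ins x g u : L (ins par x g u) = ins par x (fun v => L (g v)) u.
  by elim: u g => //= y u IHu g; rewrite linearD linearZ IHu.
elim: s f => //= x s IHs f; rewrite IHs.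
by apply: eq_ksym => u _ _; rewrite raddf_ins.
Qed.

Lemma raddf_shsum (W W' : lmodType K) (L : {linear W -> W'}) h s :
  L (shsum par h s) = shsum par (fun I J => L (h I J)) s.
Proof.
elim: s h => //= x s IHs h; rewrite linearD !IHs; congr (_ + _).
by apply: eq_shsum => I J _ _; rewrite linearZ.
Qed.

Variable W : lmodType K.
Implicit Types (f : seq X -> W) (h : seq X -> seq X -> W) (s u v I J : seq X).

Notation shsum := (shsum par).
Notation ins := (ins par).
Notation ksym := (ksym par).

Lemma ins_ksym x h u J :
  ins x (fun v => ksym (h v) J) u = ksym (fun J' => ins x (h^~ J') u) J.
Proof.
elim: u h => //= y u IHu h; rewrite ksymD ksymZ IHu.
by congr (_ + _ *: _).
Qed.

Lemma ksym_exchange h s t :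
  ksym (fun u => ksym (h u) t) s = ksym (fun v => ksym (h^~ v) s) t.
Proof.
elim: s h => //= x s IHs h; rewrite -IHs.
by apply: eq_ksym => u _ _; rewrite ins_ksym.
Qed.

(* Symmetrization is compatible with deconcatenation: the coproduct of S(V[1])
   is the restriction of that of T(V[1]). *)
Lemma ksym_cuts h s :
  ksym (cuts h) s = shsum (fun I J => ksym (fun I' => ksym (h I') J) I) s.
Proof.
elim: s h => //= x s IHs h.
under eq_ksym do rewrite ins_cuts.
rewrite ksymD !IHs; congr (_ + _); apply: eq_shsum => I J _ _.
  by apply: eq_ksym => u _ _; rewrite ins_ksym.
rewrite -ksymZ; apply: eq_ksym => u pu _.
by rewrite -ksymZ; apply: eq_ksym => v _ _; rewrite pu.
Qed.

(** Cocommutativity of the unshuffle coproduct. *)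
Lemma shsumC h s :
  shsum h s = shsum (fun I J => sgn (parw I && parw J) *: h J I) s.
Proof.
elim: s h => [|x s IHs] h /=; first by rewrite scale1r.
rewrite [in LHS]IHs [X in _ + X = _]IHs addrC; congr (_ + _);
  apply: eq_shsum => I J _ _; rewrite !scalerA -!signr_addb;
  congr ((-1) ^+ nat_of_bool _ *: _);
  by case: (par x); case: (parw I); case: (parw J).
Qed.

(** Coassociativity of the unshuffle coproduct: both sides run over the splittings of s into three
    subwords. *)
Lemma shsumA (h : seq X -> seq X -> seq X -> W) s :
  shsum (fun P J => shsum (fun A B => h A B J) P) s
  = shsum (fun A R => shsum (fun B J => h A B J) R) s.
Proof.
elim: s h => //= x s IHs h.
rewrite shsumD IHs -addrA; congr (_ + _).
rewrite IHs.
rewrite [X in _ + X](_ : _ = shsum (fun A R => shsum (fun B J =>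
    sgn (par x && (parw A (+) parw B)) *: h A B (x :: J)) R) s); last first.
  rewrite -IHs; apply: eq_shsum => P J _ _; rewrite -shsumZ.
  by apply: eq_shsum => A B <- _.
rewrite -shsumD; apply: eq_shsum => A R _ _.
rewrite scalerDr -!shsumZ; congr (_ + _); apply: eq_shsum => B J _ _.
rewrite scalerA -signr_addb; congr ((-1) ^+ nat_of_bool _ *: _).
by case: (par x).
Qed.

(** Adjacent transpositions generate the symmetric group, and their signs are local; [swapsym_perm]
    and [perm_swapsym] relate this to arbitrary permutations. *)
Definition swapsym f := forall u x y v,
  f (u ++ x :: y :: v) = sgn (par x && par y) *: f (u ++ y :: x :: v).

Definition cycsym f := forall u x,
  f (rcons u x) = sgn (par x && parw u) *: f (x :: u).

Lemma swapsym_cons f x : swapsym f -> swapsym (fun u => f (x :: u)).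
Proof. by move=> symf u; apply: (symf (x :: u)). Qed.

Lemma swapsymZ f a : swapsym f -> swapsym (fun u => a *: f u).
Proof. by move=> symf u x y v; rewrite symf !scalerA mulrC. Qed.

Lemma swapsym_shsum h : (forall J, swapsym (h^~ J)) ->
  (forall I, swapsym (h I)) -> swapsym (shsum h).
Proof.
move=> syml symr u; elim: u h syml symr => [|z u IHu] h syml symr x y v /=.
  (* The splittings with x and y in different parts are exchanged in pairs; when both are in the
     same part, the symmetry of h in that part applies. *)
  rewrite !scalerDr !addrA [RHS](ACl (1*3*2*4)) /= -!shsumZ.
  congr (_ + _ + _ + _); apply: eq_shsum => I J _ _.
  - exact: (syml _ [::]).
  - rewrite !scalerA -!signr_addb; congr ((-1) ^+ nat_of_bool _ *: _).
    by case: (par x); case: (par y); case: (parw I).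
  - rewrite !scalerA -?signr_addb; congr ((-1) ^+ nat_of_bool _ *: _).
    by case: (par x); case: (par y); case: (parw I).
  rewrite (symr _ [::]) !scalerA -!signr_addb.
  congr ((-1) ^+ nat_of_bool _ *: _).
  by case: (par x); case: (par y); case: (parw I).
rewrite scalerDr; congr (_ + _); apply: IHu => //.
- by move=> J; apply: (swapsym_cons (f := h^~ J)).
- move=> J a b c d; rewrite syml !scalerA mulrC; congr (_ * sgn (_ && _) *: _).
  by rewrite !parw_cat /= [par b (+) _]addbCA.
- by move=> I; apply: swapsymZ; apply: (swapsym_cons (f := h I)).
Qed.

(** Two successive insertions commute up to the sign of the swap of the inserted letters. *)
Lemma swapsym_ksym f : swapsym (ksym f).
Proof.
have insC x y g u : ins y (ins x g) u = sgn (par x && par y) *: ins x (ins y g) u.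
  elim: u g => [|z u IHu] g /=.
    by rewrite scalerDr [par y && _]andbC sgnK addrC.
  rewrite !insD !insZ IHu !scalerDr !scalerA !addrA -!signr_addb.
  rewrite [par y && par x]andbC addbb scale1r [LHS](ACl (2*1*4*3*5)) /=.
  by congr (_ + _ + _ + _ + _); congr ((-1) ^+ nat_of_bool _ *: _);
     case: (par x); case: (par y); case: (par z).
move=> u; elim: u f => [|z u IHu] f x y v /=; last exact: IHu.
by rewrite -ksymZ; apply: eq_ksym => w _ _; rewrite insC.
Qed.

Lemma swapsym_front f u x v : swapsym f ->
  f (u ++ x :: v) = sgn (par x && parw u) *: f (x :: u ++ v).
Proof.
move=> symf; elim: u f symf => [|y u IHu] f symf /=.
  by rewrite andbF scale1r.
rewrite (IHu (fun w => f (y :: w))) ?(symf [::] y x (u ++ v)) /=; last first.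
  exact: swapsym_cons.
rewrite scalerA -signr_addb; congr ((-1) ^+ nat_of_bool _ *: _).
by case: (par x); case: (par y); case: (parw u).
Qed.

Lemma swapsym_cyc f : swapsym f -> cycsym f.
Proof. by move=> symf u x; rewrite -cats1 swapsym_front // cats0. Qed.

Lemma cycsym_cat f u v : cycsym f ->
  f (u ++ v) = sgn (parw u && parw v) *: f (v ++ u).
Proof.
move=> cycf; elim/last_ind: v u => [|v x IHv] u.
  by rewrite cats0 andbF scale1r.
rewrite -rcons_cat cycf -cat_cons IHv scalerA -signr_addb cat_rcons.
congr ((-1) ^+ nat_of_bool _ *: _).
rewrite /= parw_cat parw_rcons.
by case: (par x); case: (parw u); case: (parw v).
Qed.

(** A swap that reaches the end of the word is rotated inside it; on two letters the swap is itself
    a rotation. This gives the full symmetry of B (Q (x_1,...,x_n), y), where the symmetry of Q only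
    concerns the x_i. *)
Lemma cycsym_swapsym f : cycsym f ->
  (forall u x y v z, f (u ++ x :: y :: rcons v z)
     = sgn (par x && par y) *: f (u ++ y :: x :: rcons v z)) ->
  swapsym f.
Proof.
move=> cycf symf u x y v; case: (lastP v) => [|{}v z]; last exact: symf.
rewrite !(cycsym_cat u _ cycf) /= !addbF addbC scalerA mulrC -scalerA.
congr (_ *: _); case: (lastP u) => [|{}u z]; last exact: (symf [::]).
by rewrite (cycf [:: x] y) /= addbF andbC.
Qed.

Lemma insE x f u :
  ins x f u = cuts (fun I J => sgn (par x && parw I) *: f (I ++ x :: J)) u.
Proof.
elim: u f => [|y u IHu] f /=; first by rewrite andbF scale1r.
rewrite andbF scale1r IHu -cutsZ; congr (_ + _); apply: eq_cuts => I J _.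
rewrite scalerA -signr_addb; congr ((-1) ^+ nat_of_bool _ *: _).
by case: (par x).
Qed.

(** Each permuted word is rotated so as to start with x: I x J becomes x J I. After symmetrization
    the order of I and J is immaterial, and a word of length n has n + 1 cuts, which all contribute
    the same term. *)
Lemma ksym_cycsym f x s : cycsym f ->
  ksym f (x :: s) = (size s).+1%:R *: ksym (fun u => f (x :: u)) s.
Proof.
move=> cycf /=.
pose h I J := sgn (parw I && parw J) *: f (x :: J ++ I).
rewrite (eq_ksym (f' := cuts h)) => [|u _ _]; last first.
  rewrite insE; apply: eq_cuts => I J _; rewrite (cycsym_cat I) // scalerA.
  rewrite -signr_addb; congr ((-1) ^+ nat_of_bool _ *: _) => /=.
  by case: (par x); case: (parw I); case: (parw J).
rewrite ksym_cuts shsumC.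
transitivity (ksym (cuts (fun I J => f (x :: I ++ J))) s).
  rewrite ksym_cuts; apply: eq_shsum => I J _ _; rewrite -ksymZ [RHS]ksym_exchange.
  apply: eq_ksym => u pu _; rewrite -ksymZ; apply: eq_ksym => v pv _.
  by rewrite /h pu pv andbC scalerA -signr_addb addbb scale1r.
rewrite -ksymZ; apply: eq_ksym => u _ szu; rewrite cutsE.
under eq_bigr do rewrite cat_take_drop.
by rewrite sumr_const card_ord szu scaler_nat.
Qed.

Lemma ksym_swapsym f s : swapsym f -> ksym f s = (size s)`!%:R *: f s.
Proof.
elim: s f => [|x s IHs] f symf; first by rewrite scale1r.
rewrite ksym_cycsym; last exact: swapsym_cyc.
by rewrite IHs ?scalerA -?natrM //; apply: swapsym_cons.
Qed.

End SignedWordsTheory.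

(** * Koszul signs of permutations *)

Section Permutations.

Variables (K : fieldType) (X : Type) (par : X -> bool).
Notation sgn b := ((-1) ^+ nat_of_bool b : K).

Definition pword (T : Type) n (s : 'S_n) (t : n.-tuple T) : n.-tuple T :=
  [tuple tnth t ((s^-1)%g i) | i < n].

Arguments pword : simpl never.

Lemma pwordM (T : Type) n (s s' : 'S_n) (t : n.-tuple T) :
  pword (s * s')%g t = pword s' (pword s t).
Proof. by apply: eq_from_tnth => i; rewrite !tnth_mktuple invMg permM. Qed.

Lemma pword1 (T : Type) n (t : n.-tuple T) : pword 1%g t = t.
Proof. by apply: eq_from_tnth => i; rewrite tnth_mktuple invg1 perm1. Qed.

Lemma pword_map (T T' : Type) n (g : T -> T') (s : 'S_n) (t : n.-tuple T) :
  pword s (map_tuple g t) = map_tuple g (pword s t).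
Proof. by apply: eq_from_tnth => i; rewrite !tnth_map !tnth_ord_tuple. Qed.

Lemma ksignE n (s : 'S_n) (p : n.-tuple bool) :
  ksign K s p = \prod_(i < n) \prod_(j < n | (i < j)%N && (s j < s i)%N)
                  sgn (tnth p i && tnth p j).
Proof.
apply: eq_bigr => i _; apply: eq_bigr => j _.
by rewrite !(tnth_nth false); case: ifP; rewrite ?expr1 ?expr0.
Qed.

Lemma ksign1 n (p : n.-tuple bool) : ksign K (1%g : 'S_n) p = 1.
Proof.
rewrite ksignE big1 // => i _; rewrite big_pred0 // => j.
by rewrite !perm1; case: ltngtP.
Qed.

(* Both sides are products over the unordered pairs {i, j}: a pair contributes
   according to the parity of the number of times it is inverted. *)
Lemma ksignM n (s s' : 'S_n) (p : n.-tuple bool) :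
  ksign K (s * s')%g p = ksign K s p * ksign K s' (pword s p).
Proof.
pose h (i j : 'I_n) := sgn (tnth p i && tnth p j).
have hC i j : h i j = h j i by rewrite /h andbC.
have ltC (i j : 'I_n) : i != j -> (j < i)%N = ~~ (i < j)%N.
  by rewrite -val_eqE /= -leqNgt ltn_neqAle eq_sym => ->.
have neS (r : 'S_n) i j : i != j -> r i != r j by rewrite (inj_eq perm_inj).
have hh i j : h i j * h i j = 1 by rewrite -signr_addb addbb.
have -> : ksign K s' (pword s p)
  = \prod_(ij : 'I_n * 'I_n | (ij.1 < ij.2)%N
      && ((s ij.1 < s ij.2)%N (+) (s' (s ij.1) < s' (s ij.2))%N)) h ij.1 ij.2.
  rewrite ksignE pair_big_dep /=.
  rewrite (reindex (fun ij : 'I_n * 'I_n => (s ij.1, s ij.2))) /=; last first.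
    exists (fun ij : 'I_n * 'I_n => ((s^-1)%g ij.1, (s^-1)%g ij.2)) => -[i j] _;
    by rewrite /= ?permK ?permKV.
  under eq_bigr do rewrite !tnth_mktuple !permK.
  rewrite (bigID (fun ij : 'I_n * 'I_n => (ij.1 < ij.2)%N)) /=.
  rewrite [X in _ * X](reindex_inj (h := fun ij : 'I_n * 'I_n => (ij.2, ij.1)))
    /=; last by move=> [i j] [k l] [-> ->].
  rewrite [RHS](bigID (fun ij : 'I_n * 'I_n => (s ij.1 < s ij.2)%N)) /=.
  congr (_ * _).
    apply: eq_bigl => -[i j] /=; case: (eqVneq i j) => [->|ne].
      by rewrite !ltnn.
    rewrite (ltC _ _ (neS s' _ _ (neS s _ _ ne))).
    by do 3!case: ltnP => _.
  apply: eq_big => [[i j]|[i j] _] /=; last exact: hC.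
  case: (eqVneq i j) => [->|ne]; first by rewrite !ltnn.
  rewrite (ltC _ _ (neS s _ _ ne)) (ltC _ _ ne).
  by do 3!case: ltnP => _.
rewrite !ksignE !pair_big_dep /= [LHS]big_mkcond /=.
rewrite [X in _ = X * _]big_mkcond [X in _ = _ * X]big_mkcond -big_split /=.
apply: eq_bigr => -[i j] _ /=; case: (eqVneq i j) => [->|ne].
  by rewrite !ltnn mulr1.
rewrite !permM (ltC _ _ (neS s _ _ ne)) (ltC _ _ (neS s' _ _ (neS s _ _ ne))).
by do 3?[case: ltnP => _ //=]; rewrite -?/(h i j) ?mulr1 ?mul1r ?hh.
Qed.

Lemma prod_signs n (b : bool) (u : n.-tuple bool) k :
  \prod_(i < n | (i < k)%N) sgn (b && tnth u i)
  = sgn (b && word_parity id (take k u)).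
Proof.
elim: n u k => [|n IHn] u k; first by rewrite big_ord0 tuple0 andbF.
case/tupleP: u => c u; rewrite big_mkcond big_ord_recl /= -big_mkcond /=.
case: k => [|k] /=; first by rewrite big_pred0 // mulr1 andbF.
under eq_bigr do rewrite tnthS.
by rewrite IHn tnth0 -signr_addb andb_addr.
Qed.

(** A permutation of n + 1 letters is the position of the first letter together with a permutation
    of the others, which is the recursion of [ksym]. Injectivity is enough, both sides having (n +
    1)! elements. *)
Lemma lift_perm_bij n :
  bijective (fun ks : 'I_n.+1 * 'S_n => lift_perm ord0 ks.1 ks.2).
Proof.
apply: inj_card_bij => [[k s] [k' s'] /= eqs|]; last first.
  by rewrite card_prod !card_Sn card_ord factS.
have eqk : k = k' by rewrite -(lift_perm_id ord0 k s) eqs lift_perm_id.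
rewrite -eqk in eqs *; congr (_, _); apply/permP => i.
by apply: (@lift_inj _ k); rewrite -!(lift_perm_lift ord0) eqs.
Qed.

Lemma pword_lift (T : Type) n k (s : 'S_n) x (t : n.-tuple T) :
  pword (lift_perm ord0 k s) [tuple of x :: t]
  = take k (pword s t) ++ x :: drop k (pword s t) :> seq T.
Proof.
set w := pword s t.
have szk : size (take k w) = k by rewrite size_takel // size_tuple -ltnS.
apply: (@eq_from_nth _ x) => [|i].
  rewrite size_tuple size_cat szk (_ : size (x :: drop k w) = (n - k).+1).
    by rewrite addnS subnKC // -ltnS.
  by have /= -> := size_drop k w; rewrite (size_tuple w).
rewrite size_tuple => ltin; pose i' := Ordinal ltin.
rewrite -[i]/(nat_of_ord i') -tnth_nth tnth_mktuple lift_permV nth_cat szk.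
case: (unliftP k i') => [j|] ->; last by rewrite lift_perm_id ltnn subnn tnth0.
rewrite lift_perm_lift tnthS /= /bump.
have -> : tnth t ((s^-1)%g j) = nth x w j by rewrite -tnth_nth tnth_mktuple.
case: (leqP k j) => kj /=.
  rewrite add1n ltnNge (leq_trans kj) //= subSn //=.
  by rewrite nth_drop subnKC.
by rewrite add0n kj nth_take.
Qed.

(** The inversions involving the first letter correspond to the k letters placed before it; the
    other inversions are those of s. *)
Lemma ksign_lift n k (s : 'S_n) (b : bool) (p : n.-tuple bool) :
  ksign K (lift_perm ord0 k s) (b :: p)
  = sgn (b && word_parity id (take k (pword s p))) * ksign K s p.
Proof.
have -> : ksign K (lift_perm ord0 k s) (b :: p)
    = ksign K (lift_perm ord0 k s) [tuple of b :: p] by [].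
rewrite ksignE big_ord_recl; congr (_ * _).
  rewrite big_mkcond big_ord_recl /= mul1r -big_mkcond.
  rewrite -(prod_signs b (pword s p) k) [RHS](reindex_inj (@perm_inj _ s)) /=.
  apply: eq_big => [j|j _].
    rewrite lift_perm_id lift_perm_lift /= /bump.
    by case: (leqP k (s j)) => [kj|//]; rewrite add1n ltnNge (leq_trans kj).
  by rewrite tnth0 tnthS tnth_mktuple permK.
rewrite ksignE; apply: eq_bigr => i _.
rewrite big_mkcond big_ord_recl /= mul1r -big_mkcond /=.
apply: eq_big => [j|j _]; last by rewrite !tnthS.
by rewrite !lift_perm_lift /= /bump !add1n ltnS !ltnNge leq_bump2.
Qed.

Lemma ksym_perm (W : lmodType K) n (t : n.-tuple X) (f : seq X -> W) :
  \sum_(s : 'S_n) ksign K s (map par t) *: f (pword s t) = ksym par f t.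
Proof.
elim: n t f => [|n IHn] t f.
  rewrite (big_pred1 1%g) => [|s]; last first.
    by apply/esym/eqP/permP => -[].
  rewrite pword1 [t]tuple0 /=.
  by rewrite /ksign big_ord0 scale1r.
case/tupleP: t => x t.
rewrite (reindex _ (onW_bij _ (lift_perm_bij n))) /=.
rewrite -(pair_bigA _ (fun k s => ksign K (lift_perm ord0 k s) (par x :: map par t)
   *: f (pword (lift_perm ord0 k s) [tuple of x :: t]))) exchange_big /=.
rewrite -IHn; apply: eq_bigr => s _.
have cuts_tuple h (w : n.-tuple X) :
    cuts h w = \sum_(k < n.+1) h (take k w) (drop k w) :> W.
  by rewrite cutsE size_tuple.
rewrite insE cuts_tuple scaler_sumr; apply: eq_bigr => k _.
rewrite pword_lift (ksign_lift k s (par x) (map_tuple par t)) scalerA mulrC.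
by rewrite pword_map /= -map_take /word_parity foldr_map.
Qed.

Lemma swapsym_perm (W : lmodType K) n (s : 'S_n) (t : n.-tuple X)
    (f : seq X -> W) : swapsym par f ->
  ksign K s (map par t) *: f (pword s t) = f t.
Proof.
elim: n s t f => [|n IHn] s t f symf.
  rewrite /ksign big_ord0 scale1r; congr (f (tval _)).
  by apply: eq_from_tnth => -[].
case/tupleP: t => x t.
case: (lift_perm_bij n) => g _ /(_ s) <-; case: (g s) => k {}s /=.
rewrite pword_lift (swapsym_front _ _ _ symf) cat_take_drop.
rewrite (ksign_lift k s (par x) (map_tuple par t)) pword_map /= -map_take.
rewrite {1}/word_parity foldr_map mulrC -scalerA sgnK.
by rewrite (IHn _ _ (fun u => f (x :: u))) //; apply: swapsym_cons.
Qed.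

Lemma perm_swapsym (W : lmodType K) (f : seq X -> W) :
  (forall n (s : 'S_n) (t : n.-tuple X),
     ksign K s (map par t) *: f (pword s t) = f t) -> swapsym par f.
Proof.
move=> permf.
(* A lift of the identity moves a single letter. An adjacent swap is then obtained by moving y to
   the front in both words, which gives the same word. *)
have front u x v : f (u ++ x :: v) = sgn (par x && word_parity par u) *: f (x :: u ++ v).
  pose t := in_tuple (u ++ v).
  have ltu : (size u < (size (u ++ v)).+1)%N by rewrite ltnS size_cat leq_addr.
  have := permf _ (lift_perm ord0 (Ordinal ltu) 1%g) [tuple of x :: t].
  rewrite pword_lift (ksign_lift _ _ (par x) (map_tuple par t)) !pword1 ksign1.
  rewrite mulr1 /= -map_take take_size_cat // drop_size_cat // => <-.
  by rewrite /word_parity foldr_map sgnK.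
move=> u x y v; rewrite [in RHS]front -cat_rcons front cat_rcons scalerA.
rewrite parw_rcons -signr_addb; congr ((-1) ^+ nat_of_bool _ *: _).
by case: (par x); case: (par y); case: (word_parity par u).
Qed.

End Permutations.

(** * Rotations and cyclic sums *)

Section Rotation.

Variables (K : fieldType) (X : Type) (par : X -> bool).
Notation sgn b := ((-1) ^+ nat_of_bool b : K).

(** The rotation brings the last letter to the front, so it undoes the move of the first letter to
    the end, to which [pword_lift] and [ksign_lift] apply. *)
Lemma rot_permE n : rot_perm n.+1 = ((lift_perm ord0 ord_max 1)^-1)%g.
Proof.
rewrite lift_permV invg1; apply/permP => i; apply: val_inj; rewrite permE /=.
case: (unliftP ord_max i) => [j|] ->; last by rewrite lift_perm_id /= modnn.
rewrite lift_perm_lift perm1 /= /bump leqNgt ltn_ord /= add0n add1n modn_small //.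
by rewrite ltnS ltn_ord.
Qed.

Lemma pword_rot (T : Type) n (x : T) (u : n.-tuple T) :
  pword (rot_perm n.+1) [tuple of rcons u x] = [tuple of x :: u].
Proof.
have -> : [tuple of rcons u x] = pword (lift_perm ord0 ord_max 1%g) [tuple of x :: u].
  apply: val_inj; rewrite [RHS]pword_lift pword1.
  by rewrite take_oversize ?size_tuple // drop_oversize ?size_tuple // cats1.
by rewrite -pwordM rot_permE mulgV pword1.
Qed.

Lemma ksign_rot n (b : bool) (p : n.-tuple bool) :
  ksign K (rot_perm n.+1) (rcons p b) = sgn (b && word_parity id p).
Proof.
have E : pword (lift_perm ord0 ord_max 1%g) [tuple of b :: p] = [tuple of rcons p b].
  apply: val_inj; rewrite [LHS]pword_lift pword1.
  by rewrite take_oversize ?size_tuple // drop_oversize ?size_tuple // cats1.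
have := ksignM K (lift_perm ord0 ord_max 1%g) (rot_perm n.+1) [tuple of b :: p].
rewrite E rot_permE mulgV ksign1 ksign_lift pword1 ksign1 mulr1.
rewrite take_oversize ?size_tuple //= => e.
apply: (mulfI (_ : sgn (b && word_parity id p) != 0)); first by rewrite signr_eq0.
by rewrite -e -signr_addb addbb.
Qed.

Lemma rot_cycsym (W : lmodType K) (f : seq X -> W) :
  (forall n (t : n.-tuple X),
     ksign K (rot_perm n) (map par t) *: f (pword (rot_perm n) t) = f t)
  <-> cycsym par f.
Proof.
have sgnE n (x : X) (u : n.-tuple X) :
    ksign K (rot_perm n.+1) (map par (rcons u x)) = sgn (par x && word_parity par u).
  by rewrite map_rcons (ksign_rot (par x) (map_tuple par u)) /word_parity foldr_map.
split=> [rotf u x|cycf [|n] t].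
- have := rotf _ [tuple of rcons (in_tuple u) x].
  by rewrite sgnE pword_rot => <-.
- rewrite [t]tuple0 /ksign big_ord0 scale1r; congr (f (tval _)).
  by apply: eq_from_tnth => -[].
have [u [x tE]] : exists u x, tval t = rcons u x.
  by case: t => s /= szs; case/lastP: s szs => // u x _; exists u, x.
have [szu] : (size u).+1 = n.+1 by rewrite -(size_rcons u x) -tE size_tuple.
have -> : t = [tuple of rcons (tcast szu (in_tuple u)) x].
  by apply: val_inj; rewrite /= tE val_tcast.
by rewrite sgnE pword_rot [RHS](cycf _ x).
Qed.

Lemma expg_rot n k (i : 'I_n.+1) :
  ((rot_perm n.+1) ^+ k)%g i = ((i + k) %% n.+1)%N :> nat.
Proof.
elim: k => [|k IHk]; first by rewrite expg0 perm1 addn0 modn_small.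
by rewrite expgSr permM permE /= IHk -addn1 modnDml -addnA addn1.
Qed.

(** On the empty word the cyclic group has one element: this is the origin of [maxn n 1] in all the
    normalizations by n. *)
Lemma card_rot n : #|<[rot_perm n]>%g| = maxn n 1.
Proof.
case: n => [|n].
  rewrite (_ : rot_perm 0 = 1%g) ?cycle1 ?cards1 //; by apply/permP => -[].
apply/eqP; rewrite (maxn_idPl _) // eqn_dvd; apply/andP; split.
  rewrite -/(order _) order_dvdn; apply/eqP/permP => i; apply: val_inj.
  by rewrite /= expg_rot perm1 modnDr modn_small.
have := expg_rot #[rot_perm n.+1]%g (@ord0 n); rewrite expg_order perm1 add0n.
by move/esym/eqP.
Qed.

Definition kcyc (W : lmodType K) (f : seq X -> W) (s : seq X) : W :=
  \sum_(r in <[rot_perm (size s)]>%g)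
     ksign K r (map par s) *: f (pword r (in_tuple s)).

Lemma kcyc_tuple (W : lmodType K) (f : seq X -> W) n (t : n.-tuple X) :
  kcyc f t = \sum_(r in <[rot_perm n]>%g) ksign K r (map par t) *: f (pword r t).
Proof.
case: t => s szs /=; rewrite /kcyc; move: (szs); rewrite -(eqP szs) => szs'.
by apply: eq_bigr => r _; congr (_ *: f (tval (pword r _))); apply: val_inj.
Qed.

Lemma cycsym_kcyc (W : lmodType K) (f : seq X -> W) : cycsym par (kcyc f).
Proof.
apply/rot_cycsym => n t; rewrite !kcyc_tuple scaler_sumr.
rewrite [RHS](reindex_inj (mulgI (rot_perm n))).
apply: eq_big => [r|r _]; first by rewrite groupMl // cycle_id.
rewrite scalerA (ksignM K (rot_perm n) r (map_tuple par t)) pword_map.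
by rewrite pwordM.
Qed.

Lemma cycsym_kcycE (W : lmodType K) (f : seq X -> W) s : cycsym par f ->
  kcyc f s = (maxn (size s) 1)%:R *: f s.
Proof.
move=> /rot_cycsym cycf; rewrite -card_rot -sum1_card natr_sum scaler_suml.
apply: eq_bigr => r /cycleP[k ->]; rewrite scale1r.
elim: k => [|k IHk].
  by rewrite expg0 pword1 (ksign1 K (map_tuple par (in_tuple s))) scale1r.
rewrite expgSr (ksignM K _ _ (map_tuple par (in_tuple s))) pwordM pword_map.
by rewrite -scalerA cycf.
Qed.

(** Each rotation is absorbed by reindexing the sum over the symmetric group. *)
Lemma ksym_kcyc (W : lmodType K) (f : seq X -> W) s :
  ksym par (kcyc f) s = (maxn (size s) 1)%:R *: ksym par f s.
Proof.
rewrite -(ksym_perm par (in_tuple s)) -(ksym_perm par (in_tuple s)).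
under eq_bigr do rewrite kcyc_tuple scaler_sumr.
rewrite exchange_big -card_rot -sum1_card natr_sum scaler_suml.
apply: eq_bigr => r _; rewrite scale1r [RHS](reindex_inj (mulIg r)).
apply: eq_bigr => q _.
by rewrite (ksignM K q r (map_tuple par (in_tuple s))) pword_map pwordM scalerA.
Qed.

End Rotation.

(** * Homogeneous words *)

Section HomogeneousWords.

Variables (K : fieldType) (V : vectType K) (G : grading V).
Notation sgn b := ((-1) ^+ nat_of_bool b : K).

Definition gproj (d : int) (x : V) : V := sumv_pi_for (gpiece_sum G) d x.

Lemma gproj_mem d x : gproj d x \in G d.
Proof. exact: memv_sum_pi. Qed.

Lemma gprojP d a x y : gproj d (a *: x + y) = a *: gproj d x + gproj d y.
Proof. exact: linearP. Qed.

Lemma sum_gproj x : \sum_(d <- gsupp G) gproj d x = x.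
Proof. by apply: sumv_pi_uniq_sum; rewrite ?filter_predT ?gsupp_uniq ?memvf. Qed.

Lemma gpiece_independent (us : int -> V) :
  (forall d, us d \in G d) -> \sum_(d <- gsupp G) us d = 0 ->
  forall d, us d = 0.
Proof.
move=> usG sum0 d; have [dG|/gpiece_out d0] := boolP (d \in gsupp G); last first.
  by apply/eqP; rewrite -memv0 -d0.
have dirG : directv (\sum_(i < size (gsupp G)) G (gsupp G)`_i).
  have := gpiece_direct G; rewrite !directvE /= (big_nth 0) big_mkord => /eqP->.
  by rewrite (big_nth 0) big_mkord.
move/directv_sum_independent: dirG => /(_ (fun i => us (gsupp G)`_i)) indep.
have ltd : (index d (gsupp G) < size (gsupp G))%N by rewrite index_mem.
have := indep _ _ (Ordinal ltd) isT; rewrite /= nth_index //; apply => //.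
by rewrite -[RHS]sum0 [RHS](big_nth 0) big_mkord.
Qed.

Lemma gproj_hom d d' x : x \in G d -> gproj d' x = if d' == d then x else 0.
Proof.
move=> xG; apply/eqP; rewrite -subr_eq0; apply/eqP.
apply: (gpiece_independent (us := fun e => gproj e x - if e == d then x else 0)).
  by move=> e; rewrite memvB ?gproj_mem //; case: eqP => [->|]; rewrite ?mem0v.
rewrite sumrB sum_gproj -big_mkcond; apply/eqP; rewrite subr_eq0; apply/eqP.
have [dG|/gpiece_out d0] := boolP (d \in gsupp G).
  by rewrite -big_filter filter_pred1_uniq ?gsupp_uniq // big_seq1.
have -> : x = 0 by apply/eqP; rewrite -memv0 -d0.
by rewrite big1.
Qed.

Lemma gpiece_eq d d' x : x \in G d -> x \in G d' -> x != 0 -> d = d'.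
Proof.
move=> xd xd' x0; apply/eqP; apply: contraNT x0 => ne; apply/eqP.
have := gproj_hom d xd; rewrite eqxx => <-.
by rewrite (gproj_hom d xd') (negPf ne).
Qed.

Lemma parity_part_hom p d x :
  x \in G d -> parity_part G p x = if odd_letter d == p then x else 0.
Proof.
move=> xG; rewrite /parity_part big_mkcond /=.
rewrite (eq_bigr (fun e => if e == d then
   (if odd_letter d == p then x else 0) else 0)); last first.
  move=> e _; rewrite -/(gproj e x) (gproj_hom e xG).
  by case: (e =P d) => [->|_]; rewrite ?if_same.
rewrite -big_mkcond; have [dG|/gpiece_out d0] := boolP (d \in gsupp G).
  by rewrite -big_filter filter_pred1_uniq ?gsupp_uniq // big_seq1.
have -> : x = 0 by apply/eqP; rewrite -memv0 -d0.
by rewrite if_same big1.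
Qed.

Lemma parity_partP p a x y : parity_part G p (a *: x + y)
  = a *: parity_part G p x + parity_part G p y.
Proof.
rewrite /parity_part scaler_sumr -big_split; apply: eq_bigr => d _.
exact: linearP.
Qed.

(* Identities between multilinear maps are checked on words in these letters
   (multilinear_ext), where the Koszul signs are plain scalars. *)
Record letter := Letter { ldeg : int; lvec : V; lvecP : lvec \in G ldeg }.

Definition letter_parity (l : letter) := odd_letter (ldeg l).
Notation vecs := (map lvec).
Notation degs := (map ldeg).

Lemma letter_eq (l l' : letter) : ldeg l = ldeg l' -> lvec l = lvec l' -> l = l'.
Proof.
case: l l' => [d x xd] [d' x' xd'] /= dd xx; subst.
by rewrite (bool_irrelevance xd xd').
Qed.

Lemma hword_letters ds s :
  hword G ds s -> exists2 t, ds = degs t & s = vecs t.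
Proof.
elim: ds s => [|d ds IHds] [|x s] //=; first by exists [::].
by case/andP => xd /IHds[t -> ->]; exists (Letter xd :: t).
Qed.

Lemma letters_hword t : hword G (degs t) (vecs t).
Proof. by elim: t => //= l t ->; rewrite lvecP. Qed.

Definition letter_proj d x : letter := Letter (gproj_mem d x).

Section Multilinear.

Variable W : lmodType K.

Lemma multilinear0 (F : seq V -> W) s : multilinear F -> 0 \in s -> F s = 0.
Proof.
move=> mF /splitPr[s1 s2].
have := mF s1 s2 (-1) 0 0; rewrite scaler0 addr0 => ->.
by rewrite scaleN1r addNr.
Qed.

Lemma multilinear_cons (F : seq V -> W) x :
  multilinear F -> multilinear (fun s => F (x :: s)).
Proof. by move=> mF s1 s2; apply: (mF (x :: s1) s2). Qed.

Lemma multilinear_sum (F : seq V -> W) s1 s2 (I : Type) (r : seq I)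
    (P : pred I) (x : I -> V) : multilinear F ->
  F (s1 ++ \sum_(i <- r | P i) x i :: s2) = \sum_(i <- r | P i) F (s1 ++ x i :: s2).
Proof.
move=> mF; elim: r => [|i r IHr].
  by rewrite !big_nil multilinear0 // mem_cat mem_head orbT.
by rewrite !big_cons; case: ifP => // _; rewrite -[x i]scale1r mF IHr !scale1r.
Qed.

Lemma multilinear_ext (F F' : seq V -> W) :
  multilinear F -> multilinear F' ->
  (forall t : seq letter, F (vecs t) = F' (vecs t)) -> F =1 F'.
Proof.
move=> mF mF' eqF s; suff: forall t, F (vecs t ++ s) = F' (vecs t ++ s).
  by move/(_ [::]).
elim: s => [|x s IHs] t; first by rewrite cats0.
rewrite -(sum_gproj x) !multilinear_sum //; apply: eq_bigr => d _.
rewrite -cat_rcons -[gproj d x]/(lvec (letter_proj d x)) -map_rcons.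
exact: IHs.
Qed.

Lemma multilinear_tuple (F : seq V -> W) n (k : 'I_n) (f : 'I_n -> V) a x y :
  multilinear F ->
  F [tuple if i == k then a *: x + y else f i | i < n]
  = a *: F [tuple if i == k then x else f i | i < n]
    + F [tuple if i == k then y else f i | i < n].
Proof.
move=> mF; pose w := [tuple f i | i < n].
have wE z : [tuple if i == k then z else f i | i < n]
    = take k w ++ z :: drop k.+1 w :> seq V.
  have szk : size (take k w) = k by rewrite size_takel // size_tuple ltnW.
  apply: (@eq_from_nth _ 0) => [|i].
    have szd : size (drop k.+1 w) = (n - k.+1)%N by rewrite size_drop size_tuple.
    rewrite size_tuple size_cat szk -[size (_ :: _)]/((size (drop k.+1 w)).+1).
    by rewrite szd subnSK // subnKC // ltnW.
  rewrite size_tuple => ltin; pose i' := Ordinal ltin.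
  rewrite -[i]/(nat_of_ord i') -tnth_nth tnth_mktuple nth_cat szk -val_eqE /=.
  have wi : f i' = nth 0 w i by rewrite -[i]/(nat_of_ord i') -tnth_nth tnth_mktuple.
  case: ltngtP => [ik|ki|->]; last by rewrite subnn.
    by rewrite nth_take.
  by rewrite -(subnSK ki) /= nth_drop subnKC.
by rewrite !wE mF.
Qed.

(** Only the choice p of the actual parities contributes: any other p puts a zero parity part in
    some slot. *)
Lemma koszul_act_letters n (sg : 'S_n) (F : seq V -> W) (t : n.-tuple letter) :
  multilinear F ->
  koszul_act G sg F (map_tuple lvec t)
  = ksign K sg (map letter_parity t) *: F (vecs (pword sg t)).
Proof.
move=> mF; rewrite /koszul_act (bigD1 (map_tuple letter_parity t)) //= big1 ?addr0.
  congr (_ *: F (tval _)); apply: eq_from_tnth => i.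
  rewrite !(tnth_map, tnth_ord_tuple).
  by rewrite (parity_part_hom _ (lvecP _)) eqxx.
move=> p neqp; have [i neqi] : exists i, tnth p i != letter_parity (tnth t i).
  apply/existsP; apply: contra_neqT neqp => /existsPn eqp.
  apply: eq_from_tnth => i; rewrite tnth_map.
  by apply/eqP; rewrite -[_ == _]negbK eqp.
rewrite (multilinear0 mF) ?scaler0 //; apply/mapP; exists (sg i).
  by rewrite mem_enum.
rewrite permK tnth_map (parity_part_hom _ (lvecP _)).
by rewrite eq_sym (negPf neqi).
Qed.

(* Covers at once the action of one permutation, and the sums over a subgroup,
   by the choice of the weights c. *)
Lemma multilinear_act (c : forall n, 'S_n -> K) (F : seq V -> W) :
  multilinear F -> multilinear (fun s =>
    \sum_(sg : 'S_(size s)) c _ sg *: koszul_act G sg F (in_tuple s)).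
Proof.
move=> mF s1 s2 a x y.
(* The type ['S_(size s)] depends on the word; on tuples of a fixed length n the three sums have the
   same index type. *)
pose act n (u : n.-tuple V) := \sum_(sg : 'S_n) c n sg *: koszul_act G sg F u.
have actE n (u : n.-tuple V) : act (size u) (in_tuple u) = act n u.
  case: u => u szu /=; move: (szu); rewrite -(eqP szu) => szu'.
  by congr (act _ _); apply: val_inj.
pose n := (size s1 + (size s2).+1)%N.
have ltk : (size s1 < n)%N by rewrite /n addnS ltnS leq_addr.
pose k := Ordinal ltk.
pose f (i : 'I_n) := nth 0 (s1 ++ 0 :: s2) i.
pose u z := [tuple if i == k then z else f i | i < n].
have uE z : s1 ++ z :: s2 = u z.
  apply: (@eq_from_nth _ 0) => [|i]; first by rewrite size_tuple size_cat.
  rewrite size_cat => ltin0; have ltin : (i < n)%N := ltin0.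
  rewrite -[i]/(nat_of_ord (Ordinal ltin)) -tnth_nth tnth_mktuple -val_eqE /=.
  rewrite /f !nth_cat /=; case: ltngtP => //= [ki|->]; last by rewrite subnn.
  by rewrite -(subnSK ki).
have e z : \sum_(sg : 'S_(size (s1 ++ z :: s2)))
    c _ sg *: koszul_act G sg F (in_tuple (s1 ++ z :: s2)) = act n (u z).
  by rewrite uE; apply: actE.
rewrite !e /act scaler_sumr -big_split; apply: eq_bigr => sg _ /=.
rewrite scalerA mulrC -scalerA -scalerDr; congr (_ *: _).
rewrite /koszul_act scaler_sumr -big_split; apply: eq_bigr => p _.
have wE z : [tuple parity_part G (tnth p ((sg^-1)%g i)) (tnth (u z) ((sg^-1)%g i)) | i < n]
  = [tuple if i == sg k then parity_part G (tnth p k) z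
     else parity_part G (tnth p ((sg^-1)%g i)) (f ((sg^-1)%g i)) | i < n].
  apply: eq_from_tnth => i; rewrite !tnth_mktuple.
  case: (i =P sg k) => [->|ne]; first by rewrite permK eqxx.
  by case: eqP => // ek; case: ne; rewrite -ek permKV.
by rewrite !wE parity_partP multilinear_tuple // scalerDr scalerA mulrC -scalerA.
Qed.

End Multilinear.

End HomogeneousWords.

(** * Symmetric and cyclic forms as functions of homogeneous words *)

Section Forms.

Variables (K : fieldType) (V : vectType K) (G : grading V).
Notation letter := (letter G).
Notation vecs := (map (@lvec K V G)).
Notation lpar := (@letter_parity K V G).
Notation sgn b := ((-1) ^+ nat_of_bool b : K).

Definition onl (W : lmodType K) (F : seq V -> W) (t : seq letter) : W := F (vecs t).

Lemma sum_act_tuple (W : lmodType K) (c : forall n, 'S_n -> K) (F : seq V -> W)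
    n (x : n.-tuple V) :
  \sum_(sg : 'S_(size x)) c _ sg *: koszul_act G sg F (in_tuple x)
  = \sum_(sg : 'S_n) c n sg *: koszul_act G sg F x.
Proof.
case: x => x szx /=; move: (szx); rewrite -(eqP szx) => szx'.
by apply: eq_bigr => sg _; congr (_ *: koszul_act G sg F _); apply: val_inj.
Qed.

Lemma koszul_act_fixed (W : lmodType K) n (sg : 'S_n) (F : seq V -> W) :
  multilinear F ->
  (forall t : n.-tuple letter,
     ksign K sg (map lpar t) *: onl F (pword sg t) = onl F t) ->
  forall x : n.-tuple V, koszul_act G sg F x = F x.
Proof.
move=> mF fixF x.
(* [multilinear_act] takes weights in all arities: this one is 1 on [sg] in arity n and 0 elsewhere.
   It compares values because r and [sg] live in different types. *)
pose c m (r : 'S_m) : K := ((m == n)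
  && [forall i : 'I_m, forall j : 'I_n,
           (i == j :> nat) ==> (r i == sg j :> nat)])%:R.
have cE r : c n r = (r == sg)%:R.
  rewrite /c eqxx /=; congr (nat_of_bool _)%:R; apply/forallP/eqP => [eqr|-> i].
    by apply/permP => i; have /forallP/(_ i) := eqr i; rewrite eqxx => /eqP/val_inj.
  by apply/forallP => j; apply/implyP => /eqP/val_inj ->.
have actE (y : n.-tuple V) :
    \sum_(r : 'S_(size y)) c _ r *: koszul_act G r F (in_tuple y)
    = koszul_act G sg F y.
  rewrite sum_act_tuple (bigD1 sg) //= cE eqxx scale1r big1 ?addr0 // => r /negPf ne.
  by rewrite cE ne scale0r.
have ext : (fun s => \sum_(r : 'S_(size s)) c _ r *: koszul_act G r F (in_tuple s))
    =1 (fun s => if size s == n then F s else 0).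
  apply: (multilinear_ext (G := G)) (multilinear_act G c mF) _ _ => [s1 s2 a y z|t].
    by rewrite !size_cat /=; case: ifP => _; rewrite ?mF // scaler0 addr0.
  case: eqP => [szt0|/eqP/negPf szt]; last first.
    by rewrite big1 // => r _; rewrite /c szt scale0r.
  have szt : size t = n by rewrite -szt0 size_map.
  have [u ->] : exists u : n.-tuple letter, t = u.
    by exists (tcast szt (in_tuple t)); rewrite val_tcast.
  have := actE (map_tuple (@lvec K V G) u); rewrite [tval (map_tuple _ _)]/= => ->.
  by rewrite koszul_act_letters // fixF.
by have := ext x; rewrite actE size_tuple eqxx.
Qed.

Lemma koszul_symmetricP (W : lmodType K) (F : seq V -> W) : multilinear F ->
  koszul_symmetric G F <-> swapsym lpar (onl F).
Proof.
move=> mF; split=> [symF|swapF n sg x].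
  by apply: perm_swapsym => n s t; rewrite /onl -koszul_act_letters.
by apply: koszul_act_fixed => // t; apply: swapsym_perm.
Qed.

Lemma koszul_cyclicP (F : mform V) : multilinear F ->
  koszul_cyclic G F <-> cycsym lpar (onl F).
Proof.
move=> mF; split=> [cycF|/rot_cycsym rotF n x].
  by apply/rot_cycsym => n t; rewrite /onl -koszul_act_letters.
exact: koszul_act_fixed.
Qed.

Lemma symmetric_cyclic (F : mform V) : symmetric_mform G F -> cyclic_mform G F.
Proof. by case=> mF symF; split=> // n x; apply: symF. Qed.

Lemma sym_formE (F : mform V) s :
  sym_form G F s = \sum_(sg : 'S_(size s)) 1 *: koszul_act G sg F (in_tuple s).
Proof. by apply: eq_bigr => r _; rewrite scale1r. Qed.

Lemma cycl_formE (F : mform V) s :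
  cycl_form G F s = \sum_(sg : 'S_(size s))
    (sg \in <[rot_perm (size s)]>%g)%:R *: koszul_act G sg F (in_tuple s).
Proof.
rewrite /cycl_form big_mkcond; apply: eq_bigr => r _.
by case: ifP; rewrite ?scale1r ?scale0r.
Qed.

Lemma onl_sym_form (F : mform V) (t : seq letter) : multilinear F ->
  onl (sym_form G F) t = ksym lpar (onl F) t.
Proof.
move=> mF; rewrite /onl -(ksym_perm lpar (in_tuple t)) sym_formE.
have -> := sum_act_tuple (fun _ _ => 1) F (map_tuple (@lvec K V G) (in_tuple t)).
by apply: eq_bigr => r _; rewrite scale1r koszul_act_letters.
Qed.

Lemma onl_cycl_form (F : mform V) (t : seq letter) : multilinear F ->
  onl (cycl_form G F) t = kcyc lpar (onl F) t.
Proof.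
move=> mF; rewrite /onl /kcyc cycl_formE.
have -> := sum_act_tuple (fun n r => (r \in <[rot_perm n]>%g)%:R) F
  (map_tuple (@lvec K V G) (in_tuple t)).
rewrite [RHS]big_mkcond; apply: eq_bigr => r _.
by rewrite koszul_act_letters //; case: ifP; rewrite ?scale1r ?scale0r.
Qed.

Lemma multilinear_sym_form (F : mform V) : multilinear F -> multilinear (sym_form G F).
Proof.
move=> mF s1 s2 a x y; have := multilinear_act G (fun _ _ => 1) mF s1 s2 a x y.
by rewrite -!sym_formE.
Qed.

Lemma multilinear_cycl_form (F : mform V) : multilinear F -> multilinear (cycl_form G F).
Proof.
move=> mF s1 s2 a x y.
have := multilinear_act G (fun n r => (r \in <[rot_perm n]>%g)%:R) mF s1 s2 a x y.
by rewrite -!cycl_formE.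
Qed.

Lemma symmetric_sym_form (F : mform V) : multilinear F -> symmetric_mform G (sym_form G F).
Proof.
move=> mF; have mS := multilinear_sym_form mF; split=> //.
apply/koszul_symmetricP => // u x y v.
by rewrite !onl_sym_form // (swapsym_ksym lpar (onl F)).
Qed.

Lemma cyclic_cycl_form (F : mform V) : multilinear F -> cyclic_mform G (cycl_form G F).
Proof.
move=> mF; have mC := multilinear_cycl_form mF; split=> //.
by apply/koszul_cyclicP => // u x; rewrite !onl_cycl_form // cycsym_kcyc.
Qed.

End Forms.

(** * Masks as splittings; multilinear extension from homogeneous words *)

Section Masks.

Variables (K : fieldType) (V : vectType K) (G : grading V).
Notation letter := (letter G).
Notation vecs := (map (@lvec K V G)).
Notation degs := (map (@ldeg K V G)).
Notation lpar := (@letter_parity K V G).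
Notation sgn b := ((-1) ^+ nat_of_bool b : K).

Lemma shsign_cons n (b : bool) (m : n.-tuple bool) (l : letter) (t : seq letter) :
  size t = n ->
  shsign K [tuple of b :: m] (degs (l :: t))
  = sgn (~~ b && lpar l && word_parity lpar (mask m t)) * shsign K m (degs t).
Proof.
move=> szt; rewrite /shsign big_ord_recl; congr (_ * _).
  rewrite big_mkcond big_ord_recl /= mul1r -big_mkcond /= tnth0.
  under eq_bigl do rewrite tnthS.
  case: b => /=; first by rewrite big_pred0.
  elim: n m t szt => [|n IHn] m t szt.
    by rewrite big_ord0 tuple0 /= andbF.
  case/tupleP: m => c m; case: t szt => // l' t [szt].
  rewrite big_mkcond big_ord_recl -big_mkcond tnth0 /=.
  under eq_bigl do rewrite tnthS.
  rewrite (IHn m t szt).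
  case: c => /=; last by rewrite mul1r.
  by rewrite -/(lpar l) -/(lpar l'); case: (lpar l); rewrite ?mul1r //= signr_addb;
    case: (lpar l').
apply: eq_bigr => i _; rewrite big_mkcond big_ord_recl /= mul1r -big_mkcond /=.
by apply: eq_bigl => j; rewrite !tnthS.
Qed.

(** The first bit of the mask decides between the two terms of [shsum]; an unselected l is passed by
    all the selected letters after it, hence its sign. *)
Lemma shsum_masks (W : lmodType K) n (t : seq letter)
    (h : seq letter -> seq letter -> W) : size t = n ->
  \sum_(m : n.-tuple bool)
     shsign K m (degs t) *: h (mask m t) (mask (map negb m) t)
  = shsum lpar h t.
Proof.
elim: n t h => [|n IHn] [|l t] h //= => [_|[szt]].
  rewrite (big_pred1 [tuple]) => [|m]; last by apply/esym/eqP; rewrite [m]tuple0.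
  by rewrite /shsign big_ord0 scale1r.
pose c (bm : bool * n.-tuple bool) := [tuple of bm.1 :: bm.2].
have bij_c : bijective c.
  exists (fun m => (thead m, [tuple of behead m])) => [[b m]|m].
    by congr (_, _); apply: val_inj.
  by rewrite /c -tuple_eta.
rewrite (reindex _ (onW_bij _ bij_c)).
rewrite -(pair_bigA _ (fun b m => shsign K (c (b, m)) (ldeg l :: degs t)
  *: h (mask (c (b, m)) (l :: t)) (mask (map negb (c (b, m))) (l :: t)))) /=.
rewrite big_bool /= -!IHn //; congr (_ + _); apply: eq_bigr => m _.
  by rewrite (shsign_cons true m l szt) mul1r.
by rewrite (shsign_cons false m l szt) /= mulrC scalerA.
Qed.

Lemma has_mask n (m : n.-tuple bool) (t : seq letter) : size t = n ->
  has id m = ~~ nilp (mask m t).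
Proof.
move=> szt; rewrite /nilp size_mask ?szt ?size_tuple //.
by rewrite has_count lt0n.
Qed.

Lemma shsum_has_masks (W : lmodType K) n (t : seq letter)
    (h : seq letter -> seq letter -> W) : size t = n ->
  \sum_(m : n.-tuple bool | has id m)
     shsign K m (degs t) *: h (mask m t) (mask (map negb m) t)
  = shsum lpar (fun I J => if I is [::] then 0 else h I J) t.
Proof.
move=> szt; rewrite -(shsum_masks _ szt) big_mkcond; apply: eq_bigr => m _.
by rewrite (has_mask m szt); case: (mask m t) => //=; rewrite scaler0.
Qed.

Lemma shsum_proper_masks (W : lmodType K) n (t : seq letter)
    (h : seq letter -> seq letter -> W) : size t = n ->
  \sum_(m : n.-tuple bool | proper_mask m)
     shsign K m (degs t) *: h (mask m t) (mask (map negb m) t)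
  = shsum lpar (fun I J => if ~~ nilp I && ~~ nilp J then h I J else 0) t.
Proof.
move=> szt; rewrite -(shsum_masks _ szt) big_mkcond; apply: eq_bigr => m _.
rewrite /proper_mask (has_mask m szt).
have -> : has negb m = has id (map_tuple negb m) by rewrite has_map.
by rewrite (has_mask _ szt) /=; case: ifP; rewrite ?scaler0.
Qed.

Section MultilinearWords.

Variable W : lmodType K.
Implicit Types (H : seq letter -> W) (h : seq letter -> seq letter -> W).

(** Linearity is only asked within one degree, since letters of different degrees have no sum among
    the letters. *)
Definition wmultilinear H := forall u v (x y z : letter) a,
  ldeg x = ldeg z -> ldeg y = ldeg z -> lvec z = a *: lvec x + lvec y ->
  H (u ++ z :: v) = a *: H (u ++ x :: v) + H (u ++ y :: v).

Lemma wmultilinear0 H u (z : letter) v : wmultilinear H -> lvec z = 0 ->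
  H (u ++ z :: v) = 0.
Proof.
by move=> mH z0; rewrite (mH u v z z z (-1)) ?scaleN1r ?addNr.
Qed.

Lemma wmultilinear_cons H x : wmultilinear H -> wmultilinear (fun u => H (x :: u)).
Proof. by move=> mH u; apply: (mH (x :: u)). Qed.

Lemma wmultilinearZ H b : wmultilinear H -> wmultilinear (fun u => b *: H u).
Proof.
move=> mH u v x y z a dx dy zE; rewrite (mH u v x y z a) // scalerDr !scalerA.
by rewrite mulrC.
Qed.

Lemma wmultilinear_onl (F : seq V -> W) : multilinear F -> wmultilinear (onl F).
Proof. by move=> mF u v x y z a _ _ zE; rewrite /onl !map_cat /= zE mF. Qed.

Lemma parw_subst u v (x z : letter) : ldeg x = ldeg z ->
  word_parity lpar (u ++ x :: v) = word_parity lpar (u ++ z :: v).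
Proof. by move=> dx; rewrite !parw_cat /= /letter_parity dx. Qed.

Lemma wmultilinear_shsum h : (forall J, wmultilinear (h^~ J)) ->
  (forall I, wmultilinear (h I)) -> wmultilinear (shsum lpar h).
Proof.
move=> ml mr u; elim: u h ml mr => [|l u IHu] h ml mr v x y z a dx dy zE /=.
  have [px py] : lpar x = lpar z /\ lpar y = lpar z by rewrite /letter_parity dx dy.
  rewrite px py scalerDr [RHS]addrACA.
  congr (_ + _); rewrite -shsumZ -shsumD; apply: eq_shsum => I J _ _.
    exact: (ml J [::] I x y z a).
  by rewrite (mr I [::] J x y z a) // scalerDr !scalerA mulrC.
rewrite scalerDr [RHS]addrACA; congr (_ + _); apply: IHu => //.
- by move=> J; apply: (wmultilinear_cons (H := h^~ J)).
- move=> J u1 v1 x1 y1 z1 b dx1 dy1 zE1.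
  rewrite (ml (l :: J) u1 v1 x1 y1 z1 b) // (parw_subst _ _ dx1) (parw_subst _ _ dy1).
  by rewrite scalerDr !scalerA mulrC.
- by move=> I; apply: wmultilinearZ; apply: (wmultilinear_cons (H := h I)).
Qed.

Lemma ins_wmultilinear H (x : letter) : wmultilinear H -> wmultilinear (ins lpar x H).
Proof.
move=> mH u; elim: u H mH => [|l u IHu] H mH v y1 y2 z a d1 d2 zE /=.
  have [p1 p2] : lpar y1 = lpar z /\ lpar y2 = lpar z by rewrite /letter_parity d1 d2.
  rewrite p1 p2 scalerDr [RHS]addrACA.
  rewrite (mH [:: x] v y1 y2 z a) //; congr (_ + _).
  rewrite !insE !cutsE !scaler_sumr -!big_split; apply: eq_bigr => k _ /=.
  rewrite (mH [::] (take k v ++ x :: drop k v) y1 y2 z a) //= !scalerDr !scalerA.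
  by rewrite [_ * a]mulrC.
rewrite (mH [:: x, l & u] v y1 y2 z a) // !scalerDr [RHS]addrACA; congr (_ + _).
rewrite (IHu _ (wmultilinear_cons _ mH) v y1 y2 z a) // scalerDr !scalerA.
by rewrite [_ * a]mulrC.
Qed.

Lemma eq_wmultilinear_ins H (x y z : letter) a u : wmultilinear H ->
  ldeg x = ldeg z -> ldeg y = ldeg z -> lvec z = a *: lvec x + lvec y ->
  ins lpar z H u = a *: ins lpar x H u + ins lpar y H u.
Proof.
move=> mH dx dy zE.
have [px py] : lpar x = lpar z /\ lpar y = lpar z by rewrite /letter_parity dx dy.
rewrite !insE !cutsE scaler_sumr -big_split.
apply: eq_bigr => k _ /=; rewrite (mH _ _ x y z a) // px py.
by rewrite scalerDr !scalerA mulrC.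
Qed.

Lemma wmultilinear_ksym H : wmultilinear H -> wmultilinear (ksym lpar H).
Proof.
move=> mH u; elim: u H mH => [|l u IHu] H mH v x y z a dx dy zE /=.
  rewrite -ksymZ -ksymD; apply: eq_ksym => w _ _.
  exact: eq_wmultilinear_ins.
exact: (IHu _ (ins_wmultilinear l mH) v x y z a).
Qed.

(* The multilinear extension of a function of homogeneous words. *)
Fixpoint wext H (s : seq V) : W :=
  if s is x :: s' then
    \sum_(d <- gsupp G) wext (fun t => H (letter_proj G d x :: t)) s'
  else H [::].

Lemma eq_wext H H' s : H =1 H' -> wext H s = wext H' s.
Proof.
elim: s H H' => [|x s IHs] H H' eqH //=.
by apply: eq_bigr => d _; apply: IHs => t.
Qed.

Lemma wextP H H' a s : wext (fun t => a *: H t + H' t) s = a *: wext H s + wext H' s.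
Proof.
elim: s H H' => [|x s IHs] H H' //=.
by rewrite scaler_sumr -big_split; apply: eq_bigr => d _.
Qed.

Lemma multilinear_wext H : wmultilinear H -> multilinear (wext H).
Proof.
move=> mH s1; elim: s1 H mH => [|z s1 IHs] H mH s2 a x y /=.
  rewrite scaler_sumr -big_split; apply: eq_bigr => d _ /=.
  rewrite -wextP; apply: eq_wext => t.
  by apply: (mH [::] t (letter_proj G d x) (letter_proj G d y)
    (letter_proj G d (a *: x + y)) a) => //=; rewrite gprojP.
rewrite scaler_sumr -big_split; apply: eq_bigr => d _ /=.
exact: (IHs (fun t => H (letter_proj G d z :: t)) (wmultilinear_cons _ mH)).
Qed.

Lemma wext_letters H t : wmultilinear H -> wext H (vecs t) = H t.
Proof.
elim: t H => [|l t IHt] H mH //=.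
under eq_bigr do rewrite (IHt _ (wmultilinear_cons _ mH)).
(* A letter may carry a degree outside the support, but then its vector is 0. *)
have [lG|lG] := boolP (ldeg l \in gsupp G); last first.
  have l0 : lvec l = 0.
    by apply/eqP; rewrite -memv0 -(gpiece_out lG) lvecP.
  rewrite (wmultilinear0 [::] _ mH) // big1 // => d _.
  by rewrite (wmultilinear0 [::] _ mH) //= l0 /gproj linear0.
rewrite (bigD1_seq (ldeg l)) ?gsupp_uniq //= big1 ?addr0 => [|d /negPf ne].
  congr (H (_ :: t)); apply: letter_eq => //=.
  by rewrite (gproj_hom _ (lvecP l)) eqxx.
by rewrite (wmultilinear0 [::] _ mH) //= (gproj_hom _ (lvecP l)) ne.
Qed.

End MultilinearWords.

End Masks.

(** * Tensors and coderivations *)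

Section Tensors.

Variables (K : fieldType) (V : vectType K).
Notation tensor := (tensor K V).
Notation tensor2 := (tensor2 K V).
Notation index := 'I_(vdim V).

Fixpoint tcoord (u : seq index) (s : seq V) : K^o :=
  match u, s with
  | [::], [::] => 1
  | i :: u', x :: s' => coord (vbasis fullv) i x * tcoord u' s'
  | _, _ => 0
  end.

Lemma tcoord_size u s : size u != size s -> tcoord u s = 0.
Proof.
by elim: u s => [|i u IHu] [|x s] //=; rewrite eqSS => /IHu ->; rewrite mulr0.
Qed.

Lemma multilinear_tcoord u : multilinear (tcoord u).
Proof.
elim: u => [|i u IHu] [|z s1] s2 a x y /=; rewrite ?scaler0 ?addr0 //.
  by rewrite linearP mulrDl scalerAl.
by rewrite IHu mulrDr; congr (_ + _); rewrite [LHS]mulrCA.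
Qed.

Lemma tcoord_cat u v s :
  tcoord (u ++ v) s = cuts (fun I J => tcoord u I * tcoord v J : K^o) s.
Proof.
elim: u s => [|i u IHu] s /=.
  case: s => [|x s] /=; rewrite ?mul1r // (eq_cuts (h' := fun _ _ => 0)).
    by rewrite cutsE big1 // addr0.
  by move=> I J _; rewrite mul0r.
case: s => [|x s]; rewrite /= mul0r // add0r IHu !cutsE mulr_sumr.
by apply: eq_bigr => k _; rewrite mulrA.
Qed.

Lemma sum_mcoeff (T : choiceType) (t : {malg K[T]}) (u : T) :
  \sum_(w <- msupp t) t@_w * (w == u)%:R = t@_u.
Proof.
rewrite {3}[t]monalgE raddf_sum /=; apply: eq_bigr => w _.
by rewrite mcoeffU mulr_natr.
Qed.

Lemma pure_tensorE s u : (pure_tensor s)@_u = tcoord u s.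
Proof.
rewrite /pure_tensor raddf_sum /=.
under eq_bigr do rewrite mcoeffZ mcoeffU.
have [szu|szu] := eqVneq (size u) (size s); last first.
  rewrite tcoord_size // big1 // => w _; case: eqP => [wu|]; rewrite ?mulr0 //.
  by rewrite -wu size_tuple eqxx in szu.
have [w ->] : exists w : (size s).-tuple index, u = w.
  by exists (tcast szu (in_tuple u)); rewrite val_tcast.
rewrite (bigD1 w) //= eqxx mulr1 [X in _ + X]big1 ?addr0 => [|w' /negPf ne]; last first.
  by rewrite val_eqE ne mulr0.
elim: s w {szu} => [|x s IHs] w; first by rewrite big_ord0 tuple0.
case/tupleP: w => i w; rewrite big_ord_recl tnth0 /= -IHs; congr (_ * _).
by apply: eq_bigr => k _; rewrite tnthS.
Qed.

Lemma tensor_pairE (t t' : tensor) u v :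
  (tensor_pair t t')@_(u, v) = t@_u * t'@_v.
Proof.
rewrite /tensor_pair raddf_sum /= -(sum_mcoeff t u) mulr_suml.
apply: eq_bigr => w _; rewrite raddf_sum /= -(sum_mcoeff t' v) mulr_sumr.
apply: eq_bigr => w' _; rewrite mcoeffZ mcoeffU xpair_eqE -mulnb natrM.
by rewrite mulrACA.
Qed.

Definition word_cuts (w : seq index) : tensor2 :=
  \sum_(k < size w | (0 < k)%N) (<< (take k w, drop k w) >> : tensor2).

Lemma word_cutsE w u v :
  (word_cuts w)@_(u, v) = [&& ~~ nilp u, ~~ nilp v & w == u ++ v]%:R :> K.
Proof.
rewrite /word_cuts raddf_sum /=.
under eq_bigr do rewrite mcoeffU xpair_eqE.
have [/and3P[u0 v0 /eqP ->]|neq] := boolP [&& _, _ & _]; last first.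
  rewrite big1 // => k k0; case: andP => // -[/eqP uE /eqP vE].
  move: neq; rewrite -uE -vE cat_take_drop eqxx /nilp size_take size_drop.
  by rewrite ltn_ord -lt0n k0 subn_eq0 -ltnNge ltn_ord.
have ltu : (size u < size (u ++ v))%N.
  by rewrite size_cat -[X in (X < _)%N]addn0 ltn_add2l lt0n.
rewrite (bigD1 (Ordinal ltu)) /=; last by rewrite lt0n.
rewrite take_size_cat // drop_size_cat // !eqxx big1 ?addr0 // => k /andP[_ ne].
case: andP => // -[/eqP uE _]; case/eqP: ne; apply: val_inj => /=.
by rewrite -[in RHS]uE size_takel // ltnW.
Qed.

(** The reduced deconcatenation of T(V[1]): defined on all tensors, it restricts to the coproduct of
    S^+ ([cut_tensor_coproduct]). *)
Definition cut_tensor (t : tensor) : tensor2 :=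
  \sum_(w <- msupp t) t@_w *: word_cuts w.

Lemma cut_tensorE t u v : (cut_tensor t)@_(u, v)
  = if ~~ nilp u && ~~ nilp v then t@_(u ++ v) else 0.
Proof.
rewrite /cut_tensor raddf_sum /=.
under eq_bigr do rewrite mcoeffZ word_cutsE andbA.
case: ifP => _; first exact: sum_mcoeff.
by rewrite big1 // => w _; rewrite mulr0.
Qed.

Lemma cut_tensor_is_linear : linear cut_tensor.
Proof.
move=> a t t'; apply/malgP => -[u v].
rewrite mcoeffD mcoeffZ !cut_tensorE mcoeffD mcoeffZ.
by case: ifP; rewrite ?mulr0 ?addr0.
Qed.

HB.instance Definition _ :=
  GRing.isLinear.Build K tensor tensor2 *:%R cut_tensor cut_tensor_is_linear.

(** The coefficient map with values in the module [K^o], so that [raddf_ksym] and [raddf_shsum]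
    apply to it. *)
Definition mcoeffo (T : choiceType) (u : T) (t : {malg K[T]}) : K^o := t@_u.

Lemma mcoeffo_is_linear (T : choiceType) (u : T) : linear (@mcoeffo T u).
Proof. by move=> a t t'; rewrite /mcoeffo mcoeffD mcoeffZ. Qed.

HB.instance Definition _ (T : choiceType) (u : T) :=
  GRing.isLinear.Build K {malg K[T]} K^o *:%R (@mcoeffo T u) (mcoeffo_is_linear u).

Definition degree1_part (t : tensor) : V :=
  \sum_(i < vdim V) t@_[:: i] *: (vbasis fullv)`_i.

Lemma degree1_partP a t t' :
  degree1_part (a *: t + t') = a *: degree1_part t + degree1_part t'.
Proof.
rewrite /degree1_part scaler_sumr -big_split; apply: eq_bigr => i _.
by rewrite mcoeffD mcoeffZ scalerDl scalerA.
Qed.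

Lemma degree1_part_coord t i : coord (vbasis fullv) i (degree1_part t) = t@_[:: i].
Proof.
rewrite /degree1_part linear_sum (bigD1 i) //= linearZ /= coord_free ?eqxx.
  rewrite big1 ?addr0 ?mulr1 // => j /negPf ne; rewrite linearZ /= coord_free.
    by rewrite ne mulr0.
  exact: basis_free (vbasisP _).
exact: basis_free (vbasisP _).
Qed.

End Tensors.

Definition oddz (d : int) : bool := odd (absz d).

Lemma oddzD d d' : oddz (d + d') = oddz d (+) oddz d'.
Proof. by rewrite /oddz; lia. Qed.

Lemma oddzN d : oddz (- d) = oddz d.
Proof. by rewrite /oddz; lia. Qed.

Lemma oddzM d d' : oddz (d * d') = oddz d && oddz d'.
Proof. by rewrite /oddz abszM oddM. Qed.

Lemma wdeg_cons d ds : wdeg (d :: ds) = (d - 1) + wdeg ds.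
Proof. exact: big_cons. Qed.

Lemma wdeg_cat ds ds' : wdeg (ds ++ ds') = wdeg ds + wdeg ds'.
Proof. exact: big_cat. Qed.

(** * The coproduct of S^+ in coordinates *)

Section Coderivations.

Variables (K : fieldType) (V : vectType K) (G : grading V).
Notation letter := (letter G).
Notation vecs := (map (@lvec K V G)).
Notation degs := (map (@ldeg K V G)).
Notation lpar := (@letter_parity K V G).
Notation tensor := (tensor K V).
Notation tensor2 := (tensor2 K V).
Notation sgn b := ((-1) ^+ nat_of_bool b : K).

Lemma oddz_wdeg (t : seq letter) : oddz (wdeg (degs t)) = word_parity lpar t.
Proof.
elim: t => [|l t IHt] /=; first by rewrite /wdeg big_nil.
by rewrite wdeg_cons oddzD IHt.
Qed.

Definition wcoord u (t : seq letter) : K^o := ksym lpar (onl (tcoord u)) t.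

Lemma sprod_letters (t : seq letter) :
  sprod (degs t) (vecs t) = ksym lpar (onl (@pure_tensor K V)) t.
Proof.
have [n [szn eqn]] : exists n, size t = n /\ size (vecs t) = n.
  by exists (size t); rewrite size_map.
rewrite /sprod eqn; have [u ->] : exists u : n.-tuple letter, t = u.
  by exists (tcast szn (in_tuple t)); rewrite val_tcast.
rewrite -ksym_perm; apply: eq_bigr => r _; rewrite -map_comp; congr (_ *: pure_tensor _).
rewrite -(map_tnth_enum (pword r u)) -map_comp /=; apply: eq_map => i /=.
rewrite tnth_mktuple -(tnth_nth 0 (map_tuple (@lvec K V G) u)).
by rewrite tnth_map.
Qed.

Lemma sprodE (t : seq letter) w : (sprod (degs t) (vecs t))@_w = wcoord w t.
Proof.
rewrite sprod_letters -/(mcoeffo w _) raddf_ksym /wcoord.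
apply: (@eq_ksym K letter lpar K^o) => s _ _.
exact: (pure_tensorE (vecs s) w).
Qed.

Lemma wcoord_size u t : size u != size t -> wcoord u t = 0.
Proof.
move=> szt; rewrite /wcoord -[RHS](ksym0 lpar _ t); apply: eq_ksym => s _ szs.
by rewrite /onl tcoord_size // size_map szs.
Qed.

Lemma ksym_mul (f g : seq letter -> K^o) s t :
  ksym lpar (fun u => ksym lpar (fun v => f u * g v : K^o) t) s
  = ksym lpar f s * ksym lpar g t.
Proof.
transitivity (ksym lpar g t *: ksym lpar f s : K^o); last exact: mulrC.
rewrite -ksymZ; apply: eq_ksym => u _ _.
by rewrite [RHS]mulrC; apply: (ksymZ lpar (f u) g t).
Qed.

(** A coordinate along u ++ v is a sum over the cuts of the word, which [ksym_cuts] turns into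
    splittings. *)
Lemma wcoord_cat u v t : wcoord (u ++ v) t
  = shsum lpar (fun I J => wcoord u I * wcoord v J : K^o) t.
Proof.
rewrite /wcoord.
have onl_cuts s : onl (tcoord (u ++ v)) s
    = cuts (fun I J => onl (tcoord u) I * onl (tcoord v) J : K^o) s.
  by rewrite /onl tcoord_cat !cutsE size_map; apply: eq_bigr => k _; rewrite map_take map_drop.
under eq_ksym do rewrite onl_cuts.
by rewrite ksym_cuts; apply: eq_shsum => I J _ _; rewrite ksym_mul.
Qed.

(** Both sides are compared on each pair (u, v) by [wcoord_cat]. Proper masks correspond to u and v
    non empty, because [wcoord] vanishes on words of another length. *)
Lemma cut_tensor_coproduct : is_coproduct G (@cut_tensor K V).
Proof.
move=> ds s /hword_letters[t -> ->]; apply/malgP => -[u v].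
rewrite cut_tensorE.
have szt : size t = size (vecs t) by rewrite size_map.
transitivity (shsum lpar (fun I J => if ~~ nilp I && ~~ nilp J
    then wcoord u I * wcoord v J : K^o else 0) t); last first.
  rewrite -(shsum_proper_masks _ szt) [RHS]raddf_sum; apply: eq_bigr => m _.
  rewrite [RHS]mcoeffZ /sel /cosel -!map_mask; congr (_ * _).
  by rewrite -!sprodE; apply/esym/tensor_pairE.
rewrite sprodE; case: ifP => [/andP[u0 v0]|uv0].
  rewrite wcoord_cat; apply: (@eq_shsum K letter lpar K^o) => I J _ _.
  case: ifP => // /negbT; rewrite negb_and !negbK /nilp => /orP[] /eqP sz0.
    by rewrite wcoord_size ?mul0r // sz0.
  by rewrite [X in _ * X]wcoord_size ?mulr0 // sz0.
rewrite -[LHS](shsum0 lpar K^o t); apply: (@eq_shsum K letter lpar K^o) => I J _ _.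
case: ifP => // /andP[I0 J0]; move/negbT: uv0.
rewrite negb_and !negbK /nilp => /orP[] /eqP sz0.
  by rewrite wcoord_size ?mul0r // sz0 eq_sym.
by rewrite [X in _ * X]wcoord_size ?mulr0 // sz0 eq_sym.
Qed.

Lemma in_Splus_sprod (t : seq letter) d : ~~ nilp t -> wdeg (degs t) = d ->
  in_Splus G d (sprod (degs t) (vecs t)).
Proof.
move=> t0 dt; exists [:: (1, (degs t, vecs t))]; split; last first.
  by rewrite big_seq1 scale1r.
move=> [|i] //= _; split=> //; last exact: letters_hword.
by rewrite -size_eq0 size_map.
Qed.

Lemma in_Splus0 d : in_Splus G d 0.
Proof. by exists [::]; rewrite big_nil. Qed.

Lemma in_SplusP d a x y : in_Splus G d x -> in_Splus G d y ->
  in_Splus G d (a *: x + y).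
Proof.
move=> [l [hl ->]] [l' [hl' ->]].
exists ([seq (a * c.1, c.2) | c <- l] ++ l'); split; last first.
  rewrite big_cat big_map scaler_sumr; congr (_ + _).
  by apply: eq_bigr => c _; rewrite scalerA.
move=> i; rewrite size_cat size_map nth_cat size_map => lti.
case: ltnP => [ltl|lel].
  rewrite (nth_map (0, ([::], [::]))) //; have := hl i ltl.
  by case: (nth _ _ _) => b [].
by apply: hl'; rewrite ltn_subLR.
Qed.

Lemma in_Splus_shsum d h (t : seq letter) :
  (forall I J, wdeg (degs I) + wdeg (degs J) = wdeg (degs t) ->
     in_Splus G d (h I J)) ->
  in_Splus G d (shsum lpar h t).
Proof.
elim: t h => [|l t IHt] h hS /=; first by apply: hS; rewrite /wdeg big_nil addr0.
rewrite -[X in in_Splus G d (X + _)]scale1r; apply: in_SplusP.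
  by apply: IHt => I J dIJ; apply: hS; rewrite /= !wdeg_cons -addrA dIJ.
apply: IHt => I J dIJ; rewrite -[_ *: _]addr0; apply: in_SplusP; last exact: in_Splus0.
by apply: hS; rewrite /= !wdeg_cons addrCA dIJ.
Qed.

(** S^+ is spanned by symmetric products, where D is prescribed. The unspecified D in the definition
    of a coderivation can thus be replaced by deconcatenation. *)
Lemma coproduct_in_Splus D d t : is_coproduct G D -> in_Splus G d t ->
  D t = cut_tensor t.
Proof.
move=> cD [l [hl ->]]; rewrite !linear_sum /=.
rewrite !(big_nth (0, ([::], [::]))) !big_mkord; apply: eq_bigr => i _.
rewrite !linearZ /=; congr (_ *: _); have := hl i (ltn_ord i).
by case: (nth _ _ _) => c [ds s] [_ hs _] /=; rewrite cD // cut_tensor_coproduct.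
Qed.

Lemma in_Splus_nil d t : in_Splus G d t -> t@_[::] = 0.
Proof.
move=> [l [hl ->]]; rewrite raddf_sum /=.
rewrite !(big_nth (0, ([::], [::]))) !big_mkord big1 // => i _.
rewrite mcoeffZ; have := hl i (ltn_ord i).
case: (nth _ _ _) => c [ds s] [s0 /hword_letters[u -> su] _] /=.
rewrite su sprodE wcoord_size ?mulr0 //.
by rewrite -(size_map (@lvec K V G)) -su eq_sym size_eq0.
Qed.

Lemma degree1_part_sprod (t : seq letter) :
  degree1_part (sprod (degs t) (vecs t)) = if t is [:: l] then lvec l else 0.
Proof.
rewrite /degree1_part.
under eq_bigr do rewrite sprodE.
case: t => [|l [|l' t]]; try by rewrite big1 // => i _; rewrite wcoord_size ?scale0r.
rewrite [RHS](coord_vbasis (memvf (lvec l))); apply: eq_bigr => i _.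
by rewrite /wcoord /= /onl /= mulr1.
Qed.

Lemma in_Splus_degree1 d t : in_Splus G d t -> degree1_part t \in G (d + 1).
Proof.
move=> [l [hl ->]]; elim: l hl => [|c l IHl] hl.
  rewrite big_nil /degree1_part big1 ?mem0v // => i _.
  by rewrite mcoeff0 scale0r.
rewrite big_cons degree1_partP memvD ?IHl //; last by move=> i; apply: (hl i.+1).
rewrite memvZ //; have := hl 0%N isT; case: c {hl} => a [ds s] [_ /hword_letters[u -> ->]] /=.
rewrite degree1_part_sprod; case: u => [|x [|y u]] //= ; rewrite ?mem0v //.
by rewrite /wdeg big_seq1 => <-; rewrite subrK lvecP.
Qed.

End Coderivations.

(** * The coderivation with a given corestriction *)

Section CoderivationOfCorestriction.

Variables (K : fieldType) (V : vectType K) (G : grading V).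
Notation letter := (letter G).
Notation vecs := (map (@lvec K V G)).
Notation degs := (map (@ldeg K V G)).
Notation lpar := (@letter_parity K V G).
Notation tensor := (tensor K V).
Notation sgn b := ((-1) ^+ nat_of_bool b : K).

Lemma wmultilinear_scale (W : lmodType K) (H : seq letter -> W) u (x z : letter) v a :
  wmultilinear H -> ldeg x = ldeg z -> lvec z = a *: lvec x ->
  H (u ++ z :: v) = a *: H (u ++ x :: v).
Proof.
move=> mH dx zE; pose y : letter := Letter (mem0v (G (ldeg z))).
rewrite (mH u v x y z a) //= ?addr0 //.
by rewrite (wmultilinear0 u v (z := y) mH) // addr0.
Qed.

Lemma multilinear_pure_tensor : multilinear (@pure_tensor K V).
Proof.
move=> s1 s2 a x y; apply/malgP => w.
rewrite mcoeffD mcoeffZ !pure_tensorE; exact: multilinear_tcoord.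
Qed.

Definition sprodl (t : seq letter) : tensor := ksym lpar (onl (@pure_tensor K V)) t.

Lemma sprodlE t w : (sprodl t)@_w = wcoord w t.
Proof. by rewrite /sprodl -sprod_letters sprodE. Qed.

Lemma wmultilinear_sprodl : wmultilinear sprodl.
Proof. exact/wmultilinear_ksym/wmultilinear_onl/multilinear_pure_tensor. Qed.

Variable q : seq V -> V.
Hypotheses (mq : multilinear q) (sq : swapsym lpar (onl q)).
(** The map q has degree 1 on V[1], and an element of degree k of V[1] has degree k + 1 in V: hence
    the 2. *)
Hypothesis dq : forall t, q (vecs t) \in G (wdeg (degs t) + 2).

Definition qletter t : letter := Letter (dq t).

Lemma lpar_qletter t : lpar (qletter t) = ~~ word_parity lpar t.
Proof.
rewrite -oddz_wdeg /letter_parity /odd_letter -/(oddz _) /= -addrA oddzD.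
by rewrite addbT.
Qed.

(* The coderivation with corestriction q maps x_1 . ... . x_n to the sum over
   the shuffles (A, B), with A non empty, of q (x_A) . x_B. *)
Definition coder_word (t : seq letter) : tensor :=
  shsum lpar (fun A B => if nilp A then 0 else sprodl (qletter A :: B)) t.

Lemma wmultilinear_coder_word : wmultilinear coder_word.
Proof.
apply: wmultilinear_shsum => [B|A] u v x y z a dx dy zE /=; last first.
  case: ifP => _; first by rewrite scaler0 addr0.
  exact: (wmultilinear_sprodl (qletter A :: u)).
have nilF l : nilp (u ++ l :: v) = false by case: u.
rewrite !nilF; apply: (wmultilinear_sprodl [::]) => /=.
- by rewrite !map_cat /= dx.
- by rewrite !map_cat /= dy.
by rewrite !map_cat /= zE mq.
Qed.

Lemma swapsym_coder_word : swapsym lpar coder_word.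
Proof.
apply: swapsym_shsum => [B|A] u x y v; last first.
  case: ifP => _; first by rewrite scaler0.
  exact: (swapsym_ksym lpar _ (qletter A :: u)).
have nilF l w : nilp (u ++ l :: w) = false by case: u.
rewrite !nilF; apply: (wmultilinear_scale [::] _ wmultilinear_sprodl) => /=.
  by rewrite !map_cat !wdeg_cat /= !wdeg_cons; congr (_ + _ + _); rewrite addrCA.
exact: sq.
Qed.

Definition coder_of : seq V -> tensor := wext coder_word.

Lemma coder_of_letters t : coder_of (vecs t) = coder_word t.
Proof. exact/wext_letters/wmultilinear_coder_word. Qed.

Definition qcoord w (t : seq letter) : K^o :=
  shsum lpar (fun A B => if nilp A then 0 else wcoord w (qletter A :: B)) t.

Lemma coder_wordE t w : (coder_word t)@_w = qcoord w t.
Proof.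
rewrite /coder_word -/(mcoeffo w _) raddf_shsum.
apply: (@eq_shsum K letter lpar K^o) => A B _ _.
by case: ifP => _; [apply: mcoeff0|apply: sprodlE].
Qed.

Lemma shsumMr (f : seq letter -> seq letter -> K^o) (a : K^o) t :
  shsum lpar (fun I J => f I J * a : K^o) t = shsum lpar f t * a.
Proof.
rewrite [RHS]mulrC -[RHS](shsumZ lpar a f t); apply: eq_shsum => I J _ _.
exact: mulrC.
Qed.

(** The coderivation identity in coordinates: the letter q x_A falls in the factor of u or in that
    of v, and [shsumA] regroups the three subwords. In the second case q x_A passes I; the sign of
    x_A passing I comes from [shsumC], and what remains is the sign of the odd map q passing I. *)
Lemma qcoord_cat u v t : qcoord (u ++ v) t
  = shsum lpar (fun I J => qcoord u I * wcoord v J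
      + sgn (word_parity lpar I) * (wcoord u I * qcoord v J) : K^o) t.
Proof.
rewrite shsumD; set S1 := shsum _ _ _; set S2 := shsum _ _ _.
pose h1 (A I J : seq letter) : K^o := if nilp A then 0 else wcoord u (qletter A :: I) * wcoord v J.
pose h2 (I A J : seq letter) : K^o := if nilp A then 0
  else sgn (word_parity lpar I) * (wcoord u I * wcoord v (qletter A :: J)).
have -> : S1 = shsum lpar (fun A R => shsum lpar (h1 A) R) t.
  rewrite -shsumA; apply: eq_shsum => P J _ _; rewrite -shsumMr.
  by apply: eq_shsum => A I _ _; rewrite /h1; case: ifP => // _; rewrite mul0r.
have -> : S2 = shsum lpar (fun A R => shsum lpar (fun I J =>
    sgn (word_parity lpar I && word_parity lpar A) *: h2 I A J) R) t.
  rewrite -shsumA.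
  transitivity (shsum lpar (fun I R => shsum lpar (h2 I) R) t).
    apply: eq_shsum => I J _ _.
    rewrite mulrA /qcoord mulrC -shsumMr; apply: eq_shsum => A B _ _.
    by rewrite /h2; case: ifP => // _; rewrite ?mul0r // mulrC mulrA.
  rewrite -shsumA; apply: eq_shsum => P J _ _; rewrite shsumC.
  by apply: eq_shsum => I A _ _; rewrite andbC.
rewrite -shsumD; apply: eq_shsum => A B _ _; case: ifP => [A0|A0].
  rewrite -shsumD -[LHS](shsum0 lpar _ B); apply: eq_shsum => I J _ _.
  by rewrite /h1 /h2 A0 scaler0 addr0.
rewrite wcoord_cat /=; congr (_ + _); apply: eq_shsum => I J _ _.
  by rewrite /h1 A0.
rewrite /h2 A0 lpar_qletter; rewrite [RHS]mulrA -signr_addb; congr ((-1) ^+ nat_of_bool _ * _).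
by case: (word_parity lpar A); case: (word_parity lpar I).
Qed.

(** A product q x_A . x_B has a component of length 1 only when B is empty. *)
Lemma degree1_part_coder_of t : ~~ nilp t -> degree1_part (coder_of (vecs t)) = q (vecs t).
Proof.
move=> t0; rewrite [RHS](coord_vbasis (memvf _)); apply: eq_bigr => i _.
congr (_ *: _); rewrite coder_of_letters coder_wordE /qcoord.
pose f (A B : seq letter) : K^o := if nilp B then wcoord [:: i] [:: qletter A] else 0.
transitivity (shsum lpar f t).
  apply: (@eq_shsum K letter lpar K^o) => A B _ sAB; rewrite /f; case: B sAB => [|l B] sAB.
    by rewrite addn0 in sAB; rewrite /nilp sAB -/(nilp t) (negPf t0).
  by case: ifP => // _; rewrite wcoord_size.
have shsum_nil (g : seq letter -> K^o) s :
    shsum lpar (fun A B => if nilp B then g A else 0) s = g s.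
  elim: s g => //= l s IHs g; rewrite IHs -[RHS]addr0; congr (_ + _).
  by rewrite -[RHS](shsum0 lpar _ s); apply: eq_shsum => *; rewrite scaler0.
by rewrite /f shsum_nil /wcoord /= /onl /= mulr1.
Qed.

Lemma coderivation_coder_of : coderivation_deg G 1 coder_of.
Proof.
have mQ : multilinear coder_of.
  exact/multilinear_wext/wmultilinear_coder_word.
split=> //.
- apply/koszul_symmetricP => // u x y v.
  by rewrite /onl !coder_of_letters; apply: swapsym_coder_word.
- move=> ds s /hword_letters[t -> ->] t0; rewrite coder_of_letters.
  apply: in_Splus_shsum => I J dIJ; case: ifP => I0; first exact: in_Splus0.
  rewrite /sprodl -sprod_letters; apply: in_Splus_sprod => //.
  by rewrite /= wdeg_cons -dIJ; lia.
exists (@cut_tensor K V); first exact: cut_tensor_coproduct.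
move=> ds s /hword_letters[t -> ->]; apply/malgP => -[u v].
have szt : size t = size (vecs t) by rewrite size_map.
transitivity (shsum lpar (fun I J => if ~~ nilp I && ~~ nilp J
  then qcoord u I * wcoord v J
      + sgn (word_parity lpar I) * (wcoord u I * qcoord v J) : K^o else 0) t); last first.
  rewrite -(shsum_proper_masks _ szt) [RHS]raddf_sum; apply: eq_bigr => m _.
  rewrite [RHS]mcoeffZ /sel /cosel -!map_mask; congr (_ * _).
  rewrite mcoeffD mcoeffZ -!coder_wordE -!sprodE -!coder_of_letters.
  congr (_ + _); first exact/esym/tensor_pairE.
  rewrite /degsign mul1r -/(oddz _) oddz_wdeg; congr (_ * _).
  exact/esym/tensor_pairE.
rewrite cut_tensorE coder_of_letters coder_wordE.
have q0 w : qcoord w [::] = 0 by [].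
have qnil r : qcoord [::] r = 0.
  rewrite -[RHS](shsum0 lpar K^o r); apply: eq_shsum => A B _ _.
  by case: ifP => // _; rewrite wcoord_size.
case: ifP => [/andP[u0 v0]|/negbT uv0].
  rewrite qcoord_cat; apply: (@eq_shsum K letter lpar K^o) => I J _ _.
  case: ifP => // /negbT; rewrite negb_and !negbK => /orP[] /nilP ->.
    by rewrite q0 (wcoord_size (u := u)) // !mul0r mulr0 addr0.
  by rewrite q0 (wcoord_size (u := v)) // !mulr0 addr0.
rewrite -[LHS](shsum0 lpar K^o t); apply: (@eq_shsum K letter lpar K^o) => I J _ _.
case: ifP => // /andP[I0 J0].
move: uv0; rewrite negb_and !negbK => /orP[] /nilP ->.
  by rewrite qnil (wcoord_size (t := I)) 1?eq_sym // !mul0r mulr0 addr0.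
by rewrite qnil (wcoord_size (t := J)) 1?eq_sym // !mulr0 addr0.
Qed.

End CoderivationOfCorestriction.

(** * A coderivation is determined by its corestriction *)

Section CoderivationUniqueness.

Variables (K : fieldType) (V : vectType K) (G : grading V).
Notation letter := (letter G).
Notation vecs := (map (@lvec K V G)).
Notation degs := (map (@ldeg K V G)).
Notation lpar := (@letter_parity K V G).
Notation tensor := (tensor K V).
Notation sgn b := ((-1) ^+ nat_of_bool b : K).
Implicit Types (Q : seq V -> tensor) (t : seq letter).

(** The coderivation equation in coordinates, p being the parity of the degree of Q. As I and J are
    proper subwords, it computes the coefficients along words of length at least 2 from the values
    of Q on shorter words. *)
Definition coder_rec (p : bool) Q := forall t u v, ~~ nilp u -> ~~ nilp v ->
  (Q (vecs t))@_(u ++ v) = shsum lpar (fun I J => if ~~ nilp I && ~~ nilp J then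
    (Q (vecs I))@_u * wcoord v J
    + sgn (p && word_parity lpar I) * (wcoord u I * (Q (vecs J))@_v) : K^o else 0) t.

Lemma coderivation_rec d Q : coderivation_deg G d Q -> coder_rec (oddz d) Q.
Proof.
move=> [_ _ Q0 QS [D cD DQ]] t u v u0 v0.
have szt : size t = size (vecs t) by rewrite size_map.
have -> : (Q (vecs t))@_(u ++ v) = (D (Q (vecs t)))@_(u, v).
  rewrite (coproduct_in_Splus (d := wdeg (degs t) + d) cD).
    by rewrite cut_tensorE u0 v0.
  case: t {szt} => [|l t]; first by rewrite /= Q0; apply: in_Splus0.
  by apply: QS => //; apply: letters_hword.
rewrite (DQ _ _ (letters_hword t)) -(shsum_proper_masks _ szt) [LHS]raddf_sum.
apply: eq_bigr => m _.
rewrite [LHS]mcoeffZ /sel /cosel -!map_mask; congr (_ * _).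
rewrite mcoeffD mcoeffZ -!sprodE.
congr (_ + _); first exact/tensor_pairE.
rewrite /degsign -/(oddz _) oddzM oddz_wdeg; congr (_ * _).
exact/tensor_pairE.
Qed.

Lemma coder_rec_uniq (p : bool) Q Q' : coder_rec p Q -> coder_rec p Q' ->
  (forall t, (Q (vecs t))@_[::] = (Q' (vecs t))@_[::]) ->
  (forall t i, (Q (vecs t))@_[:: i] = (Q' (vecs t))@_[:: i]) ->
  forall t, Q (vecs t) = Q' (vecs t).
Proof.
move=> rQ rQ' e0 e1 t; have [n] := ubnP (size t); elim: n t => // n IHn t.
rewrite ltnS => szt; apply/malgP => -[|i [|j w]]; [exact: e0|exact: e1|].
rewrite -cat1s rQ // rQ' //; apply: (@eq_shsum K letter lpar K^o) => I J _ sIJ.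
case: ifP => // /andP[I0 J0].
have sI : (0 < size I)%N by rewrite lt0n.
have sJ : (0 < size J)%N by rewrite lt0n.
rewrite !IHn //; apply: leq_trans szt; rewrite -sIJ.
  by rewrite -[X in (X < _)%N]add0n ltn_add2r.
by rewrite -[X in (X < _)%N]addn0 ltn_add2l.
Qed.

(** The degrees of Q and Q' may differ. If they have the same parity, both satisfy the same
    recursion; otherwise the common corestriction is 0 and so are both coderivations. *)
Lemma coderivation_ext Q Q' : coderivation G Q -> coderivation G Q' ->
  (forall t, ~~ nilp t ->
     degree1_part (Q (vecs t)) = degree1_part (Q' (vecs t))) ->
  forall t, Q (vecs t) = Q' (vecs t).
Proof.
move=> [d cQ] [d' cQ'] eq1.
have nil0 d0 Q0 t : coderivation_deg G d0 Q0 -> (Q0 (vecs t))@_[::] = 0.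
  case=> _ _ Q00 QS _; case: t => [|l t]; first by rewrite /= Q00 mcoeff0.
  by apply: in_Splus_nil (QS (degs (l :: t)) _ _ _) => //; apply: letters_hword.
have deg1 d0 Q0 t : coderivation_deg G d0 Q0 ->
    degree1_part (Q0 (vecs t)) \in G (wdeg (degs t) + d0 + 1).
  case=> _ _ Q00 QS _; case: t => [|l t].
    by rewrite /= Q00 /degree1_part big1 ?mem0v // => i _; rewrite mcoeff0 scale0r.
  by apply/in_Splus_degree1/QS => //; apply: letters_hword.
have e1 t i : (Q (vecs t))@_[:: i] = (Q' (vecs t))@_[:: i].
  case: t => [|l t]; last by rewrite -!degree1_part_coord eq1.
  by case: cQ cQ' => [_ _ /= -> _ _] [_ _ -> _ _].
have [dd'|dd'] := eqVneq (oddz d) (oddz d').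
  apply: (coder_rec_uniq (p := oddz d)) => //; first exact: coderivation_rec.
    by rewrite dd'; apply: coderivation_rec.
  by move=> t; rewrite (nil0 d) // (nil0 d').
(* A non zero value of the corestriction would lie in two different pieces of the grading. *)
have z1 t i : (Q (vecs t))@_[:: i] = 0.
  rewrite -degree1_part_coord; case: (nilp t) / nilP => [->|/nilP t0].
    by case: cQ => _ _ -> _ _; rewrite degree1_part_coord mcoeff0.
  have [->|ne0] := eqVneq (degree1_part (Q (vecs t))) 0; first by rewrite linear0.
  case/negP: dd'; apply/eqP; congr oddz.
  apply: (addrI (wdeg (degs t))); apply: (addIr 1).
  apply: (gpiece_eq (deg1 _ _ t cQ) _ ne0).
  by rewrite eq1 //; apply: deg1.
have rec0 p : coder_rec p (fun _ => 0).
  move=> t u v _ _; rewrite mcoeff0; apply/esym; rewrite -[RHS](shsum0 lpar K^o t).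
  apply: (@eq_shsum K letter lpar K^o) => I J _ _; rewrite !mcoeff0 mul0r !mulr0 addr0.
  by rewrite if_same.
move=> t; transitivity (0 : tensor); last apply: esym.
  apply: (coder_rec_uniq (coderivation_rec cQ) (rec0 _)) => [s|s i].
    by rewrite mcoeff0 (nil0 d).
  by rewrite mcoeff0 z1.
apply: (coder_rec_uniq (coderivation_rec cQ') (rec0 _)) => [s|s i].
  by rewrite mcoeff0 (nil0 d').
by rewrite mcoeff0 -e1 z1.
Qed.

End CoderivationUniqueness.

(** * Quadratic forms and dual bases *)

Section QuadraticForms.

Variables (K : fieldType) (V : vectType K) (G : grading V).

Lemma homogeneous_basis : exists m (e : m.-tuple V) (dg : 'I_m -> int),
  basis_of fullv e /\ forall i, tnth e i \in G (dg i).
Proof.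
pose U (i : 'I_(size (gsupp G))) := G (gsupp G)`_i.
have defV : fullv = (\sum_i U i)%VS.
  by rewrite (gpiece_sum G) (big_nth 0) big_mkord.
have dirU : directv (\sum_i U i).
  have := gpiece_direct G; rewrite !directvE /= (big_nth 0) big_mkord => /eqP->.
  by rewrite (big_nth 0) big_mkord.
pose s : seq V := \big[cat/[::]]_i vbasis (U i).
have bs : basis_of fullv s.
  by rewrite defV; apply: bigcat_basis => // i _; apply: vbasisP.
have homs x : x \in s -> exists d, x \in G d.
  rewrite /s; elim/big_rec: _ => // i u _ IHu; rewrite mem_cat => /orP[|/IHu //].
  by move/vbasis_mem => xU; exists (gsupp G)`_i.
have [dg hdg] : exists dg, forall i, tnth (in_tuple s) i \in G (dg i).
  have homt i : exists d, tnth (in_tuple s) i \in G d.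
    exact/homs/(mem_tnth i (in_tuple s)).
  exact: (fin_all_exists homt).
by exists (size s), (in_tuple s), dg.
Qed.

Lemma homogeneous_ind (P : V -> Prop) :
  (forall a x y, P x -> P y -> P (a *: x + y)) -> P 0 ->
  (forall d x, x \in G d -> P x) -> forall x, P x.
Proof.
move=> PD P0 PG x; rewrite -(sum_gproj G x).
elim: (gsupp G) => [|d r IHr]; first by rewrite big_nil.
rewrite big_cons -[gproj G d x]scale1r; apply: PD IHr.
exact: PG (gproj_mem G d x).
Qed.

Variable b : V -> V -> K^o.

Section Bilinear.

Hypothesis bil : bilinear_map b.

Lemma bilDr x a y z : b x (a *: y + z) = a * b x y + b x z.
Proof. by case: bil => + _; apply. Qed.

Lemma bilDl x a y z : b (a *: y + z) x = a * b y x + b z x.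
Proof. by case: bil => _; apply. Qed.

Lemma bil0r x : b x 0 = 0.
Proof. by have := bilDr x (-1) 0 0; rewrite scaler0 addr0 mulN1r addNr. Qed.

Lemma bil0l x : b 0 x = 0.
Proof. by have := bilDl x (-1) 0 0; rewrite scaler0 addr0 mulN1r addNr. Qed.

Lemma bil_sumr x (I : Type) (r : seq I) (c : I -> K) (y : I -> V) :
  b x (\sum_(i <- r) c i *: y i) = \sum_(i <- r) c i * b x (y i).
Proof. by elim: r => [|i r IHr]; rewrite ?big_nil ?bil0r // !big_cons bilDr IHr. Qed.

Lemma bil_suml x (I : Type) (r : seq I) (c : I -> K) (y : I -> V) :
  b (\sum_(i <- r) c i *: y i) x = \sum_(i <- r) c i * b (y i) x.
Proof. by elim: r => [|i r IHr]; rewrite ?big_nil ?bil0l // !big_cons bilDl IHr. Qed.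

End Bilinear.

Hypothesis qb : quadratic_form G b.

Lemma quadratic_bil : bilinear_map b. Proof. by case: qb. Qed.

Lemma quadratic_degree i j x y : x \in G i -> y \in G j -> i + j != 0 -> b x y = 0.
Proof.
case: qb => _ bdeg _ _ xi yj; apply: contra_neq_eq => /(bdeg _ _ _ _ xi yj).
exact.
Qed.

Lemma quadratic_proj i x y : x \in G i -> b x (gproj G (- i) y) = b x y.
Proof.
move=> xi; rewrite -[in RHS](sum_gproj G y).
under [in RHS]eq_bigr do rewrite -[gproj G _ y]scale1r.
rewrite (bil_sumr quadratic_bil).
have zero d : d != - i -> 1 * b x (gproj G d y) = 0.
  move=> ne; rewrite (quadratic_degree xi (gproj_mem G d y)) ?mulr0 //.
  by apply: contra ne; rewrite addrC addr_eq0.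
have [iG|iG] := boolP (- i \in gsupp G).
  rewrite (bigD1_seq (- i)) ?gsupp_uniq //= mul1r big1 ?addr0 //.
rewrite big1_seq => [|d /andP[_ dG]]; last first.
  by apply: zero; apply: contraNneq iG => <-.
have -> : gproj G (- i) y = 0.
  by apply/eqP; rewrite -memv0 -(gpiece_out iG) gproj_mem.
exact: bil0r quadratic_bil _.
Qed.

(** Only the component of y of degree - i pairs with x, and i (- i) has the parity of i; so y need
    not be homogeneous. *)
Lemma quadratic_sym i x y : x \in G i -> b y x = (-1) ^+ oddz i * b x y.
Proof.
move=> xi; pose P y := b y x = (-1) ^+ oddz i * b x y.
apply: (homogeneous_ind (P := P)) => [a u v Pu Pv||j u uj].
- rewrite /P (bilDl quadratic_bil) (bilDr quadratic_bil) Pu Pv mulrDr.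
  by rewrite mulrCA.
- by rewrite /P (bil0l quadratic_bil) (bil0r quadratic_bil) mulr0.
rewrite /P; case: qb => _ bdeg bsym _; rewrite (bsym _ _ _ _ xi uj).
have [->|/(bdeg _ _ _ _ xi uj)] := eqVneq (b x u) 0; first by rewrite !mulr0.
move/eqP; rewrite addrC addr_eq0 => /eqP ->.
by rewrite /degsign -/(oddz _) oddzM oddzN andbb.
Qed.

Lemma quadratic_right_nondegenerate y : (forall x, b x y = 0) -> y = 0.
Proof.
move=> y0; case: qb => _ _ _; apply => x.
apply: (homogeneous_ind (P := fun x => b y x = 0)) => [a u v Pu Pv||i u ui].
- by rewrite (bilDr quadratic_bil) Pu Pv mulr0 addr0.
- exact: bil0r quadratic_bil _.
by rewrite (quadratic_sym y ui) y0 mulr0.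
Qed.

Variables (m : nat) (e : m.-tuple V).
Hypothesis be : basis_of fullv e.

Lemma basis_eq0 (P : V -> K^o) : (forall a x y, P (a *: x + y) = a * P x + P y) ->
  (forall i, P (tnth e i) = 0) -> forall x, P x = 0.
Proof.
move=> linP Pe x; have P0 : P 0 = 0.
  by have := linP (-1) 0 0; rewrite scaler0 addr0 mulN1r addNr.
rewrite (coord_basis be (memvf x)); elim/big_rec: _ => // i y _ Py.
by rewrite linP Py -tnth_nth Pe mulr0 addr0.
Qed.

Lemma dual_basis_exists : exists e' : m.-tuple V,
  forall i j, b (tnth e i) (tnth e' j) = (i == j)%:R.
Proof.
(* The Gram matrix of e: a row vector in its kernel gives a vector orthogonal to V. The columns of
   its inverse are the coordinates of the dual basis. *)
pose A : 'M[K]_m := \matrix_(i, j) b (tnth e i) (tnth e j).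
have Afree : A \in unitmx.
  rewrite -row_free_unit -kermx_eq0; apply/rowV0P => v /sub_kermxP vA0.
  pose x := \sum_i v 0 i *: tnth e i.
  have x0 : x = 0.
    case: qb => _ _ _; apply => y; apply: (basis_eq0 (P := b x)) => [a u w|j].
      exact: bilDr quadratic_bil _ _ _ _.
    move/matrixP/(_ 0 j): vA0; rewrite !mxE /x (bil_suml quadratic_bil) => vA.
    by rewrite -[RHS]vA; apply: eq_bigr => i _; rewrite mxE.
  apply/rowP => i; rewrite mxE.
  have /freeP := basis_free be; apply.
  by rewrite -[RHS]x0; apply: eq_bigr => k _; rewrite -tnth_nth.
exists [tuple \sum_l invmx A l j *: tnth e l | j < m] => i j.
rewrite tnth_mktuple (bil_sumr quadratic_bil).
have /matrixP/(_ i j) := mulmxV Afree; rewrite !mxE => <-.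
by apply: eq_bigr => l _; rewrite mxE mulrC.
Qed.

Variable dg : 'I_m -> int.
Hypothesis hdg : forall i, tnth e i \in G (dg i).
Variable e' : m.-tuple V.
Hypothesis dual : forall i j, b (tnth e i) (tnth e' j) = (i == j)%:R.

Lemma dual_expandr y : \sum_i b (tnth e i) y *: tnth e' i = y.
Proof.
apply/eqP; rewrite -subr_eq0; apply/eqP.
apply: quadratic_right_nondegenerate => x; set z := _ - _.
apply: (basis_eq0 (P := b^~ z)) => [a u v|j]; first exact: bilDl quadratic_bil _ _ _ _.
rewrite /z -scaleN1r addrC (bilDr quadratic_bil) (bil_sumr quadratic_bil).
rewrite (bigD1 j) //= dual eqxx mulr1 big1 ?addr0 ?mulN1r ?addNr // => i /negPf ne.
by rewrite dual eq_sym ne mulr0.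
Qed.

(** A component of e'_j of a degree other than - dg j is orthogonal to every e_k, hence 0. *)
Lemma dual_homogeneous j : tnth e' j \in G (- dg j).
Proof.
set y := tnth e' j; suff <- : gproj G (- dg j) y = y by apply: gproj_mem.
rewrite -[RHS](sum_gproj G y).
have zero d : d != - dg j -> gproj G d y = 0.
  move=> ne; apply: quadratic_right_nondegenerate => x.
  apply: (basis_eq0 (P := b^~ _)) => [a u v|k]; first exact: bilDl quadratic_bil _ _ _ _.
  have [dk|dk] := eqVneq d (- dg k); last first.
    apply: (quadratic_degree (hdg k) (gproj_mem G d y)).
    by apply: contra dk; rewrite addrC addr_eq0.
  rewrite dk (quadratic_proj _ (hdg k)) dual; case: eqP => // kj.
  by rewrite dk kj eqxx in ne.
have [jG|jG] := boolP (- dg j \in gsupp G).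
  by rewrite (bigD1_seq (- dg j)) ?gsupp_uniq //= big1 ?addr0.
rewrite big1_seq => [|d /andP[_ dG]]; last by apply: zero; apply: contraNneq jG => <-.
by apply/eqP; rewrite -memv0 -(gpiece_out jG) gproj_mem.
Qed.

Lemma dual_expandl x : \sum_i b x (tnth e' i) *: tnth e i = x.
Proof.
apply/eqP; rewrite -subr_eq0; apply/eqP; case: qb => _ _ _; apply => y.
rewrite -(dual_expandr y) (bil_sumr quadratic_bil) big1 // => j _.
rewrite -scaleN1r addrC (bilDl quadratic_bil) (bil_suml quadratic_bil).
rewrite (bigD1 j) //= dual eqxx mulr1 big1 ?addr0 ?mulN1r ?addNr ?mulr0 //.
by move=> i /negPf ne; rewrite dual ne mulr0.
Qed.

End QuadraticForms.

(** * Brackets of symmetrized forms *)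

Section Contraction.

Variables (K : fieldType) (charK : [pchar K] =i pred0).
Variables (V : vectType K) (G : grading V).
Notation letter := (letter G).
Notation vecs := (map (@lvec K V G)).
Notation degs := (map (@ldeg K V G)).
Notation lpar := (@letter_parity K V G).
Notation parw := (word_parity lpar).
Notation sgn b := ((-1) ^+ nat_of_bool b : K).

Lemma pchar0_succ_neq0 n : (n.+1%:R : K) != 0.
Proof. by have /pcharf0P -> := charK. Qed.

(* F^Sym / n for n-linear F: with this scaling the symmetrization of cyclic
   forms turns the bracket into shbr below, without numerical factors. *)
Definition hat_form (F : mform V) (t : seq letter) : K^o :=
  (maxn (size t) 1)%:R^-1 * ksym lpar (onl F) t.

Lemma maxn1_neq0 n : ((maxn n 1)%:R : K) != 0.
Proof. by case: n => [|n]; rewrite ?oner_eq0 // (maxn_idPl _) // pchar0_succ_neq0. Qed.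

Lemma sym_form_hat F t : multilinear F ->
  sym_form G F (vecs t) = (maxn (size t) 1)%:R * hat_form F t.
Proof.
move=> mF; rewrite /hat_form mulrA divff ?maxn1_neq0 // mul1r.
exact: onl_sym_form.
Qed.

Lemma hat_ext F F' : multilinear F -> multilinear F' ->
  (forall t, hat_form F t = hat_form F' t) -> sym_form G F =1 sym_form G F'.
Proof.
move=> mF mF' eqh; apply: (multilinear_ext (G := G)) => [||t].
- exact: multilinear_sym_form.
- exact: multilinear_sym_form.
by rewrite !sym_form_hat // eqh.
Qed.

(** The n rotations contribute equally after symmetrization, and the normalization by n removes this
    factor. *)
Lemma hat_cycl F t : multilinear F ->
  hat_form (cycl_form G F) t = ksym lpar (onl F) t.
Proof.
move=> mF; rewrite /hat_form.
have -> : ksym lpar (onl (cycl_form G F)) t = ksym lpar (kcyc lpar (onl F)) t.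
  by apply: eq_ksym => u _ _; rewrite onl_cycl_form.
rewrite ksym_kcyc; have := maxn1_neq0 (size t).
by move=> N0; rewrite [LHS]mulrA mulVf // mul1r.
Qed.

(** The factor n of [ksym_cycsym] cancels the normalization: [hat_form] turns the insertion of l in
    one slot into the symmetrization of the remaining slots. *)
Lemma hat_cons F l t : cyclic_mform G F ->
  hat_form F (l :: t) = ksym lpar (fun u => onl F (l :: u)) t.
Proof.
case=> mF /(koszul_cyclicP G mF) cF; rewrite /hat_form (ksym_cycsym _ _ cF).
by rewrite /= (maxn_idPl _) // [LHS]mulrA mulVf ?mul1r // pchar0_succ_neq0.
Qed.

Lemma hat_nil F : hat_form F [::] = F [::].
Proof. by rewrite /hat_form /= invr1 mul1r. Qed.

(** Used to replace the degrees of forms by parities of words in the signs. *)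
Lemma hat_degree d F t : has_degree G d F -> hat_form F t != 0 -> parw t = oddz d.
Proof.
move=> dF; apply: contra_neq_eq => nep; rewrite /hat_form.
suff -> : ksym lpar (onl F) t = 0 by rewrite mulr0.
rewrite -[RHS](ksym0 lpar K^o t); apply: eq_ksym => u pu _.
apply/eqP; apply: contraNT nep => /(dF _ _ (letters_hword u)).
move/eqP; rewrite addr_eq0 => /eqP wd.
by rewrite -pu -oddz_wdeg wd oddzN.
Qed.

Lemma multilinear_cuts (W : lmodType K) (h : seq V -> seq V -> W) :
  (forall J, multilinear (h^~ J)) -> (forall I, multilinear (h I)) ->
  multilinear (cuts h).
Proof.
move=> ml mr s1; elim: s1 h ml mr => [|z s1 IHs] h ml mr s2 a x y /=.
  rewrite (mr [::] [::]) scalerDr [RHS]addrACA; congr (_ + _).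
  rewrite -cutsZ -cutsD; apply: eq_cuts => I J _; exact: (ml J [::]).
rewrite (mr [::] (z :: s1)) scalerDr [RHS]addrACA; congr (_ + _).
apply: (IHs (fun I J => h (z :: I) J)) => // J.
exact: (multilinear_cons z (ml J)).
Qed.

Lemma multilinearZ (W : lmodType K) (F : seq V -> W) (c : K) :
  multilinear F -> multilinear (fun s => c *: F s).
Proof. by move=> mF s1 s2 a x y; rewrite mF scalerDr !scalerA mulrC. Qed.

Lemma multilinear_bigsum (W : lmodType K) (I : Type) (r : seq I)
    (F : I -> seq V -> W) : (forall i, multilinear (F i)) ->
  multilinear (fun s => \sum_(i <- r) F i s).
Proof.
move=> mF s1 s2 a x y; rewrite scaler_sumr -big_split.
by apply: eq_bigr => i _; rewrite mF.
Qed.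

Variables (m : nat) (dg : 'I_m -> int) (e e' : 'I_m -> V).
Hypotheses (hdg : forall i, e i \in G (dg i)) (hdg' : forall i, e' i \in G (- dg i)).

Definition eletter i : letter := Letter (hdg i).
Definition eletter' i : letter := Letter (hdg' i).

Lemma lpar_eletter' i : lpar (eletter' i) = lpar (eletter i).
Proof. by rewrite /letter_parity /odd_letter -!/(oddz _) /= !oddzD !oddzN. Qed.

(* The sign only depends on the parities of the letters, so that shbr makes
   sense for forms without degree. *)
Definition shbr (f g : seq letter -> K^o) (t : seq letter) : K^o :=
  \sum_(i < m) shsum lpar (fun I J =>
    sgn (lpar (eletter i) (+) (lpar (eletter i) && parw J) (+) (parw I && parw J))
      *: (f (eletter i :: I) * g (eletter' i :: J) : K^o)) t.

Lemma ftensor_cuts d d' (F F' : mform V) s :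
  ftensor d d' F F' s = degsign K (d * d') *: cuts (fun I J => F I * F' J : K^o) s.
Proof. by rewrite /ftensor cutsE. Qed.

Lemma multilinear_contraction d d' F F' : multilinear F -> multilinear F' ->
  multilinear (contraction dg e e' d d' F F').
Proof.
move=> mF mF'; apply: multilinear_bigsum => i.
apply: (multilinearZ (W := K^o)) => s1 s2 a x y; rewrite !ftensor_cuts.
apply: (multilinearZ (W := K^o)); apply: multilinear_cuts => [J|I] u v b z w.
  rewrite /insertion (multilinear_cons (e i) mF) mulrDl; congr (_ + _).
  exact/esym/mulrA.
rewrite /insertion (multilinear_cons (e' i) mF') mulrDr; congr (_ + _).
exact: mulrCA.
Qed.

Lemma hat_contraction d d' F F' t : cyclic_mform G F -> cyclic_mform G F' ->
  has_degree G d F -> has_degree G d' F' ->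
  hat_form (cycl_form G (contraction dg e e' d d' F F')) t = shbr (hat_form F) (hat_form F') t.
Proof.
move=> cF cF' dF dF'; have [[mF _] [mF' _]] := (cF, cF').
rewrite hat_cycl; last exact: multilinear_contraction.
rewrite ksym_sum; apply: eq_bigr => i _.
pose f u := onl F (eletter i :: u); pose f' u := onl F' (eletter' i :: u).
set c1 := degsign _ _; set c2 : K := degsign K ((d + (dg i - 1)) * (d' + (- dg i - 1))).
transitivity (ksym lpar (fun u => (c1 * c2) *: cuts (fun I J => f I * f' J : K^o) u) t).
  apply: eq_ksym => u _ _; rewrite ftensor_cuts -/c2.
  transitivity (c1 * c2 *: cuts (fun I J => insertion (e i) F I
    * insertion (e' i) F' J : K^o) (vecs u)); first exact: mulrA.
  congr (_ *: _); rewrite !cutsE size_map; apply: eq_bigr => k _.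
  by rewrite /f /f' /onl /= map_take map_drop.
rewrite ksymZ ksym_cuts -shsumZ; apply: eq_shsum => I J _ _.
rewrite ksym_mul -!hat_cons //.
have [->|/(hat_degree dF) pI] := eqVneq (hat_form F (eletter i :: I)) 0.
  by rewrite mul0r !scaler0.
have [->|/(hat_degree dF') pJ] := eqVneq (hat_form F' (eletter' i :: J)) 0.
  by rewrite mulr0 !scaler0.
congr (_ *: _); rewrite /c1 /c2 /degsign -!/(oddz _) -signr_addb.
congr ((-1) ^+ nat_of_bool _).
have p1 : oddz (dg i - 1) = lpar (eletter i) by [].
have p2 : oddz (- dg i - 1) = lpar (eletter i) by rewrite -lpar_eletter'.
rewrite !oddzM !(oddzD d) !(oddzD d') p1 p2 -pI -pJ /= lpar_eletter'.
by case: (lpar _); case: (parw I); case: (parw J).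
Qed.

End Contraction.

Section ScalarForm.

Variables (K : fieldType) (V : vectType K) (f : V -> K) (linf : scalar f).

Definition scalar_fun (x : V) : K := f x.

Lemma scalar_fun_is_scalar : scalar scalar_fun. Proof. exact: linf. Qed.

HB.instance Definition _ :=
  GRing.isLinear.Build K V K *%R scalar_fun scalar_fun_is_scalar.

Definition scalar_of : {scalar V} := scalar_fun.

End ScalarForm.

(** * Expansion of cyclic forms in cyclic sums of tensors of coordinates *)

Section FormSpace.

Variables (K : fieldType) (charK : [pchar K] =i pred0).
Variables (V : vectType K) (G : grading V).
Notation letter := (letter G).
Notation vecs := (map (@lvec K V G)).
Notation degs := (map (@ldeg K V G)).
Notation lpar := (@letter_parity K V G).
Notation parw := (word_parity lpar).
Notation sgn b := ((-1) ^+ nat_of_bool b : K).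
Implicit Types (F : mform V) (a : {scalar V}).

Lemma cyclic_lin c F F' : cyclic_mform G F -> cyclic_mform G F' ->
  cyclic_mform G (fun s => c * F s + F' s).
Proof.
move=> [mF cF] [mF' cF']; have mFF' : multilinear (fun s => c * F s + F' s : K^o).
  by move=> s1 s2 b x y; rewrite mF mF' mulrDr scalerDr addrACA mulrCA.
split=> //; apply/koszul_cyclicP => // u x.
move/(koszul_cyclicP G mF): cF => cF; move/(koszul_cyclicP G mF'): cF' => cF'.
have /= := cF u x; have /= := cF' u x; rewrite /onl => -> ->.
by rewrite scalerDr; congr (_ + _); apply: mulrCA.
Qed.

Lemma cyclic0 : cyclic_mform G (fun _ => 0).
Proof.
split=> [s1 s2 c x y|]; first by rewrite scaler0 addr0.
apply/koszul_cyclicP => [s1 s2 c x y|u x]; first by rewrite scaler0 addr0.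
by rewrite /onl scaler0.
Qed.

Lemma cyclic_sum (I : Type) (r : seq I) (c : I -> K) (F : I -> mform V) :
  (forall i, cyclic_mform G (F i)) ->
  cyclic_mform G (fun s => \sum_(i <- r) c i * F i s).
Proof.
move=> cF; elim: r => [|i r IHr].
  rewrite (_ : (fun s => _) = fun=> 0); first exact: cyclic0.
  by apply: functional_extensionality => s; rewrite big_nil.
rewrite (_ : (fun s => _) = fun s => c i * F i s + \sum_(j <- r) c j * F j s).
  exact: cyclic_lin.
by apply: functional_extensionality => s; rewrite big_cons.
Qed.

Lemma cyclic_lform a : cyclic_mform G (lform a).
Proof.
have ma : multilinear (lform a).
  move=> [|z s1] [|z' s2] c x y /=; rewrite ?linearP //.
  - by rewrite scaler0 addr0.
  - by case: s1 => [|z1 s1] /=; rewrite scaler0 addr0.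
  - by case: s1 => [|z1 s1] /=; rewrite scaler0 addr0.
split=> //; apply/koszul_cyclicP => // -[|l u] x; rewrite /onl /=.
  by rewrite andbF scale1r.
by rewrite map_rcons; case: (vecs u); rewrite /= scaler0.
Qed.

Lemma cyclic_component n F : cyclic_mform G F -> cyclic_mform G (component n F).
Proof.
move=> [mF /(koszul_cyclicP G mF) cF].
have mn : multilinear (component n F).
  move=> s1 s2 c x y; rewrite /component !size_cat /=.
  by case: ifP => _; rewrite ?mF // scaler0 addr0.
split=> //; apply/koszul_cyclicP => // u x.
rewrite /onl /component /= !map_rcons size_rcons size_map.
case: ifP => _; last by rewrite scaler0.
by have := cF u x; rewrite /onl map_rcons.
Qed.

Lemma multilinear_ltensor k (d : 'I_k -> int) (b : 'I_k -> {scalar V}) :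
  multilinear (ltensor d b).
Proof.
move=> s1 s2 c x y; rewrite /ltensor !size_cat /=.
case: eqP => [szk|_]; last by rewrite scaler0 addr0.
have ltk : (size s1 < k)%N by rewrite -szk addnS ltnS leq_addr.
pose i0 := Ordinal ltk.
have prodE z : \prod_(i < k) b i (s1 ++ z :: s2)`_i
    = b i0 z * \prod_(i < k | i != i0) b i (s1 ++ 0 :: s2)`_i.
  rewrite (bigD1 i0) //=; congr (_ * _).
    by rewrite nth_cat ltnn subnn.
  apply: eq_bigr => i ne; rewrite !nth_cat; case: ltnP => // le.
  have lt : (size s1 < i)%N by rewrite ltn_neqAle le andbT eq_sym.
  by rewrite -(subnSK lt).
rewrite !prodE linearP mulrDl mulrDr; congr (_ + _).
by rewrite -!mulrA [LHS]mulrCA.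
Qed.

Lemma wdeg_tuple n (u : n.-tuple letter) :
  wdeg (degs u) = \sum_(i < n) (ldeg (tnth u i) - 1).
Proof. by rewrite /wdeg big_map big_tuple. Qed.

Lemma has_degree_cycl d F : multilinear F -> has_degree G d F ->
  has_degree G d (cycl_form G F).
Proof.
move=> mF dF ds s /hword_letters[t -> ->].
rewrite -[cycl_form _ _ _]/(onl (cycl_form G F) t) onl_cycl_form //.
apply: contra_neq_eq => nd; rewrite /kcyc big1 // => r _.
suff -> : onl F (pword r (in_tuple t)) = 0 by rewrite scaler0.
apply/eqP; apply: contraNT nd => /(dF _ _ (letters_hword _)) <-; apply/eqP.
congr (_ + _); rewrite -[t in LHS]/(tval (in_tuple t)) !wdeg_tuple.
rewrite (reindex_inj (@perm_inj _ (r^-1)%g)).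
by apply: eq_bigr => i _; rewrite tnth_mktuple.
Qed.

Variables (N : nat) (E : N.-tuple V) (g : 'I_N -> int).
Hypotheses (bE : basis_of fullv E) (hE : forall i, tnth E i \in G (g i)).

Lemma coord_E i k : coord E i (tnth E k) = (i == k)%:R.
Proof. by rewrite (tnth_nth 0) coord_free ?(basis_free bE) // eq_sym. Qed.

Lemma sum_coord_E x : \sum_i coord E i x *: tnth E i = x.
Proof.
rewrite [RHS](coord_basis bE (memvf x)); apply: eq_bigr => i _.
by rewrite (tnth_nth 0).
Qed.

Lemma coord_hom d x i : x \in G d -> coord E i x != 0 -> g i = d.
Proof.
move=> xd; apply: contra_neq_eq => ne.
have := gproj_hom d xd; rewrite eqxx => {1}<-.
rewrite -[x]sum_coord_E /gproj !linear_sum big1 // => k _.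
rewrite !linearZ /= -/(gproj G d (tnth E k)) (gproj_hom _ (hE k)).
case: eqP => [dk|_]; last by rewrite linear0 mulr0.
by rewrite coord_E; case: eqP => [ik|]; rewrite ?mulr0 //; rewrite dk -ik eqxx in ne.
Qed.

(** A form of degree d pairs with words of degree - d, and the i-th basis vector has degree g i - 1
    in V[1]. *)
Lemma coord_degree i : has_degree G (1 - g i) (lform (coord E i)).
Proof.
move=> ds s /hword_letters[t -> ->]; case: t => [|l [|l' t]] /=; rewrite ?eqxx //.
move/(coord_hom (lvecP l)) ->; rewrite /wdeg big_seq1; lia.
Qed.

Lemma scalar_coord a x : a x = \sum_i a (tnth E i) * coord E i x.
Proof.
rewrite -{1}[x]sum_coord_E linear_sum; apply: eq_bigr => i _.
by rewrite linearZ mulrC.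
Qed.

Definition wtensor n (w : n.-tuple 'I_N) : mform V :=
  ltensor (fun i => 1 - g (tnth w i)) (fun i => coord E (tnth w i)).

Lemma has_degree_wtensor n (w : n.-tuple 'I_N) :
  has_degree G (\sum_(i < n) (1 - g (tnth w i))) (wtensor w).
Proof.
move=> ds s /hword_letters[t -> ->]; rewrite /wtensor /ltensor size_map.
have [szt|_] := eqVneq (size t) n; last by rewrite eqxx.
rewrite mulf_eq0 negb_or => /andP[_ /prodf_neq0 ne].
rewrite /wdeg big_map (big_nth (Letter (mem0v (G 0)))) big_mkord szt -big_split.
rewrite big1 // => i _ /=; have /(_ isT) := ne i.
rewrite (nth_map (Letter (mem0v (G 0)))) ?szt // => /(coord_hom (lvecP _)) ->.
lia.
Qed.

(** The constant sign built in [ltensor]; as it is its own inverse, it also serves as the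
    coefficient that removes it. *)
Definition wsign n (w : n.-tuple 'I_N) : K :=
  \prod_(i < n) \prod_(j < n | (i < j)%N)
    degsign K ((1 - g (tnth w i)) * (1 - g (tnth w j))).

Lemma wsignK n (w : n.-tuple 'I_N) : wsign w * wsign w = 1.
Proof.
rewrite -big_split big1 // => i _ /=; rewrite -big_split big1 // => j _ /=.
by rewrite /degsign -signr_addb addbb.
Qed.

Lemma multilinear_expand F s : multilinear F ->
  F s = \sum_(w : (size s).-tuple 'I_N)
    (\prod_(i < size s) coord E (tnth w i) s`_i) * F (map (tnth E) w).
Proof.
elim: s F => [|x s IHs] F mF.
  rewrite (big_pred1 [tuple]) => [|w]; last by apply/esym/eqP; rewrite [w]tuple0.
  by rewrite big_ord0 mul1r.
rewrite -{1}[x]sum_coord_E.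
have -> : F (\sum_i coord E i x *: tnth E i :: s)
    = \sum_i coord E i x * F (tnth E i :: s).
  rewrite (multilinear_sum [::] s _ _ _ mF); apply: eq_bigr => i _.
  have := mF [::] s (coord E i x) (tnth E i) 0; rewrite addr0 /= => ->.
  by rewrite (multilinear0 (s := 0 :: s) mF) ?mem_head // addr0.
under eq_bigr do rewrite (IHs _ (multilinear_cons _ mF)) mulr_sumr.
rewrite pair_bigA /=.
pose c (iw : 'I_N * (size s).-tuple 'I_N) := [tuple of iw.1 :: iw.2].
have bij_c : bijective c.
  exists (fun w => (thead w, [tuple of behead w])) => [[i w]|w].
    by congr (_, _); apply: val_inj.
  by rewrite /c -tuple_eta.
rewrite [RHS](reindex _ (onW_bij _ bij_c)); apply: eq_bigr => -[i w] _ /=.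
rewrite big_ord_recl tnth0 /= -mulrA; congr (_ * (_ * _)).
by apply: eq_bigr => k _; rewrite tnthS.
Qed.

Lemma component_expand n F s : multilinear F ->
  component n F s = \sum_(w : n.-tuple 'I_N)
    (wsign w * F (map (tnth E) w)) * wtensor w s.
Proof.
move=> mF; rewrite /component /wtensor /ltensor; case: eqP => [<-|_]; last first.
  by rewrite big1 // => w _; rewrite mulr0.
rewrite {1}(multilinear_expand s mF); apply: eq_bigr => w _.
by rewrite -/(wsign w) mulrACA wsignK mul1r mulrC.
Qed.

(** F is a combination of the tensors [wtensor], and being cyclic it is its own cyclic sum divided
    by n. This is the shape to which the Leibniz axiom applies; the equality is one of functions so
    that it can be rewritten inside a bracket. *)
Lemma cyclic_expand n F : cyclic_mform G F -> component n F = fun s =>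
  \sum_(w : n.-tuple 'I_N)
    ((maxn n 1)%:R^-1 * (wsign w * F (map (tnth E) w)))
      * cycl_form G (wtensor w) s.
Proof.
move=> cF; have mF := cF.1; apply: functional_extensionality.
apply: (multilinear_ext (G := G)) => [||t].
- exact: (cyclic_component n cF).1.
- apply: (cyclic_sum _ _ _).1 => w; apply: cyclic_cycl_form.
  exact: multilinear_ltensor.
have mC := (cyclic_component n cF).1.
have /(koszul_cyclicP G mC) cC := (cyclic_component n cF).2.
have := cycsym_kcycE t cC; rewrite -[onl (component n F) t]/(component n F (vecs t)).
have [szt|szt] := eqVneq (size t) n; last first.
  have comp0 u : size u = size t -> component n F (vecs u) = 0.
    by rewrite /component size_map => ->; rewrite (negPf szt).
  rewrite comp0 // => _; rewrite big1 // => w _.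
  rewrite -[cycl_form _ _ _]/(onl (cycl_form G (wtensor w)) t).
  rewrite onl_cycl_form; last exact: multilinear_ltensor.
  rewrite /kcyc big1 ?mulr0 // => r _.
  rewrite /onl /wtensor /ltensor size_map size_tuple (negPf szt).
  by rewrite scaler0.
rewrite szt => kE.
rewrite -[LHS](mulKf (maxn1_neq0 charK n)) -[X in _ * X]kE.
rewrite {1}/kcyc mulr_sumr.
under eq_bigr => r _ do rewrite [X in _ *: X]component_expand // scaler_sumr mulr_sumr.
rewrite exchange_big /=; apply: eq_bigr => w _.
rewrite -[cycl_form _ _ _]/(onl (cycl_form G (wtensor w)) t).
rewrite onl_cycl_form; last exact: multilinear_ltensor.
rewrite /kcyc mulr_sumr; apply: eq_bigr => r _.
by rewrite -[RHS]mulrA; congr (_ * _); rewrite [RHS]mulrCA.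
Qed.

End FormSpace.

(** * The quadratic form of a Pinczon bracket *)

Section PinczonBracket.

Variables (K : fieldType) (charK : [pchar K] =i pred0).
Variables (V : vectType K) (G : grading V).
Notation letter := (letter G).
Notation vecs := (map (@lvec K V G)).
Notation degs := (map (@ldeg K V G)).
Notation lpar := (@letter_parity K V G).
Notation parw := (word_parity lpar).
Notation sgn b := ((-1) ^+ nat_of_bool b : K).
Implicit Types (F : mform V) (a : {scalar V}).

Variable br : mform V -> mform V -> mform V.
Hypothesis pb : pinczon_bracket G br.

Lemma br_closed F F' : cyclic_mform G F -> cyclic_mform G F' ->
  cyclic_mform G (br F F').
Proof. by case: pb => h *; apply: h. Qed.

Lemma br0r F s : cyclic_mform G F -> br F (fun _ => 0) s = 0.
Proof.
move=> cF; have c0 := cyclic0 G.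
have := pb_linearr pb (-1) cF c0 c0 s.
rewrite (_ : (fun s => -1 * 0 + 0) = (fun _ : seq V => 0 : K^o)).
  by move->; rewrite mulN1r addNr.
by apply: functional_extensionality => u; rewrite mulr0 addr0.
Qed.

Lemma br0l F s : cyclic_mform G F -> br (fun _ => 0) F s = 0.
Proof.
move=> cF; have c0 := cyclic0 G.
have := pb_linearl pb (-1) c0 c0 cF s.
rewrite (_ : (fun s => -1 * 0 + 0) = (fun _ : seq V => 0 : K^o)).
  by move->; rewrite mulN1r addNr.
by apply: functional_extensionality => u; rewrite mulr0 addr0.
Qed.

Lemma br_sumr F (I : Type) (r : seq I) (c : I -> K) (F' : I -> mform V) s :
  cyclic_mform G F -> (forall i, cyclic_mform G (F' i)) ->
  br F (fun u => \sum_(i <- r) c i * F' i u) s = \sum_(i <- r) c i * br F (F' i) s.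
Proof.
move=> cF cF'; elim: r => [|i r IHr].
  rewrite big_nil (_ : (fun u => _) = fun=> 0) ?br0r //.
  by apply: functional_extensionality => u; rewrite big_nil.
rewrite big_cons -IHr -(pb_linearr pb) //; last exact: cyclic_sum.
congr (br F _ s); apply: functional_extensionality => u.
by rewrite big_cons.
Qed.

Lemma br_suml F (I : Type) (r : seq I) (c : I -> K) (F' : I -> mform V) s :
  cyclic_mform G F -> (forall i, cyclic_mform G (F' i)) ->
  br (fun u => \sum_(i <- r) c i * F' i u) F s = \sum_(i <- r) c i * br (F' i) F s.
Proof.
move=> cF cF'; elim: r => [|i r IHr].
  rewrite big_nil (_ : (fun u => _) = fun=> 0) ?br0l //.
  by apply: functional_extensionality => u; rewrite big_nil.
rewrite big_cons -IHr -(pb_linearl pb) //; last exact: cyclic_sum.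
congr (br _ F s); apply: functional_extensionality => u.
by rewrite big_cons.
Qed.

Lemma component_lform n a :
  component n (lform a) = if n == 1%N then lform a else fun=> 0.
Proof.
apply: functional_extensionality => s; rewrite /component /lform.
by case: s => [|x [|y s]] /=; case: n => [|[|n]] /=; rewrite ?if_same.
Qed.

(** A linear form has a single term, so on a word of length n the bracket only sees the term of
    arity n + 1 of F. *)
Lemma br_lform_component a F s : cyclic_mform G F ->
  br (lform a) F s = br (lform a) (component (size s).+1 F) s.
Proof.
move=> cF; have ca := cyclic_lform G a.
rewrite (pb_terms pb) // big_ord_recl subn0 component_lform /=.
rewrite big1 ?addr0 // => k _; rewrite component_lform br0l //.
exact: cyclic_component.
Qed.

Variables (N : nat) (E : N.-tuple V) (g : 'I_N -> int).
Hypotheses (bE : basis_of fullv E) (hE : forall i, tnth E i \in G (g i)).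

Definition wcoef n F (w : n.-tuple 'I_N) : K :=
  (maxn n 1)%:R^-1 * (wsign K g w * F (map (tnth E) w)).

Lemma br_lform_expand a F s : cyclic_mform G F ->
  br (lform a) F s = \sum_(w : (size s).+1.-tuple 'I_N)
    wcoef F w * br (lform a) (cycl_form G (wtensor E g w)) s.
Proof.
move=> cF; rewrite br_lform_component // (cyclic_expand charK g bE _ cF).
rewrite br_sumr //; first exact: cyclic_lform.
by move=> w; apply/cyclic_cycl_form/multilinear_ltensor.
Qed.

Lemma br_lform_nondegenerate a :
  (forall a', br (lform a) (lform a') [::] = 0) -> forall x, a x = 0.
Proof.
move=> a0; have ca := cyclic_lform G a.
have zero F : cyclic_mform G F -> br (lform a) F =1 fun=> 0.
  move=> cF s; rewrite br_lform_expand // big1 // => w _.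
  rewrite (pb_linear_form pb) ?big1 ?mulr0 // => [j _|i].
    by rewrite a0 mulr0 mul0r.
  exact: (@coord_degree _ _ _ _ _ _ bE hE).
(* [pb_center] leaves only arity 0 in the symmetrization of a, whereas Sym fixes a linear form. *)
move=> x; have sa y : sym_form G (lform a) [:: y] = 0.
  have := pb_center pb ca zero (s := [:: y]).
  by case: eqP => // _ /(_ isT).
rewrite -(sum_gproj G x) linear_sum big1 // => d _.
have := sa (gproj G d x).
rewrite -[[:: gproj _ _ _]]/(vecs [:: letter_proj G d x]).
rewrite -[sym_form _ _ _]/(onl (sym_form G (lform a)) [:: letter_proj G d x]).
by rewrite onl_sym_form //; case: ca.
Qed.

Lemma br_lform2_expand a a' : br (lform a) (lform a') [::]
  = \sum_i \sum_j a (tnth E i) * a' (tnth E j)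
      * br (lform (coord E i)) (lform (coord E j)) [::].
Proof.
have lformE (c : {scalar V}) :
    lform c = fun s => \sum_i c (tnth E i) * lform (coord E i) s.
  apply: functional_extensionality => -[|x [|y s]] /=.
  - by rewrite big1 // => i _; rewrite mulr0.
  - exact: (scalar_coord bE c x).
  by rewrite big1 // => i _; rewrite mulr0.
rewrite (lformE a) br_suml; try (move=> *; exact: cyclic_lform).
apply: eq_bigr => i _; rewrite (lformE a') br_sumr; try (move=> *; exact: cyclic_lform).
by rewrite mulr_sumr; apply: eq_bigr => j _; rewrite mulrA.
Qed.

End PinczonBracket.

Lemma pchar0_intr (K : fieldType) (charK : [pchar K] =i pred0) (z : int) :
  (z%:~R == 0 :> K) = (z == 0).
Proof.
have /pcharf0P natK := charK.
by case: z => n; rewrite ?NegzE ?mulrNz ?oppr_eq0 -?pmulrn natK.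
Qed.

(** * The quadratic form b attached to a Pinczon bracket *)

Section BracketForm.

Variables (K : fieldType) (charK : [pchar K] =i pred0).
Variables (V : vectType K) (G : grading V).
Notation sgn b := ((-1) ^+ nat_of_bool b : K).

(* The linear form b (-, x) acts on linear forms as the evaluation at x, up to
   sign; this determines b from the bracket of linear forms. *)
Definition bracket_form (br : mform V -> mform V -> mform V)
    (b : V -> V -> K^o) : Prop :=
  forall (d : int) (x : V) (a a' : {scalar V}), x \in G d ->
    (forall y, a y = b y x) ->
    br (lform a) (lform a') [::] = sgn (oddz (d - 1)) * a' x.

Variable br : mform V -> mform V -> mform V.
Hypothesis pb : pinczon_bracket G br.

Lemma bracket_form_exists : exists2 b, quadratic_form G b & bracket_form br b.
Proof.
have [N [E [g [bE hE]]]] := homogeneous_basis G.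
pose C : 'M[K]_N := \matrix_(i, j) br (lform (coord E i)) (lform (coord E j)) [::].
(* The bracket of the two coordinates has degree (1 - g i) + (1 - g j) - 2, which must be 0 for a
   non zero scalar. *)
have Cdeg i j : C i j != 0 -> g i + g j = 0.
  rewrite mxE => Cij; have ci k := cyclic_lform G (coord E k).
  have := pb_degree pb (ci i) (ci j)
    (@coord_degree _ _ _ _ _ _ bE hE i) (@coord_degree _ _ _ _ _ _ bE hE j).
  by move/(_ [::] [::] isT Cij); rewrite /wdeg big_nil; lia.
have Csym i j : C j i = sgn (oddz (g i)) * C i j.
  have ci k := cyclic_lform G (coord E k).
  have := pb_antisym pb (ci i) (ci j)
    (@coord_degree _ _ _ _ _ _ bE hE i) (@coord_degree _ _ _ _ _ _ bE hE j) [::].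
  rewrite !mxE => ->; have [->|] := eqVneq (br (lform (coord E i)) (lform (coord E j)) [::]) 0.
    by rewrite !mulr0 oppr0.
  have := Cdeg i j; rewrite mxE => dij /dij/eqP; rewrite addrC addr_eq0 => /eqP ->.
  rewrite -mulNr; congr (_ * _); rewrite /degsign -/(oddz _) oddzM opprK !oddzD oddzN.
  by case: (oddz (g i)); rewrite ?opprK.
have Cunit : C \in unitmx.
  rewrite -row_free_unit -kermx_eq0; apply/rowV0P => r /sub_kermxP rC0.
  have linf : scalar (fun x => \sum_k r 0 k * coord E k x).
    move=> c u v; rewrite mulr_sumr -big_split; apply: eq_bigr => k _.
    by rewrite linearP mulrDr mulrCA.
  pose a := scalar_of linf.
  have aE k : a (tnth E k) = r 0 k.
    rewrite /a /= /scalar_fun (bigD1 k) //= coord_E // eqxx mulr1 big1 ?addr0 //.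
    by move=> i /negPf ne; rewrite coord_E // ne mulr0.
  apply/rowP => k; rewrite mxE -aE.
  apply: (br_lform_nondegenerate charK pb bE hE) => a'.
  rewrite (br_lform2_expand pb bE) exchange_big big1 // => j _ /=.
  have /matrixP/(_ 0 j) := rC0; rewrite !mxE => rC.
  rewrite -[RHS](mulr0 (a' (tnth E j))) -[X in _ = _ * X]rC mulr_sumr.
  by apply: eq_bigr => i _; rewrite mxE aE mulrA [a' _ * _]mulrC.
pose D := invmx C.
have Ddeg i j : D i j != 0 -> g i + g j = 0.
  (* C anticommutes with the grading operator L, hence so does its inverse. *)
  pose L : 'M[K]_N := diag_mx (\row_i (g i)%:~R).
  have LC : L *m C + C *m L = 0.
    apply/matrixP => k l; rewrite mul_diag_mx mul_mx_diag !mxE.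
    have := Cdeg k l; rewrite mxE => dkl.
    have [->|/dkl/eqP] := eqVneq (br (lform (coord E k)) (lform (coord E l)) [::]) 0.
      by rewrite mulr0 mul0r addr0.
    rewrite addr_eq0 => /eqP ->; rewrite mulrC -mulrDr.
    by rewrite mulrNz addNr mulr0.
  have : D *m (L *m C + C *m L) *m D = 0 by rewrite LC mulmx0 mul0mx.
  rewrite mulmxDr mulmxDl !mulmxA mulVmx // mul1mx -mulmxA mulmxV // mulmx1.
  move/matrixP/(_ i j); rewrite mul_diag_mx mul_mx_diag !mxE mulrC -mulrDl -intrD.
  move/eqP; rewrite mulf_eq0 pchar0_intr // => /orP[/eqP gg _|-> //].
  by rewrite addrC.
(* The symmetry of C reads C^T = S C for the diagonal matrix S of signs; passing to inverses, D^T =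
   D S. *)
have Dsym k l : D l k = sgn (oddz (g l)) * D k l.
  pose S : 'M[K]_N := diag_mx (\row_i sgn (oddz (g i))).
  have SS : S *m S = 1%:M.
    apply/matrixP => i j; rewrite mul_diag_mx !mxE; case: eqP => [->|_].
      by rewrite mulr1n -signr_addb addbb.
    by rewrite mulr0n mulr0.
  have CS : C^T = S *m C.
    apply/matrixP => i j; rewrite mul_diag_mx [LHS]mxE Csym [RHS]mxE.
    by congr (_ * _); rewrite mxE.
  have CT : C^T *m (D *m S) = 1%:M.
    by rewrite CS !mulmxA -(mulmxA S) mulmxV // mulmx1 SS.
  have : D^T = D *m S.
    by rewrite /D trmx_inv -[invmx C^T]mulmx1 -CT mulKmx // unitmx_tr.
  by move/matrixP/(_ k l); rewrite mul_mx_diag !mxE mulrC.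
(* Forced by [bracket_form] at x = e_l: the row of the b (e_k, e_l), multiplied by C, must be
   (-1)^(deg e_l) times the l-th unit row. *)
pose B k l := sgn (oddz (g l - 1)) * D l k.
pose b (x y : V) : K^o := \sum_k \sum_l coord E k x * coord E l y * B k l.
have bE_ k x : b x (tnth E k) = \sum_l coord E l x * B l k.
  apply: eq_bigr => l _; rewrite (bigD1 k) //= coord_E // eqxx mulr1 big1 ?addr0 //.
  by move=> j /negPf ne; rewrite coord_E // ne mulr0 mul0r.
have bilb : bilinear_map b.
  split=> x c u v; rewrite /b mulr_sumr -big_split; apply: eq_bigr => k _ /=;
  rewrite mulr_sumr -big_split; apply: eq_bigr => l _ /=.
    by rewrite linearP mulrDr mulrDl; congr (_ + _); rewrite !mulrA [_ * c]mulrC.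
  by rewrite linearP !mulrDl !mulrA.
have Bsym k l : B l k = sgn (oddz (g k) && oddz (g l)) * B k l.
  rewrite /B Dsym; have [->|/Ddeg] := eqVneq (D l k) 0; first by rewrite !mulr0.
  move/eqP; rewrite addr_eq0 => /eqP ->.
  rewrite !mulrA -!signr_addb !oddzD !oddzN; congr (_ ^+ nat_of_bool _ * _).
  by case: (oddz (g k)).
exists b.
  split=> //.
  - move=> i j x y xi yj; apply: contra_neq_eq => nij.
    rewrite /b big1 // => k _; rewrite big1 // => l _.
    have [->|/(coord_hom bE hE xi) gk] := eqVneq (coord E k x) 0; first by rewrite !mul0r.
    have [->|/(coord_hom bE hE yj) gl] := eqVneq (coord E l y) 0.
      by rewrite mulr0 !mul0r.
    rewrite /B; have [->|/Ddeg] := eqVneq (D l k) 0; first by rewrite !mulr0.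
    by rewrite gk gl addrC => ij; rewrite ij eqxx in nij.
  - move=> i j x y xi yj; rewrite /b mulr_sumr exchange_big; apply: eq_bigr => k _ /=.
    rewrite mulr_sumr; apply: eq_bigr => l _.
    have [->|/(coord_hom bE hE xi) gk] := eqVneq (coord E k x) 0.
      by rewrite mulr0 !mul0r mulr0.
    have [->|/(coord_hom bE hE yj) gl] := eqVneq (coord E l y) 0.
      by rewrite mulr0 !mul0r mulr0.
    rewrite Bsym gk gl /degsign -/(oddz _) oddzM mulrCA; congr (_ * (_ * _)).
    exact: mulrC.
  move=> x x0; rewrite -(sum_coord_E bE x) big1 // => k _.
  suff -> : coord E k x = 0 by rewrite scale0r.
  pose r : 'cV[K]_N := \col_i coord E i x.
  have Dr : D *m r = 0.
    apply/colP => l; rewrite !mxE.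
    apply: (mulfI (_ : sgn (oddz (g l - 1)) != 0)); first by rewrite signr_eq0.
    rewrite mulr0 -[RHS](x0 (tnth E l)) bE_ mulr_sumr; apply: eq_bigr => i _.
    by rewrite mxE /B mulrA mulrC.
  have : r = 0 by rewrite -[r](mulKmx (_ : D \in unitmx)) ?Dr ?mulmx0 // unitmx_inv.
  by move/colP/(_ k); rewrite !mxE.
move=> d x a a' xd ab; rewrite (br_lform2_expand pb bE).
rewrite (scalar_coord bE a' x) mulr_sumr exchange_big; apply: eq_bigr => j _ /=.
transitivity (a' (tnth E j) * \sum_i a (tnth E i) * C i j).
  by rewrite mulr_sumr; apply: eq_bigr => i _; rewrite mxE mulrA [a' _ * _]mulrC.
rewrite [RHS]mulrCA; congr (_ * _).
transitivity (\sum_l coord E l x * sgn (oddz (g l - 1)) * (D *m C) l j).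
  have aEi i : a (tnth E i) = \sum_l coord E l x * (sgn (oddz (g l - 1)) * D l i).
    rewrite ab /b (bigD1 i) //= [X in _ + X]big1 ?addr0 => [|k /negPf ne]; last first.
      by rewrite big1 // => l _; rewrite coord_E // ne !mul0r.
    by apply: eq_bigr => l _; rewrite coord_E // eqxx mul1r.
  under eq_bigr do rewrite aEi mulr_suml.
  rewrite exchange_big; apply: eq_bigr => l _ /=; rewrite mxE mulr_sumr.
  by apply: eq_bigr => i _; rewrite !mulrA.
rewrite mulVmx // (bigD1 j) //= mxE eqxx mulr1 big1 ?addr0 => [|l /negPf ne]; last first.
  by rewrite mxE ne mulr0.
have [->|/(coord_hom bE hE xd) ->] := eqVneq (coord E j x) 0; first by rewrite mul0r mulr0.
exact: mulrC.
Qed.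

End BracketForm.

(** * The Leibniz sum of a tensor of linear forms as an insertion *)

Section BracketInsertion.

Variables (K : fieldType) (charK : [pchar K] =i pred0).
Variables (V : vectType K) (G : grading V).
Notation letter := (letter G).
Notation vecs := (map (@lvec K V G)).
Notation degs := (map (@ldeg K V G)).
Notation lpar := (@letter_parity K V G).
Notation parw := (word_parity lpar).
Notation sgn b := ((-1) ^+ nat_of_bool b : K).
Implicit Types (F : mform V).

Lemma prod_pairs_lift n (k : 'I_n.+1) (c : 'I_n.+1 -> 'I_n.+1 -> K) :
  (forall i j, c i j = c j i) ->
  \prod_(i < n.+1) \prod_(j < n.+1 | (i < j)%N) c i j
  = (\prod_(i < n) c (lift k i) k)
    * \prod_(i < n) \prod_(j < n | (i < j)%N) c (lift k i) (lift k j).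
Proof.
move=> cC; rewrite (bigD1_ord k) //=.
under [X in _ * X]eq_bigr do rewrite big_mkcond (bigD1_ord k) //=.
rewrite big_split /= mulrA big_mkcond (bigD1_ord k) //= ltnn mul1r -big_split /=.
congr (_ * _); apply: eq_bigr => i _.
  rewrite cC; have := neq_lift k i; rewrite -val_eqE /=.
  by case: ltngtP; rewrite ?mulr1 ?mul1r.
rewrite -big_mkcond; apply: eq_bigl => j.
by rewrite /= /bump; case: leqP; case: leqP => *; lia.
Qed.

Lemma nth_insert (T : Type) (x0 x : T) (s : seq T) n (k : 'I_n.+1) (i : 'I_n) :
  size s = n -> nth x0 (take k s ++ x :: drop k s) (lift k i) = nth x0 s i.
Proof.
move=> szs; have szk : size (take k s) = k.
  by rewrite size_takel // szs -ltnS.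
rewrite nth_cat szk /= /bump; case: (leqP k i) => ki.
  by rewrite add1n ltnNge (leq_trans ki) //= subSn //= nth_drop subnKC.
by rewrite add0n ki nth_take.
Qed.

Lemma ltensor_insert n (d : 'I_n.+1 -> int) (c : 'I_n.+1 -> {scalar V})
    (k : 'I_n.+1) x (s : seq V) : size s = n ->
  ltensor d c (take k s ++ x :: drop k s)
  = (\prod_(i < n) degsign K (d (lift k i) * d k))
    * (c k x * ltensor (fun i => d (lift k i)) (fun i => c (lift k i)) s).
Proof.
move=> szs; have szk : size (take k s) = k.
  by rewrite size_takel // szs -ltnS.
have szi : size (take k s ++ x :: drop k s) = n.+1.
  by rewrite size_cat /= addnS -size_cat cat_take_drop szs.
rewrite /ltensor szi szs !eqxx.
rewrite (prod_pairs_lift k) => [|i j]; last by rewrite mulrC.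
rewrite -!mulrA; congr (_ * _); rewrite [RHS]mulrCA; congr (_ * _).
rewrite (bigD1_ord k) //=; congr (_ * _).
  by rewrite nth_cat szk ltnn subnn.
by apply: eq_bigr => i _; rewrite nth_insert.
Qed.

Lemma ltensor_parity n (d : 'I_n -> int) (c : 'I_n -> {scalar V}) (u : seq letter) :
  (forall i, has_degree G (d i) (lform (c i))) -> ltensor d c (vecs u) != 0 ->
  map lpar u = [tuple oddz (d i) | i < n].
Proof.
move=> dc; rewrite /ltensor size_map.
have [szu|_] := eqVneq (size u) n; last by rewrite eqxx.
rewrite mulf_eq0 negb_or => /andP[_ /prodf_neq0 ne].
apply: (@eq_from_nth _ false) => [|i]; first by rewrite size_map size_tuple.
rewrite size_map szu => ltin; pose i' := Ordinal ltin.
pose l0 : letter := Letter (mem0v (G 0)).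
rewrite (nth_map l0) ?szu // -[i in RHS]/(nat_of_ord i') -tnth_nth tnth_mktuple.
have /(_ isT) := ne i'; rewrite (nth_map l0) ?szu //=; set l := nth l0 u i => cl.
have := dc i' [:: ldeg l] [:: lvec l]; rewrite /= lvecP => /(_ isT cl).
rewrite /wdeg big_seq1 => /eqP; rewrite addr_eq0 => /eqP e.
by rewrite /letter_parity /odd_letter -/(oddz _) e oddzN.
Qed.

Lemma lform_parity d (c : {scalar V}) (l : letter) :
  has_degree G d (lform c) -> c (lvec l) != 0 -> lpar l = oddz d.
Proof.
move=> dc cl; have := dc [:: ldeg l] [:: lvec l]; rewrite /= lvecP => /(_ isT cl).
rewrite /wdeg big_seq1 => /eqP; rewrite addr_eq0 => /eqP e.
by rewrite /letter_parity /odd_letter -/(oddz _) e oddzN.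
Qed.

(** Inserting l in position j evaluates the j-th factor on l and leaves the tensor of the others, as
    in the Leibniz axiom. A factor only sees letters of its own parity, so all the signs become
    functions of the parities of l, of u and of a prefix of u; the factor [sgn (lpar l)] on the
    right is the one of [bracket_form]. *)
Lemma ins_ltensor n (d : 'I_n.+1 -> int) (c : 'I_n.+1 -> {scalar V})
    (l : letter) (u : seq letter) :
  (forall i, has_degree G (d i) (lform (c i))) -> size u = n ->
  sgn (lpar l && (lpar l (+) parw u)) * ins lpar l (onl (ltensor d c)) u
  = \sum_(j < n.+1) (\prod_(i < n.+1 | (i < j)%N) degsign K (d i * d j))
      * (sgn (lpar l) * c j (lvec l))
      * onl (ltensor (fun i => d (lift j i)) (fun i => c (lift j i))) u.
Proof.
move=> dc szu; rewrite insE cutsE szu mulr_sumr; apply: eq_bigr => k _.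
rewrite /onl map_cat /= map_take map_drop ltensor_insert ?size_map //.
have [->|ck] := eqVneq (c k (lvec l)) 0.
  by rewrite mul0r mulr0 scaler0 !mulr0 mul0r.
set T := ltensor _ _ _; have [->|T0] := eqVneq T 0.
  by rewrite !mulr0 scaler0 mulr0.
have pl := lform_parity (dc k) ck.
have pu := ltensor_parity (fun i => dc (lift k i)) T0.
set v := [tuple _ | _ < _] in pu.
have parwE j : parw (take j u) = word_parity id (take j v).
  by rewrite -pu -map_take /word_parity foldr_map.
have -> : \prod_(i < n) degsign K (d (lift k i) * d k) = sgn (lpar l && parw u).
  rewrite -[u in RHS]take_size parwE -prod_signs szu.
  rewrite [RHS]big_mkcond; apply: eq_bigr => i _.
  by rewrite ltn_ord tnth_mktuple /degsign -/(oddz _) oddzM pl andbC.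
have -> : \prod_(i < n.+1 | (i < k)%N) degsign K (d i * d k)
    = sgn (lpar l && parw (take k u)).
  rewrite parwE -prod_signs big_mkcond (bigD1_ord k) //= ltnn mul1r.
  rewrite [RHS]big_mkcond; apply: eq_bigr => i _.
  have -> : (bump k i < k)%N = (i < k)%N by rewrite /bump; case: leqP; lia.
  by case: ifP => // _; rewrite tnth_mktuple /degsign -/(oddz _) oddzM pl andbC.
rewrite [X in _ * X]mulrA !mulrA; congr (_ * _ * _).
rewrite -!signr_addb; congr ((-1) ^+ nat_of_bool _).
by case: (lpar l); case: (parw u); case: (parw (take k u)).
Qed.

End BracketInsertion.

(** * The bracket as a contraction, after symmetrization *)

Section BracketFormula.

Variables (K : fieldType) (charK : [pchar K] =i pred0).
Variables (V : vectType K) (G : grading V).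
Notation letter := (letter G).
Notation vecs := (map (@lvec K V G)).
Notation degs := (map (@ldeg K V G)).
Notation lpar := (@letter_parity K V G).
Notation parw := (word_parity lpar).
Notation sgn b := ((-1) ^+ nat_of_bool b : K).
Notation hat := (@hat_form K V G).
Implicit Types (F : mform V).

Lemma swapsym_hat F : swapsym lpar (hat F).
Proof.
move=> u x y v; rewrite /hat_form (swapsym_ksym lpar (onl F) u x y v).
have -> : size (u ++ [:: x, y & v]) = size (u ++ [:: y, x & v]).
  by rewrite !size_cat.
by rewrite [LHS]mulrCA.
Qed.

Lemma hat_sum (I : Type) (r : seq I) (c : I -> K) (F : I -> mform V) F' t :
  (forall u : seq letter, size u = size t ->
     F' (vecs u) = \sum_(i <- r) c i * F i (vecs u)) ->
  hat F' t = \sum_(i <- r) c i * hat (F i) t.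
Proof.
move=> F'E; rewrite /hat_form.
have -> : ksym lpar (onl F') t = \sum_(i <- r) c i * ksym lpar (onl (F i)) t.
  transitivity (ksym lpar (fun u => \sum_(i <- r) c i *: onl (F i) u) t).
    by apply: eq_ksym => u _ szu; apply: F'E.
  by rewrite ksym_sum; apply: eq_bigr => i _; rewrite ksymZ.
by rewrite mulr_sumr; apply: eq_bigr => i _; rewrite mulrCA.
Qed.

Lemma eq_hat F F' t : (forall u : seq letter, size u = size t ->
  F (vecs u) = F' (vecs u)) -> hat F t = hat F' t.
Proof.
by move=> eqF; congr (_ * _); apply: eq_ksym => u _ szu; apply: eqF.
Qed.

Variable br : mform V -> mform V -> mform V.
Hypothesis pb : pinczon_bracket G br.
Variable b : V -> V -> K^o.
Hypotheses (qb : quadratic_form G b) (bb : bracket_form G br b).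

(* Bracketing with the linear form b (-, x) is, up to sign, the insertion of
   x. *)
Lemma hat_br_lform (l : letter) (a : {scalar V}) F t : cyclic_mform G F ->
  (forall y, a y = b y (lvec l)) ->
  hat (br (lform a) F) t = sgn (lpar l && (lpar l (+) parw t)) * hat F (l :: t).
Proof.
move=> cF ab; have [N [E [g [bE hE]]]] := homogeneous_basis G.
(* Both sides are expanded with the same coefficients along the cyclic sums of tensors of
   coordinates, on which the Leibniz axiom is compared with the insertion of l. *)
have E1 := hat_sum (F' := br (lform a) F) (t := t) (r := index_enum _)
  (c := wcoef (n := (size t).+1) E g F)
  (F := fun w => br (lform a) (cycl_form G (wtensor E g w))).
rewrite E1 => [|u szu]; last first.
  rewrite (br_lform_expand charK pb g bE _ _ cF).
  by have -> : size (vecs u) = size t by rewrite size_map.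
have E2 := hat_sum (F' := F) (t := l :: t) (r := index_enum _)
  (c := wcoef (n := (size t).+1) E g F) (F := fun w => cycl_form G (wtensor E g w)).
rewrite E2 => [|u szu]; last first.
  have -> : F (vecs u) = component (size t).+1 F (vecs u).
    by rewrite /component size_map szu eqxx.
  by rewrite (cyclic_expand charK g bE _ cF).
rewrite mulr_sumr; apply: eq_bigr => w _; rewrite [RHS]mulrCA; congr (_ * _).
set d := fun i => 1 - g (tnth w i); pose c i : {scalar V} := coord E (tnth w i).
have dc i : has_degree G (d i) (lform (c i)).
  exact: (@coord_degree _ _ _ _ _ _ bE hE).
rewrite (hat_cycl charK); last exact: multilinear_ltensor.
have E3 := hat_sum (F' := br (lform a) (cycl_form G (wtensor E g w))) (t := t)
  (r := index_enum _)
  (c := fun j : 'I_(size t).+1 => (\prod_(i < (size t).+1 | (i < j)%N) degsign K (d i * d j))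
          * (sgn (lpar l) * c j (lvec l)))
  (F := fun j => cycl_form G (ltensor (fun i => d (lift j i)) (fun i => c (lift j i)))).
rewrite E3 => [|u szu]; last first.
  rewrite (pb_linear_form pb) //; apply: eq_bigr => j _.
  by rewrite (bb _ (lvecP l) ab).
rewrite [ksym _ _ (l :: t)]/= -[RHS](ksymZ lpar (_ : K) (ins lpar l (onl (wtensor E g w))) t).
transitivity (ksym lpar (fun u => \sum_(j < (size t).+1)
  ((\prod_(i < (size t).+1 | (i < j)%N) degsign K (d i * d j))
          * (sgn (lpar l) * c j (lvec l)))
     *: onl (ltensor (fun i => d (lift j i)) (fun i => c (lift j i))) u) t).
  rewrite ksym_sum; apply: eq_bigr => j _; rewrite ksymZ.
  by rewrite (hat_cycl charK) //; apply: multilinear_ltensor.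
apply: eq_ksym => u pu szu.
by rewrite -pu; apply/esym/(ins_ltensor l dc szu).
Qed.

(** For homogeneous x, the linear form b (-, x) - b' (-, x) brackets to 0 with all linear forms,
    hence is 0. *)
Lemma bracket_form_uniq b' : quadratic_form G b' -> bracket_form G br b' -> b = b'.
Proof.
move=> qb' bb'; have bil := quadratic_bil qb; have bil' := quadratic_bil qb'.
have [N [E [g [bE hE]]]] := homogeneous_basis G.
apply: functional_extensionality => y; apply: functional_extensionality => x.
pose P x := b y x = b' y x; apply: (homogeneous_ind (G := G) (P := P)).
- by move=> c u v Pu Pv; rewrite /P (bilDr bil) (bilDr bil') Pu Pv.
- by rewrite /P (bil0r bil) (bil0r bil').
move=> d {}x xd.
have linb : scalar (b^~ x) by case: bil.
have linb' : scalar (b'^~ x) by case: bil'.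
have linD : scalar (fun y => b y x - b' y x).
  by move=> c u v; rewrite (bilDl bil) (bilDl bil') mulrBr opprD addrACA.
apply/eqP; rewrite -subr_eq0; apply/eqP.
apply: (br_lform_nondegenerate charK pb bE hE (a := scalar_of linD)) => a'.
have -> : lform (scalar_of linD)
    = fun s => -1 * lform (scalar_of linb') s + lform (scalar_of linb) s.
  apply: functional_extensionality => -[|z [|z' s]] /=; rewrite ?mulr0 ?addr0 //.
  by rewrite mulN1r addrC.
rewrite (pb_linearl pb); try exact: cyclic_lform.
have eb : br (lform (scalar_of linb)) (lform a') [::]
    = sgn (oddz (d - 1)) * a' x by apply: (bb _ xd).
by rewrite eb (bb' _ _ _ _ xd) // mulN1r addNr.
Qed.

Variables (m : nat) (dg : 'I_m -> int) (e e' : m.-tuple V).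
Hypotheses (be : basis_of fullv e) (he : forall i, tnth e i \in G (dg i)).
Hypothesis dual : forall i j, b (tnth e i) (tnth e' j) = (i == j)%:R.

Let he' := dual_homogeneous qb be he dual.
Notation el := (eletter he).
Notation el' := (eletter' he').

Lemma shbr_nil f f' : shbr he he' f f' [::]
  = \sum_(i < m) sgn (lpar (el i)) * (f [:: el i] * f' [:: el' i]).
Proof. by apply: eq_bigr => i _; rewrite /= !andbF !addbF. Qed.

(** On the empty word only the linear terms of F and F' meet, and the one of F is a combination of
    the forms b (-, e'_i), whose brackets are known. *)
Lemma hat_br_nil F F' : cyclic_mform G F -> cyclic_mform G F' ->
  hat (br F F') [::] = shbr he he' (hat F) (hat F') [::].
Proof.
move=> cF cF'; rewrite shbr_nil hat_nil (pb_terms pb) // big_ord1 subn0.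
have lformE F0 : cyclic_mform G F0 -> exists2 a : {scalar V},
    component 1 F0 = lform a & forall x, a x = F0 [:: x].
  move=> [mF0 _]; have linF : scalar (fun x => F0 [:: x]).
    by move=> c x y; apply: (mF0 [::] [::]).
  exists (scalar_of linF) => //.
  by apply: functional_extensionality => -[|x [|y s]].
have [a -> aE] := lformE F cF; have [a' -> a'E] := lformE F' cF'.
have hat1 F0 (l : letter) : hat F0 [:: l] = F0 [:: lvec l].
  by rewrite /hat_form /= invr1 mul1r.
have linb x : scalar (b^~ x) by have [_] := quadratic_bil qb; apply.
have -> : lform a = fun s => \sum_i a (tnth e i) * lform (scalar_of (linb (tnth e' i))) s.
  apply: functional_extensionality => -[|x [|y s]] /=.
  - by rewrite big1 // => i _; rewrite mulr0.
  - rewrite -{1}[x](dual_expandl qb be dual) linear_sum; apply: eq_bigr => i _.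
    by rewrite linearZ mulrC.
  by rewrite big1 // => i _; rewrite mulr0.
rewrite (br_suml pb); try (move=> *; exact: cyclic_lform).
apply: eq_bigr => i _; rewrite (bb _ (he' i)) // !hat1 -aE -a'E mulrCA.
by congr (_ * _); rewrite -(lpar_eletter' he he' i).
Qed.

(* Induction on the word: the first letter x of l :: t is inserted by bracketing
   with b (-, x), and the Jacobi identity moves it inside the bracket. *)
Lemma hat_br F F' d d' t : cyclic_mform G F -> cyclic_mform G F' ->
  has_degree G d F -> has_degree G d' F' ->
  hat (br F F') t = shbr he he' (hat F) (hat F') t.
Proof.
elim: t F F' d d' => [|l t IHt] F F' d d' cF cF' dF dF'; first exact: hat_br_nil.
have linb : scalar (b^~ (lvec l)) by have [_] := quadratic_bil qb; apply.
pose a := scalar_of linb; pose p := lpar l.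
have ca := cyclic_lform G a.
(* The form b (-, x) only sees letters of degree - [ldeg l] in V, that is of degree - [ldeg l] - 1
   in V[1]. *)
have da : has_degree G (1 + ldeg l) (lform a).
  move=> ds s /hword_letters[u -> ->]; case: u => [|k [|k' u]] /=; rewrite ?eqxx //.
  case: qb => _ bdeg _ _ /(bdeg _ _ _ _ (lvecP k) (lvecP l)) kl.
  by rewrite /wdeg big_seq1; lia.
have pa : oddz (1 + ldeg l) = p.
  by rewrite /p /letter_parity /odd_letter -/(oddz _) !oddzD addbC.
have key F0 u : cyclic_mform G F0 ->
    hat (br (lform a) F0) u = sgn (p && (p (+) parw u)) * hat F0 (l :: u).
  by move=> cF0; apply: hat_br_lform.
have cFF' := br_closed pb cF cF'.
have caF := br_closed pb ca cF; have caF' := br_closed pb ca cF'.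
rewrite -[LHS](signrMK (p && (p (+) parw t))) -key //.
have -> : hat (br (lform a) (br F F')) t = hat (br (br (lform a) F) F') t
    + degsign K ((1 + ldeg l) * d) * hat (br F (br (lform a) F')) t.
  have E1 := hat_sum (F' := br (lform a) (br F F')) (t := t) (r := index_enum _)
    (c := fun i : bool => if i then 1 else degsign K ((1 + ldeg l) * d))
    (F := fun i => if i then br (br (lform a) F) F' else br F (br (lform a) F')).
  rewrite E1 ?big_bool ?mul1r // => u _.
  by rewrite big_bool mul1r; apply: (pb_jacobi pb ca cF cF' da dF dF').
have daF := pb_degree pb ca cF da dF; have daF' := pb_degree pb ca cF' da dF'.
rewrite (IHt _ _ _ _ caF cF' daF dF') (IHt _ _ _ _ cF caF' dF daF').
rewrite mulrDr !mulr_sumr -big_split; apply: eq_bigr => i _.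
rewrite -[X in X + _ = _](shsumZ lpar (_ : K)) mulrA -[X in _ + X = _](shsumZ lpar (_ : K)).
have assoc (A B C D X Y : K) : A * (B * (C * (D * X) * Y)) = A * B * C * D * (X * Y).
  by rewrite !mulrA.
have assoc' (A B C D X Y : K) : A * (B * (X * (C * (D * Y)))) = A * B * C * D * (X * Y).
  by rewrite (mulrCA X C) (mulrCA X D) !mulrA.
(* The first Jacobi term gives the splittings of l :: t with l in I, the second those with l in
   J. *)
congr (_ + _); apply: eq_shsum => I J pIJ _.
  rewrite (key _ _ cF).
  have := swapsym_hat F [::] l (el i) I; rewrite /= -/p => ->.
  etransitivity; first exact: assoc.
  rewrite -!signr_addb; congr (_ ^+ nat_of_bool _ * _); rewrite -pIJ /= -/p.
  by case: (p); case: (lpar (el i)); case: (parw I); case: (parw J).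
have [->|/(hat_degree dF) /= pF] := eqVneq (hat F (el i :: I)) 0.
  by rewrite !mul0r !scaler0.
rewrite (key _ _ cF').
have := swapsym_hat F' [::] l (el' i) J; rewrite /= -/p => ->.
etransitivity; first exact: assoc'.
rewrite /degsign -/(oddz _) oddzM pa -pF (lpar_eletter' he he' i).
apply/esym; etransitivity; first exact: mulrA.
rewrite -!signr_addb; congr (_ ^+ nat_of_bool _ * _); rewrite -pIJ /=.
by rewrite -/p; case: (p); case: (lpar (el i)); case: (parw I); case: (parw J).
Qed.

End BracketFormula.

(** * Equivalence of the two ways of attaching b to the bracket *)

Section Associated.

Variables (K : fieldType) (charK : [pchar K] =i pred0).
Variables (V : vectType K) (G : grading V).
Notation vecs := (map (@lvec K V G)).
Notation hat := (@hat_form K V G).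
Notation sgn b := ((-1) ^+ nat_of_bool b : K).
Variable br : mform V -> mform V -> mform V.
Hypothesis pb : pinczon_bracket G br.
Variable b : V -> V -> K^o.
Hypothesis qb : quadratic_form G b.

Lemma bracket_form_associated : bracket_form G br b -> associated G br b.
Proof.
move=> bb m dg e e' be he dual d d' F F' cF cF' dF dF'.
have he' := dual_homogeneous qb be he dual.
apply: (hat_ext charK) => [||t]; first exact: (br_closed pb cF cF').1.
  by apply/multilinear_cycl_form/multilinear_contraction; [apply: cF.1|apply: cF'.1].
rewrite (hat_br charK pb qb bb be he dual t cF cF' dF dF').
by rewrite (hat_contraction charK he (dual_homogeneous qb be he dual) _ cF cF').
Qed.

Lemma associated_hat_br m (dg : 'I_m -> int) (e e' : m.-tuple V)
    (be : basis_of fullv e) (he : forall i, tnth e i \in G (dg i))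
    (he' : forall i, tnth e' i \in G (- dg i))
    (dual : forall i j, b (tnth e i) (tnth e' j) = (i == j)%:R)
    d d' F F' t : associated G br b -> cyclic_mform G F -> cyclic_mform G F' ->
  has_degree G d F -> has_degree G d' F' ->
  hat (br F F') t = shbr he he' (hat F) (hat F') t.
Proof.
move=> ab cF cF' dF dF'; rewrite -(hat_contraction charK _ _ _ cF cF' dF dF').
have m1 := (br_closed pb cF cF').1.
have m2 := multilinear_cycl_form G
  (multilinear_contraction dg (tnth e) (tnth e') d d' cF.1 cF'.1).
have := ab m dg e e' be he dual d d' F F' cF cF' dF dF' (vecs t).
rewrite (sym_form_hat charK _ m1) (sym_form_hat charK _ m2).
by apply: mulfI; apply: maxn1_neq0.
Qed.

(** The bracket of linear forms is a scalar on the empty word, which Sym does not change, so the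
    contraction formula gives it exactly. The formula needs a degree, hence the passage through the
    coordinates of a'. *)
Lemma associated_bracket_form : associated G br b -> bracket_form G br b.
Proof.
move=> ab d x a a' xd abx.
have [m [e [dg [be he]]]] := homogeneous_basis G.
have [e' dual] := dual_basis_exists qb be.
pose he' := dual_homogeneous qb be he dual.
have ca c := cyclic_lform G c.
have da : has_degree G (1 + d) (lform a).
  move=> ds s /hword_letters[u -> ->]; case: u => [|k [|k' u]] /=; rewrite ?eqxx //.
  rewrite abx; case: qb => _ bdeg _ _ /(bdeg _ _ _ _ (lvecP k) xd) kd.
  by rewrite /wdeg big_seq1; lia.
have coordE j : br (lform a) (lform (coord e j)) [::] = sgn (oddz (d - 1)) * coord e j x.
  rewrite -(hat_nil G (br _ _)).
  rewrite (associated_hat_br be he he' dual [::] ab (ca a) (ca _) da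
    (@coord_degree _ _ _ _ _ _ be he j)).
  rewrite shbr_nil -[in RHS](dual_expandr qb be dual x) linear_sum mulr_sumr.
  apply: eq_bigr => i _; rewrite linearZ.
  have hat1 (c : {scalar V}) (l : letter G) : hat (lform c) [:: l] = c (lvec l).
    by rewrite /hat_form /= invr1 mul1r.
  rewrite !hat1 /= abx.
  have [->|] := eqVneq (b (tnth e i) x) 0; first by rewrite !mul0r !mulr0.
  case: qb => _ bdeg _ _ /(bdeg _ _ _ _ (he i) xd) id0.
  congr (_ ^+ nat_of_bool _ * _); rewrite /letter_parity /odd_letter -/(oddz _) /=.
  have -> : d = - dg i by lia.
  by rewrite !oddzD oddzN.
have lformE : lform a' = fun s => \sum_i a' (tnth e i) * lform (coord e i) s.
  apply: functional_extensionality => -[|y [|z s]] /=.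
  - by rewrite big1 // => i _; rewrite mulr0.
  - exact: (scalar_coord be a' y).
  by rewrite big1 // => i _; rewrite mulr0.
rewrite lformE (br_sumr pb) //; under eq_bigr do rewrite coordE.
rewrite (scalar_coord be a' x) mulr_sumr; apply: eq_bigr => i _.
exact: mulrCA.
Qed.

End Associated.

(** * Symplectic forms and the forms of coderivations *)

Section Symplectic.

Variables (K : fieldType) (V : vectType K) (G : grading V).
Notation letter := (letter G).
Notation vecs := (map (@lvec K V G)).
Notation degs := (map (@ldeg K V G)).
Notation lpar := (@letter_parity K V G).
Notation parw := (word_parity lpar).
Notation sgn b := ((-1) ^+ nat_of_bool b : K).
Variable b : V -> V -> K^o.
Hypothesis qb : quadratic_form G b.
Notation B := (symplectic_of G b).

Lemma symplectic_hom d x y : x \in G d -> B x y = sgn (odd_letter d) * b x y.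
Proof.
move=> xd; rewrite /symplectic_of !(parity_part_hom _ xd).
have bil := quadratic_bil qb.
case: (odd_letter d) => /=; rewrite (bil0l bil).
  by rewrite sub0r mulN1r.
by rewrite subr0 mul1r.
Qed.

Lemma symplectic_bil : bilinear_map B.
Proof.
have bil := quadratic_bil qb; split=> x c u v; rewrite /symplectic_of.
  by rewrite !(bilDr bil) mulrBr opprD addrACA.
by rewrite !parity_partP !(bilDl bil) mulrBr opprD addrACA.
Qed.

Lemma symplectic_antisym i j x y : x \in G i -> y \in G j ->
  B y x = - (degsign K ((i - 1) * (j - 1)) * B x y).
Proof.
move=> xi yj; rewrite (symplectic_hom _ xi) (symplectic_hom _ yj).
rewrite (quadratic_sym qb y xi).
have [->|] := eqVneq (b x y) 0; first by rewrite !mulr0 oppr0.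
case: qb => _ bdeg _ _ /(bdeg _ _ _ _ xi yj)/eqP.
rewrite addr_eq0 => /eqP ->; rewrite !mulrA -mulNr; congr (_ * _).
rewrite /degsign -/(oddz _) oddzM /odd_letter -!/(oddz _) -signr_addb -signr_addb -signrN.
rewrite !oddzD !oddzN /=.
by case: (oddz j).
Qed.

(** B (x, -) is b (theta x, -) for the parity involution theta, which acts by a sign on each
    homogeneous component and is therefore injective. *)
Lemma symplectic_nondegenerate : left_nondegenerate B.
Proof.
move=> x x0; have bil := quadratic_bil qb.
have theta0 : parity_part G false x - parity_part G true x = 0.
  case: qb => _ _ _; apply => y; rewrite -[RHS](x0 y) /symplectic_of.
  by rewrite -scaleN1r addrC (bilDl bil) mulN1r addrC.
have projE d p : gproj G d (parity_part G p x)
    = if odd_letter d == p then gproj G d x else 0.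
  apply: (homogeneous_ind (G := G)
    (P := fun x => gproj G d (parity_part G p x)
       = if odd_letter d == p then gproj G d x else 0)) => [a u v Pu Pv||j u uj].
  - rewrite parity_partP !gprojP Pu Pv.
    by case: ifP => _; rewrite ?scaler0 ?addr0.
  - have := parity_partP G p (-1) 0 0; rewrite scaler0 addr0 => ->.
    by rewrite scaleN1r addNr /gproj !linear0 if_same.
  rewrite (parity_part_hom _ uj) (gproj_hom _ uj).
  have [->|dj] := eqVneq d j; case: ifP => _.
  - by rewrite (gproj_hom _ uj) eqxx.
  - by rewrite /gproj linear0.
  - by rewrite (gproj_hom _ uj) (negPf dj) if_same.
  by rewrite /gproj linear0 if_same.
rewrite -(sum_gproj G x) big1 // => d _.
have : gproj G d (parity_part G false x - parity_part G true x) = 0.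
  by rewrite theta0 /gproj linear0.
rewrite -scaleN1r addrC gprojP !projE.
case: (odd_letter d) => /=; rewrite ?scaler0 ?addr0 ?add0r // => /eqP.
by rewrite scaleN1r oppr_eq0 => /eqP.
Qed.

Lemma symplectic_of_symplectic : symplectic_form G B.
Proof.
split; [exact: symplectic_bil| |exact: symplectic_nondegenerate].
by move=> i j x y xi yj; apply: symplectic_antisym.
Qed.

End Symplectic.

(** * Forms and coderivations correspond through B *)

Section PinczonToCoderivation.

Variables (K : fieldType) (charK : [pchar K] =i pred0).
Variables (V : vectType K) (G : grading V).
Notation letter := (letter G).
Notation vecs := (map (@lvec K V G)).
Notation degs := (map (@ldeg K V G)).
Notation lpar := (@letter_parity K V G).
Notation tensor := (tensor K V).
Notation sgn b := ((-1) ^+ nat_of_bool b : K).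
Variable b : V -> V -> K^o.
Hypothesis qb : quadratic_form G b.
Notation B := (symplectic_of G b).

Lemma form_of_rcons (Q : seq V -> tensor) s y :
  form_of B Q (rcons s y) = B (taylor Q s) y.
Proof. by case: s => [|x s] //=; rewrite belast_rcons last_rcons. Qed.

Lemma fact_neq0 n : (n`!%:R : K) != 0.
Proof. by have /pcharf0P -> := charK; rewrite -lt0n fact_gt0. Qed.

Lemma form_of_coderivation_exists (W : mform V) : symmetric_mform G W ->
  has_degree G 3 W -> (forall s, (size s < 2)%N -> W s = 0) ->
  exists2 Q, coderivation G Q & W = form_of B Q.
Proof.
move=> [mW /(koszul_symmetricP G mW) sW] dW W2.
have [m [e [dg [be he]]]] := homogeneous_basis G.
have [e' dual] := dual_basis_exists qb be.
have he' := dual_homogeneous qb be he dual.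
(* The vector defined by B (q1 s, y) = W (s, y): y is expanded along the e'_j with coefficients b
   (e_j, y), and the sign relates b to B at e_j. *)
pose q1 s := \sum_j (sgn (odd_letter (dg j)) * W (rcons s (tnth e' j))) *: tnth e j.
have Bq1 s y : B (q1 s) y = W (rcons s y).
  rewrite (bil_suml (symplectic_bil qb)).
  rewrite -[y in RHS](dual_expandr qb be dual) -cats1 (multilinear_sum s [::] _ _ _ mW).
  apply: eq_bigr => j _; rewrite (symplectic_hom qb _ (he j)).
  rewrite mulrACA -signr_addb addbb mul1r mulrC.
  have := mW s [::] (b (tnth e j) y) (tnth e' j) 0; rewrite addr0 => ->.
  rewrite (multilinear0 (s := s ++ [:: 0]) mW) ?mem_cat ?mem_head ?orbT //.
  by rewrite addr0 cats1.
(* The factor n! compensates the division in [taylor]. *)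
pose q s := ((size s)`!%:R : K) *: q1 s.
have mq : multilinear q.
  move=> s1 s2 c x y; rewrite /q !size_cat /= scalerA mulrC -scalerA -scalerDr.
  congr (_ *: _); rewrite /q1 scaler_sumr -big_split; apply: eq_bigr => j _ /=.
  rewrite !rcons_cat /= mW scalerA -scalerDl; congr (_ *: _).
  by rewrite mulrDr mulrCA.
have sq : swapsym lpar (onl q).
  move=> u x y v; rewrite /onl /q !map_cat /= !size_cat /= scalerA mulrC -scalerA.
  congr (_ *: _); rewrite /q1 scaler_sumr; apply: eq_bigr => j _.
  rewrite scalerA; congr (_ *: _); rewrite mulrCA; congr (_ * _).
  rewrite !rcons_cat /=; pose l := Letter (he' j).
  have := sW u x y (rcons v l); rewrite /onl !map_cat /= map_rcons => ->.
  by [].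
have dq t : q (vecs t) \in G (wdeg (degs t) + 2).
  rewrite memvZ // memv_suml // => j _; pose l : letter := Letter (he' j).
  have [->|Wj] := eqVneq (W (rcons (vecs t) (tnth e' j))) 0.
    by rewrite mulr0 scale0r mem0v.
  rewrite memvZ //; have := dW _ _ (letters_hword (rcons t l)).
  rewrite map_rcons => /(_ Wj); rewrite map_rcons -cats1 wdeg_cat.
  rewrite {2}/wdeg big_seq1 /= => dj.
  (* W has degree 3 and e'_j has degree - dg j - 1 in V[1], so the degree of t is dg j + 1 - 3. *)
  have <- : dg j = wdeg (degs t) + 2 by lia.
  exact: he.
(* W has no term of arity 1; accordingly a coderivation vanishes on the empty word. *)
have q0 : q [::] = 0.
  by rewrite /q /q1 big1 ?scaler0 // => j _; rewrite W2 // mulr0 scale0r.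
have cQ := coderivation_coder_of mq sq dq.
exists (coder_of dq); first by exists 1.
have corE s : corestriction (coder_of dq) s = q s.
  apply: (multilinear_ext (G := G)) s => [s1 s2 c x y||t] //.
    case: cQ => mQ _ _ _ _; rewrite /corestriction mQ; exact: degree1_partP.
  case: t => [|l t]; last exact: degree1_part_coder_of.
  case: cQ => _ _ Q0 _ _; rewrite /= q0 /corestriction Q0.
  by rewrite big1 // => i _; rewrite mcoeff0 scale0r.
apply: functional_extensionality => s; case: (lastP s) => [|{}s y].
  by rewrite W2.
rewrite form_of_rcons /taylor corE /q scalerA mulVf ?fact_neq0 // scale1r.
by rewrite Bq1.
Qed.

(** Nondegeneracy of B recovers the Taylor coefficients from the form, and inverting n! the
    corestriction, which determines the coderivation. *)
Lemma form_of_inj Q Q' : coderivation G Q -> coderivation G Q' ->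
  form_of B Q =1 form_of B Q' -> Q = Q'.
Proof.
move=> cQ cQ' QQ'; have bil := symplectic_bil qb.
have tE s : taylor Q s = taylor Q' s.
  apply/eqP; rewrite -subr_eq0; apply/eqP.
  apply: (symplectic_nondegenerate qb) => y.
  rewrite addrC -scaleN1r (bilDl bil) mulN1r -!form_of_rcons QQ'.
  exact: addNr.
have cE s : corestriction Q s = corestriction Q' s.
  by have := tE s; rewrite /taylor => /(scalerI _); apply; rewrite invr_eq0 fact_neq0.
apply: functional_extensionality; apply: (multilinear_ext (G := G)).
- by case: cQ => d [].
- by case: cQ' => d [].
by apply: coderivation_ext => // t _; apply: cE.
Qed.

End PinczonToCoderivation.

(** * The induced bracket and the master equation *)

Section InducedBracket.

Variables (K : fieldType) (charK : [pchar K] =i pred0).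
Variables (V : vectType K) (G : grading V).
Notation letter := (letter G).
Notation vecs := (map (@lvec K V G)).
Notation lpar := (@letter_parity K V G).
Notation hat := (@hat_form K V G).
Variable br : mform V -> mform V -> mform V.
Hypothesis pb : pinczon_bracket G br.
Variable b : V -> V -> K^o.
Hypotheses (qb : quadratic_form G b) (ab : associated G br b).
Variables (m : nat) (dg : 'I_m -> int) (e e' : m.-tuple V).
Hypotheses (be : basis_of fullv e) (he : forall i, tnth e i \in G (dg i)).
Hypothesis he' : forall i, tnth e' i \in G (- dg i).
Hypothesis dual : forall i j, b (tnth e i) (tnth e' j) = (i == j)%:R.

(** Removes the homogeneity of [associated_hat_br], since the induced bracket involves all cyclic
    forms: each term of F and F' is a combination of cyclic sums of tensors of coordinates, which
    have degrees, and both sides are bilinear. *)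
Lemma hat_br_general F F' t : cyclic_mform G F -> cyclic_mform G F' ->
  hat (br F F') t = shbr he he' (hat F) (hat F') t.
Proof.
move=> cF cF'; pose wt n (w : n.-tuple 'I_m) := cycl_form G (wtensor e dg w).
have cw n (w : n.-tuple 'I_m) : cyclic_mform G (wt n w).
  exact/cyclic_cycl_form/multilinear_ltensor.
have dw n (w : n.-tuple 'I_m) :
    has_degree G (\sum_(i < n) (1 - dg (tnth w i))) (wt n w).
  apply: has_degree_cycl; first exact: multilinear_ltensor.
  exact: has_degree_wtensor.
have assoc (c c' s h h' : K) : s * ((c * h) * (c' * h')) = c * (c' * (s * (h * h'))).
  by rewrite [X in s * X]mulrACA [LHS]mulrA (mulrC s (c * c')) -!mulrA.
pose cf n F0 w := wcoef (n := n) e dg F0 w.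
have hatE n F0 u : cyclic_mform G F0 ->
    hat (component n F0) u = \sum_w cf n F0 w * hat (wt n w) u.
  move=> cF0; apply: hat_sum => v _.
  by rewrite (cyclic_expand charK dg be n cF0).
have comps n n' : hat (br (component n F) (component n' F')) t
    = shbr he he' (hat (component n F)) (hat (component n' F')) t.
  transitivity (\sum_w cf n F w * \sum_w' cf n' F' w' * hat (br (wt n w) (wt n' w')) t).
    have cc := cyclic_component n' cF'.
    rewrite (hat_sum (r := index_enum _) (c := cf n F)
      (F := fun w => br (wt n w) (component n' F'))) => [|u _]; last first.
      rewrite (cyclic_expand charK dg be n cF).
      exact: (br_suml pb _ (cf n F) _ cc (cw n)).
    apply: eq_bigr => w _; congr (_ * _).
    apply: (hat_sum (F := fun w' => br (wt n w) (wt n' w'))) => u _.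
    rewrite (cyclic_expand charK dg be n' cF').
    exact: (br_sumr pb _ (cf n' F') _ (cw n w) (cw n')).
  under eq_bigr do under eq_bigr do
    rewrite (associated_hat_br charK pb be he he' dual t ab (cw _ _) (cw _ _) (dw _ _) (dw _ _)).
  rewrite /shbr; under eq_bigr do under eq_bigr do rewrite mulr_sumr.
  under eq_bigr do rewrite exchange_big mulr_sumr.
  rewrite exchange_big; apply: eq_bigr => i _ /=.
  transitivity (\sum_w \sum_w' shsum lpar (fun I J => cf n F w *: (cf n' F' w' *:
     ((-1) ^+ nat_of_bool (lpar (eletter he i) (+) lpar (eletter he i) && word_parity lpar J
        (+) word_parity lpar I && word_parity lpar J) *:
     (hat (wt n w) (eletter he i :: I) * hat (wt n' w') (eletter' he' i :: J) : K^o)))) t).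
    apply: eq_bigr => w _; rewrite mulr_sumr; apply: eq_bigr => w' _.
    by rewrite !shsumZ.
  under eq_bigr do rewrite -shsum_sum.
  rewrite -shsum_sum; apply: eq_shsum => I J _ _.
  rewrite !hatE // mulr_suml scaler_sumr; apply: eq_bigr => w _.
  rewrite mulr_sumr scaler_sumr; apply: eq_bigr => w' _.
  exact/esym/assoc.
(* By [pb_terms] the arities k + 1 and n - k + 1 meet on n letters; in [shbr] the index k is the
   length of I. *)
pose n := size t.
rewrite (hat_sum (r := index_enum _) (c := fun=> 1)
  (F := fun k : 'I_n.+1 => br (component k.+1 F) (component (n - k).+1 F'))); last first.
  move=> u szu; rewrite (pb_terms pb) // size_map szu.
  by apply: eq_bigr => k _; rewrite mul1r.
under eq_bigr do rewrite mul1r comps.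
rewrite /shbr exchange_big; apply: eq_bigr => i _ /=.
etransitivity.
  exact: (esym (@shsum_sum K letter lpar K^o _ (index_enum _) xpredT _ t)).
apply: eq_shsum => I J _ sIJ.
rewrite -scaler_sumr; congr (_ *: _).
have hat_comp k F0 u : hat (component k F0) u = if size u == k then hat F0 u else 0.
  case: eqP => [szu|/eqP szu].
    by apply: eq_hat => v szv; rewrite /component size_map szv szu eqxx.
  rewrite /hat_form (_ : ksym _ _ u = 0) ?mulr0 // -[RHS](ksym0 lpar K^o u).
  apply: eq_ksym => v _ szv.
  by rewrite /onl /component size_map szv (negPf szu).
have ltI : (size I < n.+1)%N by rewrite ltnS /n -sIJ leq_addr.
have nI : (n - size I)%N = size J by rewrite /n -sIJ addKn.
rewrite (bigD1 (Ordinal ltI)) //= !hat_comp /= nI !eqxx.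
rewrite big1 ?addr0 // => k /negPf ne; rewrite hat_comp /= eqSS.
case: eqP => [Ik|_]; last by rewrite mul0r.
by case/eqP: ne; apply: val_inj.
Qed.

End InducedBracket.

(** * Existence of the bracket induced on symmetric forms *)

Section InducedBracketExists.

Variables (K : fieldType) (charK : [pchar K] =i pred0).
Variables (V : vectType K) (G : grading V).
Notation letter := (letter G).
Notation vecs := (map (@lvec K V G)).
Notation lpar := (@letter_parity K V G).
Notation hat := (@hat_form K V G).

(** A section of Sym: the symmetric representative of the class A. *)
Definition sym_normalize (A : mform V) : mform V := fun s => (size s)`!%:R^-1 * A s.

Lemma symmetric_normalize A : symmetric_mform G A -> symmetric_mform G (sym_normalize A).
Proof.
move=> [mA /(koszul_symmetricP G mA) sA].
have mN : multilinear (sym_normalize A).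
  move=> s1 s2 a x y; rewrite /sym_normalize !size_cat /= mA mulrDr.
  by congr (_ + _); apply: mulrCA.
split=> //; apply/koszul_symmetricP => // u x y v.
rewrite /onl /sym_normalize !map_cat /= !size_cat /=.
have := sA u x y v; rewrite /onl !map_cat /= => ->.
exact: mulrCA.
Qed.

Lemma sym_form_symmetric A : symmetric_mform G A ->
  sym_form G A =1 (fun s => (size s)`!%:R * A s).
Proof.
move=> [mA /(koszul_symmetricP G mA) sA].
apply: (multilinear_ext (G := G)) => [|s1 s2 a x y|t].
- exact: multilinear_sym_form.
- by rewrite !size_cat /= mA mulrDr; congr (_ + _); apply: mulrCA.
rewrite -[LHS]/(onl (sym_form G A) t) onl_sym_form // ksym_swapsym //.
by rewrite size_map.
Qed.

Lemma sym_form_normalize A : symmetric_mform G A ->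
  sym_form G (sym_normalize A) = A.
Proof.
move=> sA; apply: functional_extensionality => s.
rewrite (sym_form_symmetric (symmetric_normalize sA)) /sym_normalize.
by rewrite mulrA divff ?mul1r // fact_neq0.
Qed.

Lemma hat_normalize F t : multilinear F ->
  hat (sym_normalize (sym_form G F)) t = hat F t.
Proof.
move=> mF; have sS := symmetric_sym_form G mF; have [mS _] := sS.
have [mN _] := symmetric_normalize sS.
have := sym_form_hat charK t mN; have := sym_form_hat charK t mF.
rewrite sym_form_normalize // => -> eqN.
exact/esym/(mulfI (maxn1_neq0 charK (size t)) eqN).
Qed.

Lemma hat_symmetric A t : symmetric_mform G A ->
  (maxn (size t) 1)%:R * hat A t = (size t)`!%:R * A (vecs t).
Proof.
move=> sA; rewrite -sym_form_hat //; last by case: sA.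
by rewrite (sym_form_symmetric sA) size_map.
Qed.

Variable br : mform V -> mform V -> mform V.
Hypothesis pb : pinczon_bracket G br.
Variable b : V -> V -> K^o.
Hypotheses (qb : quadratic_form G b) (ab : associated G br b).

(** The symmetrized bracket is expressed by [shbr], which only involves the symmetrizations of the
    arguments: the kernel of Sym is an ideal, and the induced bracket is well defined. *)
Lemma sym_br_ext F F' F1 F1' : cyclic_mform G F -> cyclic_mform G F' ->
  cyclic_mform G F1 -> cyclic_mform G F1' ->
  hat F =1 hat F1 -> hat F' =1 hat F1' ->
  sym_form G (br F F') =1 sym_form G (br F1 F1').
Proof.
move=> cF cF' cF1 cF1' eF eF'.
have [m [e [dg [be he]]]] := homogeneous_basis G.
have [e' dual] := dual_basis_exists qb be.
have he' := dual_homogeneous qb be he dual.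
apply: (hat_ext charK) => [||t].
- exact: (br_closed pb cF cF').1.
- exact: (br_closed pb cF1 cF1').1.
rewrite !(hat_br_general charK pb ab be he he' dual) //.
apply: eq_bigr => i _; apply: eq_shsum => I J _ _.
by rewrite eF eF'.
Qed.

Definition sym_br (A A' : mform V) : mform V :=
  sym_form G (br (sym_normalize A) (sym_normalize A')).

Lemma sym_br_induced : induced_bracket G br sym_br.
Proof.
move=> F F' cF cF'; have [[mF _] [mF' _]] := (cF, cF').
apply: sym_br_ext => //; try exact/symmetric_cyclic/symmetric_normalize/symmetric_sym_form.
  by move=> t; apply: hat_normalize.
by move=> t; apply: hat_normalize.
Qed.

End InducedBracketExists.

(** * The form of an L-infinity structure satisfies the master equation *)

Section MasterEquation.

Variables (K : fieldType) (charK : [pchar K] =i pred0).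
Variables (V : vectType K) (G : grading V).
Notation letter := (letter G).
Notation vecs := (map (@lvec K V G)).
Notation degs := (map (@ldeg K V G)).
Notation lpar := (@letter_parity K V G).
Notation parw := (word_parity lpar).
Notation hat := (@hat_form K V G).
Notation sgn b := ((-1) ^+ nat_of_bool b : K).
Variable b : V -> V -> K^o.
Hypothesis qb : quadratic_form G b.
Notation B := (symplectic_of G b).
Variable Q : seq V -> tensor K V.
Hypotheses (LQ : Linfty G Q) (BQ : B_quadratic G B Q).

Notation q := (corestriction Q).
Notation W := (form_of B Q).

Lemma multilinear_q : multilinear q.
Proof.
case: LQ => -[mQ _ _ _ _] _ s1 s2 a x y.
rewrite /corestriction mQ; exact: degree1_partP.
Qed.

Lemma q_degree t : q (vecs t) \in G (wdeg (degs t) + 2).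
Proof.
case: LQ => -[_ _ Q0 QS _] _; case: t => [|l t].
  rewrite /= /corestriction Q0 big1 ?mem0v // => i _.
  by rewrite mcoeff0 scale0r.
have := in_Splus_degree1 (QS _ _ (letters_hword (l :: t)) isT).
by rewrite -addrA.
Qed.

Lemma swapsym_q : swapsym lpar (onl q).
Proof.
case: LQ => -[mQ symQ _ _ _] _ u x y v.
have /(koszul_symmetricP G mQ) sQ := symQ.
have := sQ u x y v; rewrite /onl => e; rewrite /corestriction e.
have := degree1_partP (sgn (lpar x && lpar y)) (Q (vecs (u ++ [:: y, x & v]))) 0.
rewrite addr0 /degree1_part => ->.
rewrite [X in _ + X]big1 ?addr0 // => i _.
by rewrite mcoeff0 scale0r.
Qed.

Lemma W_rcons s y : W (rcons s y) = (size s)`!%:R^-1 * B (q s) y.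
Proof.
rewrite form_of_rcons /taylor.
have bil := symplectic_bil qb.
by have := bilDl bil y (size s)`!%:R^-1 (q s) 0; rewrite addr0 => ->;
  rewrite (bil0l bil) addr0.
Qed.

Lemma multilinear_W : multilinear W.
Proof.
have bil := symplectic_bil qb.
move=> s1 s2 a x y; case: (lastP s2) => [|{}s2 z].
  by rewrite !cats1 !W_rcons (bilDr bil) mulrDr; congr (_ + _); apply: mulrCA.
rewrite -!rcons_cons -!rcons_cat !W_rcons !size_cat /= multilinear_q (bilDl bil).
by rewrite mulrDr; congr (_ + _); apply: mulrCA.
Qed.

(** The coderivation gives the symmetry in all letters but the last, and B-quadraticity the
    cyclicity. *)
Lemma swapsym_W : swapsym lpar (onl W).
Proof.
have bil := symplectic_bil qb.
have cW : cycsym lpar (onl W) by apply/(koszul_cyclicP G multilinear_W).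
apply: cycsym_swapsym => // u x y v z.
rewrite -!rcons_cons -!rcons_cat /onl !map_rcons !W_rcons !size_map !size_cat /=.
rewrite -[q _]/(onl q _) swapsym_q.
have := bilDl bil (lvec z) (sgn (lpar x && lpar y)) (q (vecs (u ++ [:: y, x & v]))) 0.
rewrite addr0 => ->; rewrite (bil0l bil) addr0.
exact: mulrCA.
Qed.

Lemma symmetric_W : symmetric_mform G W.
Proof.
split; first exact: multilinear_W.
apply/koszul_symmetricP; [exact: multilinear_W | exact: swapsym_W].
Qed.

Lemma W_small s : (size s < 2)%N -> W s = 0.
Proof.
case: LQ => -[_ _ Q0 _ _] _; case: s => [|x [|y s]] //= _.
have := W_rcons [::] x; rewrite /= => ->.
have -> : q [::] = 0.
  by rewrite /corestriction Q0 big1 // => i _; rewrite mcoeff0 scale0r.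
by rewrite (bil0l (symplectic_bil qb)) mulr0.
Qed.

Lemma degree_W : has_degree G 3 W.
Proof.
move=> ds s /hword_letters[t -> ->]; case: (lastP t) => [|{}t l].
  by rewrite eqxx.
rewrite map_rcons W_rcons (symplectic_hom qb _ (q_degree t)).
rewrite mulf_eq0 negb_or mulf_eq0 negb_or => /andP[_ /andP[_]].
case: qb => _ bdeg _ _ /(bdeg _ _ _ _ (q_degree t) (lvecP l)).
rewrite map_rcons -cats1 wdeg_cat {3}/wdeg big_seq1; lia.
Qed.

(** On n + 1 letters, (n + 1)! / (n + 1) from [hat_form] cancels 1 / n! from [taylor], so no factor
    remains. *)
Lemma hat_W_rcons t l : hat W (rcons t l) = B (q (vecs t)) (lvec l).
Proof.
apply: (mulfI (maxn1_neq0 charK (size (rcons t l)))).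
rewrite (hat_symmetric charK _ symmetric_W) map_rcons W_rcons size_rcons size_map.
rewrite (maxn_idPl _) // factS natrM -mulrA; congr (_ * _).
by rewrite mulrA divff ?mul1r // fact_neq0.
Qed.

Lemma hat_W_cons l t : hat W (l :: t)
  = sgn (lpar l && parw t) * B (q (vecs t)) (lvec l).
Proof.
rewrite -hat_W_rcons.
have := swapsym_cyc (@swapsym_hat K V G W) t l => ->.
exact/esym/sgnK.
Qed.

Notation ql := (qletter q_degree).

(* {W, W} is the sum over the shuffles (I, J) of W (q x_I, x_J). The terms of
   (I, J) and (J, I) agree, so that it is twice the sum of the terms in which J
   contains the first letter x, that is B ([Q, Q] (...), x) up to a factor. *)
Lemma shbr_W m (dg : 'I_m -> int) (e e' : m.-tuple V)
    (be : basis_of fullv e) (he : forall i, tnth e i \in G (dg i))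
    (he' : forall i, tnth e' i \in G (- dg i))
    (dual : forall i j, b (tnth e i) (tnth e' j) = (i == j)%:R) t :
  shbr he he' (hat W) (hat W) t = 0.
Proof.
have bil := quadratic_bil qb; have bilB := symplectic_bil qb.
have hW2 (u : seq letter) : (size u < 2)%N -> hat W u = 0.
  move=> su; rewrite /hat_form (_ : ksym _ _ u = 0) ?mulr0 //.
  rewrite -[RHS](ksym0 lpar K^o u); apply: eq_ksym => v _ sv.
  by rewrite /onl W_small // size_map sv.
have lpar_ql u : lpar (ql u) = ~~ parw u by apply: lpar_qletter.
have oddq u : oddz (wdeg (degs u) + 2 - 1) = ~~ parw u by rewrite -lpar_ql.
pose h I J : K^o := hat W (ql I :: J).
(* By [hat_W_cons], h I J is B (q x_J, q x_I) up to sign, so this is the antisymmetry of B. *)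
have hC I J : h J I = sgn (parw I && parw J) * h I J.
  rewrite /h !hat_W_cons !lpar_ql.
  rewrite (symplectic_antisym qb (q_degree J) (q_degree I)) mulrN.
  rewrite /degsign -/(oddz _) oddzM !oddq !mulrA -mulNr; congr (_ * _).
  rewrite -!signr_addb -signrN; congr (_ ^+ nat_of_bool _).
  by case: (parw I); case: (parw J).
case: t => [|x s].
  by rewrite /shbr big1 // => i _ /=; rewrite hW2 // mul0r scaler0.
have -> : shbr he he' (hat W) (hat W) (x :: s) = shsum lpar h (x :: s).
  rewrite /shbr.
  etransitivity.
    exact: (esym (@shsum_sum K letter lpar K^o _ (index_enum _) xpredT _ (x :: s))).
  apply: eq_shsum => I J _ _; rewrite /h.
  (* q x_I is expanded along the e'_i. Since W (e_i, x_I) is b (e_i, q x_I) up to sign, the sum over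
     i collapses to the single value W (q x_I, x_J). *)
  have hatq : hat W (ql I :: J) = \sum_i b (tnth e i) (q (vecs I)) * hat W (eletter' he' i :: J).
    have mW1 l : hat W (l :: J) = (maxn (size J).+1 1)%:R^-1 * ((size J).+1)`!%:R
        * W (lvec l :: vecs J).
      apply: (mulfI (maxn1_neq0 charK (size (l :: J)))).
      rewrite (hat_symmetric charK _ symmetric_W) /= !mulrA divff ?mul1r //.
      exact: maxn1_neq0.
    rewrite mW1 -[lvec (ql I)]/(q (vecs I)).
    rewrite -[in LHS](dual_expandr qb be dual (q (vecs I))).
    rewrite (multilinear_sum [::] _ _ _ _ multilinear_W) mulr_sumr.
    apply: eq_bigr => i _; rewrite mW1 [RHS]mulrCA; congr (_ * _).
    have := multilinear_W [::] (vecs J) (b (tnth e i) (q (vecs I))) (tnth e' i) 0.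
    rewrite addr0 => ->.
    by rewrite (multilinear0 (s := 0 :: vecs J) multilinear_W) ?mem_head // addr0.
  rewrite hatq; apply: eq_bigr => i _.
  rewrite hat_W_cons (symplectic_hom qb _ (q_degree I)).
  rewrite (quadratic_sym qb _ (he i)).
  have [->|bi] := eqVneq (b (tnth e i) (q (vecs I))) 0.
    by rewrite !mulr0 !mul0r scaler0.
  have [->|/(hat_degree degree_W) /= pJ] := eqVneq (hat W (eletter' he' i :: J)) 0.
    by rewrite !mulr0 scaler0.
  have pI : lpar (eletter he i) = ~~ parw I.
    case: qb => _ bdeg _ _; have := bdeg _ _ _ _ (he i) (q_degree I) bi.
    rewrite -lpar_ql /letter_parity /odd_letter -!/(oddz _) /= => dI.
    have -> : dg i = - (wdeg (degs I) + 2) by lia.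
    by rewrite !oddzD oddzN !oddzD.
  have pD : oddz (dg i) = parw I.
    by have := pI; rewrite /letter_parity /odd_letter -!/(oddz _) oddzD /= addbT => /negb_inj.
  have oddqI : odd_letter (wdeg (degs I) + 2) = ~~ parw I by rewrite -lpar_ql.
  move: pJ; rewrite (lpar_eletter' he he') pI pD oddqI => pJ.
  rewrite [LHS]mulrA; congr (_ * _); rewrite !mulrA -!signr_addb -[RHS]mul1r.
  congr (_ * _); rewrite -[RHS]/(sgn false); congr (_ ^+ nat_of_bool _).
  by move: pJ; case: (parw I); case: (parw J).
rewrite /= (shsumC lpar (fun I J => h (x :: I) J)).
set S := shsum lpar (fun I J => sgn (lpar x && parw I) *: h I (x :: J)) s.
have -> : shsum lpar (fun I J => sgn (parw I && parw J) *: h (x :: J) I) s = S.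
  apply: eq_shsum => I J _ _; rewrite (hC I (x :: J)).
  rewrite [LHS]mulrA -signr_addb; congr (_ ^+ nat_of_bool _ * _) => /=.
  by case: (lpar x); case: (parw I); case: (parw J).
suff -> : S = 0 by rewrite addr0.
pose z := shsum lpar (fun I J => q (q (vecs I) :: vecs J)) s.
have z0 : z = 0.
  (* The equation [Q, Q] = 0 concerns non empty words only; on the empty word q vanishes. *)
  case: s @S @z => [|y s] S z.
    rewrite /z /=; have /= := q_degree [::]; case: LQ => -[_ _ Q0 _ _] _ _.
    have q0 : q [::] = 0.
      by rewrite /corestriction Q0 big1 // => i _; rewrite mcoeff0 scale0r.
    by rewrite q0 (multilinear0 multilinear_q) // mem_head.
  case: LQ => -[_ _ Q0 _ _] /(_ _ _ (letters_hword (y :: s)) isT).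
  have szs : size (y :: s) = size (vecs (y :: s)) by rewrite size_map.
  (* Q is odd, so the two sums of the commutator add up to 2 c. The sum c omits empty I, whose term
     in z is 0 because q vanishes on the empty word. *)
  rewrite /Defs.commutator /degsign expr1 scaleN1r opprK.
  set c := \sum_(_ | _) _.
  have -> : c = z.
    transitivity (shsum lpar (fun I J =>
        if I is [::] then 0 else q (q (vecs I) :: vecs J)) (y :: s)).
      rewrite -(shsum_has_masks (fun I J => q (q (vecs I) :: vecs J)) szs).
      by apply: eq_bigr => i _; rewrite /sel /cosel -!map_mask.
    apply: eq_shsum => -[|l I] J _ _ //.
    rewrite /= (_ : q [::] = 0); last first.
      by rewrite /corestriction Q0 big1 // => i _; rewrite mcoeff0 scale0r.
    by rewrite (multilinear0 multilinear_q) // mem_head.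
  move/eqP; rewrite -mulr2n -scaler_nat scaler_eq0 => /orP[|/eqP //].
  by rewrite (negPf (pchar0_succ_neq0 charK 1)).
transitivity (sgn (lpar x && parw s) * B z (lvec x)); last first.
  by rewrite z0 (bil0l bilB) mulr0.
have Bsh f r : B (shsum lpar f r) (lvec x)
    = shsum lpar (fun I J => B (f I J) (lvec x) : K^o) r.
  elim: r f => //= y r IHr f.
  have := bilDl bilB (lvec x) 1 => lin1; rewrite -[X in B (X + _) _]scale1r lin1 mul1r !IHr.
  congr (_ + _); apply: eq_shsum => I J _ _.
  by have := bilDl bilB (lvec x) (sgn (lpar y && parw I)) (f I (y :: J)) 0;
    rewrite addr0 (bil0l bilB) addr0.
rewrite /z Bsh.
rewrite -[RHS](shsumZ lpar (_ : K)); apply: eq_shsum => I J pIJ _.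
rewrite /h; have := @swapsym_hat K V G W [::] (ql I) x J; rewrite /= => ->.
have := hat_W_cons x (ql I :: J); rewrite /= => ->.
rewrite -pIJ lpar_ql.
rewrite [LHS]mulrA [LHS]mulrA; congr (_ * _); rewrite -!signr_addb.
congr (_ ^+ nat_of_bool _).
by case: (lpar x); case: (parw I); case: (parw J).
Qed.

End MasterEquation.

Theorem proposition6p3 (K : fieldType) (charK : [pchar K] =i pred0)
    (V : vectType K) (G : grading V) :
  (forall (br brS : mform V -> mform V -> mform V) (W : mform V),
     pinczon_lie_algebra G br brS W ->
     exists2 B : V -> V -> K^o,
       unique (associated_symplectic G br) B
       & exists! Q : seq V -> tensor K V,
           [/\ coderivation G Q, B_quadratic G B Q & W =1 form_of B Q])
  /\
  (forall (b : V -> V -> K^o) (br : mform V -> mform V -> mform V)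
     (Q : seq V -> tensor K V),
     quadratic_form G b -> pinczon_bracket G br -> associated G br b ->
     Linfty G Q -> B_quadratic G (symplectic_of G b) Q ->
     exists brS : mform V -> mform V -> mform V,
       pinczon_lie_algebra G br brS (form_of (symplectic_of G b) Q)
       /\ (forall brS' : mform V -> mform V -> mform V,
             pinczon_lie_algebra G br brS' (form_of (symplectic_of G b) Q) ->
             forall F F' : mform V,
               symmetric_mform G F -> symmetric_mform G F' ->
               brS' F F' =1 brS F F')).
Proof.
split=> [br brS W [pb _ sW [dW W2] _]|b br Q qb pb ab LQ BQ].
  have [b qb bb] := bracket_form_exists charK pb.
  exists (symplectic_of G b).
    split.
      split; first exact: symplectic_of_symplectic.
      by exists b; split=> //; apply: bracket_form_associated.
    (* Another candidate comes from a form b' associated to the same bracket, and b' is determined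
       by the brackets of linear forms. *)
    move=> B' [_ [b' [qb' ab' ->]]]; congr (symplectic_of G _).
    apply: (bracket_form_uniq charK pb qb bb qb').
    exact: associated_bracket_form.
  have [Q cQ WQ] := form_of_coderivation_exists charK qb sW dW W2.
  exists Q; split; first by split; rewrite ?/B_quadratic -?WQ //; case: (symmetric_cyclic sW).
  move=> Q' [cQ' _ WQ']; apply: (form_of_inj charK qb cQ cQ') => s.
  by rewrite -WQ' WQ.
have sW := symmetric_W qb LQ BQ; have cW := symmetric_cyclic sW.
have indS := sym_br_induced charK pb qb ab.
exists (sym_br G br); split.
  split=> //; first by split; [apply: degree_W|apply: W_small].
  move=> s; rewrite indS //.
  have [m [e [dg [be he]]]] := homogeneous_basis G.
  have [e' dual] := dual_basis_exists qb be.
  have he' := dual_homogeneous qb be he dual.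
  have c0 := cyclic0 G; rewrite (hat_ext charK (F' := fun=> 0) _ c0.1) => [||t].
  - rewrite sym_form_symmetric ?mulr0 //; split; first by case: c0.
    by apply/koszul_symmetricP => [|u x y v]; [case: c0|rewrite /onl scaler0].
  - exact: (br_closed pb cW cW).1.
  rewrite (hat_br_general charK pb ab be he he' dual) // shbr_W //.
  by rewrite /hat_form (ksym0 _ _ t) mulr0.
move=> brS' [_ indS' _ _ _] F F' sF sF' s.
(* Every symmetric form is in the image of Sym, where the induced bracket is prescribed. *)
rewrite -(sym_form_normalize charK sF) -(sym_form_normalize charK sF').
have cN A : symmetric_mform G A -> cyclic_mform G (sym_normalize A).
  by move=> sA; apply/symmetric_cyclic/symmetric_normalize.
by rewrite indS' ?indS //; apply: cN.
Qed.
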